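(* Let $\alpha>0$, $\beta\in\mathbb{R}$ and $z_0>0$. For $\varepsilon>0$ let $u$ be the solution of the cubic nonlinear Schr\''odinger equation on $\mathbb{T}=[0,2\pi]$ (periodic boundary conditions) $$i\partial_t u+\Delta u=\varepsilon^{\alpha}|u|^2u,\qquad u(0,x)=\sum_{k\in\mathbb{Z}}c_k\eta_k e^{ikx},$$ with the random initial data described in the context, and let $t=t(\varepsilon)>0$ satisfy $t\sim\varepsilon^{-\beta}$. If either (i) $\alpha-1>\beta$, or (ii) $\alpha-1=\beta$ and $\beta>0$, then $$\lim_{\varepsilon\to0^+}\varepsilon\,\log\mathbb{P}\Big(\sup_{x\in\mathbb{T}}|u(t,x)|>z_0\,\varepsilon^{-1/2}\Big)=-\frac{z_0^2}{\sum_{k\in\mathbb{Z}}c_k^2}.$$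
   Context: Random initial data: the coefficients are $c_k=a\,e^{-b|k|}$ for all $k\in\mathbb{Z}$, or $c_k=a\,e^{-b|k|^2}$ for all $k\in\mathbb{Z}$, where $a,b>0$ are fixed. The $\{\eta_k\}_{k\in\mathbb{Z}}$ are independent, identically distributed complex Gaussian random variables with $\mathbb{E}\eta_k=0$, $\mathbb{E}[\eta_k\eta_j]=0$ and $\mathbb{E}[\eta_k\overline{\eta_j}]=\delta_{kj}$ for $k,j\in\mathbb{Z}$. Almost surely the initial datum lies in $\bigcap_{s\ge0}H^s(\mathbb{T})$, and $u$ denotes the (almost surely defined) unique global solution. The notation $t\sim\varepsilon^{-\beta}$ means that there is a constant $C\ge1$, independent of $\varepsilon$, with $C^{-1}\varepsilon^{-\beta}\le t(\varepsilon)\le C\varepsilon^{-\beta}$ for all small $\varepsilon>0$. *)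

(* Defs.v *)
From HB Require Import structures.
From mathcomp Require Import all_boot all_order all_algebra.
From mathcomp Require Import complex.
From mathcomp Require Import all_classical all_reals all_analysis.
Set Implicit Arguments.
Unset Strict Implicit.
Unset Printing Implicit Defensive.
Import Order.TTheory GRing.Theory Num.Theory.
Import numFieldNormedType.Exports.
Import ComplexField.Normc.
Local Open Scope classical_set_scope.
Local Open Scope ring_scope.
Local Open Scope complex_scope.

(* [R[i]] carries no topology over [R] and no sigma-algebra in the libraries
   used here: it is handled through its real and imaginary parts. *)
Section complex_functions.
Variable R : realType.

Definition reC (z : R[i]) : R := complex.Re z.
Definition imC (z : R[i]) : R := complex.Im z.

Definition cis (theta : R) : R[i] := cos theta +i* sin theta.

Definition cderivable (f : R -> R[i]) (x : R) : Prop :=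
  derivable (reC \o f) x 1 /\ derivable (imC \o f) x 1.

Definition cderive (f : R -> R[i]) (x : R) : R[i] :=
  derive1 (reC \o f) x +i* derive1 (imC \o f) x.

Definition ccontinuous2 (v : R -> R -> R[i]) : Prop :=
  continuous (fun p : R * R => reC (v p.1 p.2)) /\
  continuous (fun p : R * R => imC (v p.1 p.2)).

(* Sum over all the integers, as the limit of the sums over -N <= k <= N. *)
Definition is_zsum (f : int -> R[i]) (s : R[i]) : Prop :=
  (fun N : nat => normc (\sum_(j < (N.*2).+1) f (j%:Z - N%:Z) - s)) @ \oo
    --> (0 : R).

End complex_functions.

Arguments reC {R} z.
Arguments imC {R} z.

Section nls.
Variable R : realType.
Implicit Types v : R -> R -> R[i].

Definition dt v (t x : R) : R[i] := cderive (v ^~ x) t.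
Definition dx v (t x : R) : R[i] := cderive (v t) x.

(* Global-in-time classical (C^1 in time, C^2 in space) solutions, 2pi-periodic
   in space, of  i v_t + v_xx = lam |v|^2 v.  This class contains the solutions
   in C(R; H^s) for all s, and the Cauchy problem has at most one solution in
   it. *)
Definition nls_solution (lam : R) v : Prop :=
  [/\ forall t x, v t (x + 2 * pi) = v t x,
      forall t x, [/\ cderivable (v ^~ x) t, cderivable (v t) x
                    & cderivable (dx v t) x],
      [/\ ccontinuous2 v, ccontinuous2 (dt v), ccontinuous2 (dx v)
        & ccontinuous2 (dx (dx v))]
    & forall t x, (0 +i* 1) * dt v t x + dx (dx v) t x
                  = (lam * normc (v t x) ^+ 2)%:C * v t x].

End nls.

Section random.
Context (d : measure_display) (Omega : measurableType d) (R : realType).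
Variable P : probability Omega R.
Implicit Types (X : Omega -> R) (Z : Omega -> R[i]) (eta : int -> Omega -> R[i]).

Definition pairC (z : R[i]) : R * R := (reC z, imC z).

Definition complex_rv Z : Prop :=
  measurable_fun setT (pairC \o Z : Omega -> (R * R)%type).

(* The degenerate case is separate: [normal_prob m 0] is not a Dirac mass. *)
Definition real_gaussian X : Prop :=
  (exists m s : R, 0 < s /\ forall A : set R, measurable A ->
     P (X @^-1` A) = normal_prob m s A) \/
  (exists m : R, forall A : set R, measurable A ->
     P (X @^-1` A) = dirac m A).

(* The pair of real and imaginary parts is a Gaussian vector of R^2. *)
Definition complex_gaussian Z : Prop :=
  complex_rv Z /\
  forall p q : R, real_gaussian (fun w => p * reC (Z w) + q * imC (Z w)).

Definition independent eta : Prop :=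
  forall (s : seq int) (A : int -> set (R * R)),
    uniq s -> (forall k, measurable (A k)) ->
    P (\bigcap_(k in [set` s]) ((pairC \o eta k) @^-1` A k))
    = (\prod_(k <- s) P ((pairC \o eta k) @^-1` A k))%E.

Definition identically_distributed eta : Prop :=
  forall (k j : int) (A : set (R * R)), measurable A ->
    P ((pairC \o eta k) @^-1` A) = P ((pairC \o eta j) @^-1` A).

Definition is_expectation Z (z : R[i]) : Prop :=
  ('E_P[reC \o Z] = (reC z)%:E /\ 'E_P[imC \o Z] = (imC z)%:E)%E.

Definition standard_complex_gaussians eta : Prop :=
  [/\ forall k, complex_gaussian (eta k),
      independent eta,
      identically_distributed eta
    & [/\ forall k, is_expectation (eta k) 0,
          forall k j, is_expectation (fun w => eta k w * eta j w) 0
        & forall k j,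
            is_expectation (fun w => eta k w * conjc (eta j w)) (k == j)%:R]].

End random.

Section statement_notions.
Variable R : realType.

Definition coefficients (a b : R) (c : int -> R) : Prop :=
  (forall k, c k = a * expR (- b * `|k%:~R|)) \/
  (forall k, c k = a * expR (- b * `|k%:~R| ^+ 2)).

(* The Fourier series of the initial datum sums to [g] at every point. *)
Definition initial_datum (c : int -> R) (e : int -> R[i]) (g : R -> R[i]) :
    Prop :=
  forall x : R, is_zsum (fun k => (c k)%:C * e k * cis (k%:~R * x)) (g x).

Definition sup_torus (g : R -> R[i]) : \bar R :=
  ereal_sup [set (normc (g x))%:E | x in `[0, 2 * pi]%classic].

(* t(eps) ~ eps^(-beta) as eps -> 0+ *)
Definition time_scale (beta : R) (t : R -> R) : Prop :=
  exists C : R, 1 <= C /\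
    \forall eps \near 0^'+,
      C^-1 * eps `^ (- beta) <= t eps /\ t eps <= C * eps `^ (- beta).

(* The solution being defined only almost surely, an event about it is
   determined up to a null set, so need not be measurable; its probability is
   that of the completion of [P], i.e. its outer measure, which coincides with
   [P] on measurable sets. *)
Definition Prob (d : measure_display) (Omega : measurableType d)
  (P : probability Omega R) (E : set Omega) : \bar R := mu_ext P E.

End statement_notions.

(* Main.v *)
Require Import Defs.
From HB Require Import structures.
From mathcomp Require Import all_boot all_order all_algebra.
From mathcomp Require Import complex finmap.
From mathcomp Require Import all_classical all_reals all_analysis.
From mathcomp Require Import measurable_realfun.
From mathcomp Require Import ring lra zify.
Import Order.TTheory GRing.Theory Num.Theory.
Import numFieldNormedType.Exports.
Set Implicit Arguments.
Unset Strict Implicit.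
Unset Printing Implicit Defensive.
Import ComplexField.Normc.
Local Open Scope classical_set_scope.
Local Open Scope ring_scope.
Local Open Scope complex_scope.

(* On the time scales considered the nonlinearity only rotates the Fourier
   modes. As long as the l^1 norm of the initial modes is K = O(eps^(-1/2)), a
   normal form transformation removes the nonresonant interactions and shows
   that, up to a phase common to all modes and an l^1 error o(K),
     v_k(t) = exp (i (lam |v_k(0)|^2 t - k^2 t)) v_k(0),     lam = eps^alpha.
   Hence sup |u(t)| <= sum_k c_k |eta_k| + o(K), and by Cauchy-Schwarz the upper
   bound reduces to the deviations of sum_{|k| <= N} |eta_k|^2, the modes with
   |k| > N being negligible at the exponential scale. For the lower bound,
   sqrt(eps) eta_k is asked to be close to z c_k / sum_j c_j^2 times the phase
   that the resonant rotation undoes at time t, so that all the modes add up at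
   the point x = 0. *)

(** * Calculus of complex-valued functions *)

Section complex_modulus.
Variable R : realType.
Implicit Types z w : R[i].

Lemma normcE z : normc z = Num.sqrt (reC z ^+ 2 + imC z ^+ 2).
Proof. by case: z. Qed.

Lemma normc_ge0 z : 0 <= normc z.
Proof. by rewrite normcE sqrtr_ge0. Qed.

Lemma sqr_normcE z : normc z ^+ 2 = reC z ^+ 2 + imC z ^+ 2.
Proof. by rewrite normcE sqr_sqrtr// addr_ge0// sqr_ge0. Qed.

Lemma normc_distrC z w : normc (z - w) = normc (w - z).
Proof. by rewrite -opprB normcN. Qed.

Lemma ler_normcD z w : normc (z + w) <= normc z + normc w.
Proof. exact: le_normcD. Qed.

Lemma ler_normcB z w : normc (z - w) <= normc z + normc w.
Proof. by rewrite -(normcN w) le_normcD. Qed.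

Lemma ler_normc_sub z w : normc z - normc w <= normc (z - w).
Proof. by rewrite lerBlDr -{1}(subrK w z) le_normcD. Qed.

Lemma ler_normc_sum (I : Type) (r : seq I) (P : pred I) (F : I -> R[i]) :
  normc (\sum_(i <- r | P i) F i) <= \sum_(i <- r | P i) normc (F i).
Proof.
elim/big_rec2: _ => [|i x z _ le_zx]; first by rewrite normc0.
by rewrite (le_trans (ler_normcD _ _))// lerD2l.
Qed.

Lemma normc_conj z : normc (conjc z) = normc z.
Proof. by case: z => x y /=; rewrite sqrrN. Qed.

Lemma normc_real (x : R) : normc x%:C = `|x|.
Proof. by rewrite /= expr0n/= addr0 sqrtr_sqr. Qed.

Lemma normc_i : normc ('i : R[i]) = 1.
Proof. by rewrite /= expr0n/= expr1n add0r sqrtr1. Qed.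

Lemma normc_cis (x : R) : normc (cis x) = 1.
Proof. by rewrite /cis /= cos2Dsin2 sqrtr1. Qed.

Lemma normr_reC_le z : `|reC z| <= normc z.
Proof.
by rewrite normcE -sqrtr_sqr ler_sqrt ?lerDl ?sqr_ge0// addr_ge0 ?sqr_ge0.
Qed.

Lemma normr_imC_le z : `|imC z| <= normc z.
Proof.
by rewrite normcE -sqrtr_sqr ler_sqrt ?lerDr ?sqr_ge0// addr_ge0 ?sqr_ge0.
Qed.

Lemma normc_le_reim z : normc z <= `|reC z| + `|imC z|.
Proof.
rewrite -(ler_pXn2r (ltn0Sn 1)) ?nnegrE ?normc_ge0 ?addr_ge0//.
rewrite sqr_normcE sqrrD !real_normK ?num_real// -addrA lerD2l lerDr.
by rewrite mulrn_wge0// mulr_ge0.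
Qed.

Lemma cisD (x y : R) : cis (x + y) = cis x * cis y.
Proof. by rewrite /cis cosD sinD; simpc; congr (_ +i* _); rewrite addrC. Qed.

Lemma cis0 : cis (0 : R) = 1.
Proof. by rewrite /cis cos0 sin0. Qed.

Lemma cisN (x : R) : cis (- x) = conjc (cis x).
Proof. by rewrite /cis cosN sinN. Qed.

Lemma reCD z w : reC (z + w) = reC z + reC w. Proof. by case: z; case: w. Qed.
Lemma imCD z w : imC (z + w) = imC z + imC w. Proof. by case: z; case: w. Qed.
Lemma reCN z : reC (- z) = - reC z. Proof. by case: z. Qed.
Lemma imCN z : imC (- z) = - imC z. Proof. by case: z. Qed.
Lemma reCM z w : reC (z * w) = reC z * reC w - imC z * imC w.
Proof. by case: z; case: w. Qed.
Lemma imCM z w : imC (z * w) = reC z * imC w + imC z * reC w.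
Proof. by case: z => a b; case: w => c e; simpc => /=. Qed.
Lemma reCconj z : reC (conjc z) = reC z. Proof. by case: z. Qed.
Lemma imCconj z : imC (conjc z) = - imC z. Proof. by case: z. Qed.

Lemma reim_eq z w : reC z = reC w -> imC z = imC w -> z = w.
Proof. by case: z => ? ?; case: w => ? ? /= -> ->. Qed.

Lemma mulCconj z : z * conjc z = (normc z ^+ 2)%:C.
Proof.
by rewrite sqr_normcE; apply: reim_eq; rewrite ?reCM ?imCM reCconj imCconj/=; ring.
Qed.

End complex_modulus.

Section complex_derivative.
Variable R : realType.
Implicit Types f g : R -> R[i].

Definition is_cderive f (x : R) (df : R[i]) :=
  is_derive x 1 (reC \o f) (reC df) /\ is_derive x 1 (imC \o f) (imC df).

Lemma cderivableP f x : cderivable f x -> is_cderive f x (cderive f x).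
Proof.
by case=> /derivableP d1 /derivableP d2; split; rewrite /cderive /= derive1E.
Qed.

Lemma is_cderiveE f x df : is_cderive f x df -> cderive f x = df.
Proof.
by case=> d1 d2; apply: reim_eq; rewrite /cderive/= derive1E derive_val.
Qed.

Lemma is_cderive_eq f x df dg : is_cderive f x df -> df = dg -> is_cderive f x dg.
Proof. by move=> ? <-. Qed.

Lemma is_cderive_ext f g x df : f =1 g -> is_cderive f x df -> is_cderive g x df.
Proof. by move=> /funext <-. Qed.

Lemma is_cderive_cst (z : R[i]) x : is_cderive (fun=> z) x 0.
Proof. by split; exact: is_derive_cst. Qed.

Lemma is_cderiveD f g x df dg : is_cderive f x df -> is_cderive g x dg ->
  is_cderive (fun y => f y + g y) x (df + dg).
Proof.
move=> [f1 f2] [g1 g2]; split.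
- rewrite reCD (_ : _ \o _ = (reC \o f) + (reC \o g)); first exact: is_deriveD.
  by apply/funext => y /=; rewrite reCD.
- rewrite imCD (_ : _ \o _ = (imC \o f) + (imC \o g)); first exact: is_deriveD.
  by apply/funext => y /=; rewrite imCD.
Qed.

Lemma is_cderiveN f x df : is_cderive f x df -> is_cderive (fun y => - f y) x (- df).
Proof.
move=> [f1 f2]; split.
- rewrite reCN (_ : _ \o _ = - (reC \o f)); first exact: is_deriveN.
  by apply/funext => y /=; rewrite reCN.
- rewrite imCN (_ : _ \o _ = - (imC \o f)); first exact: is_deriveN.
  by apply/funext => y /=; rewrite imCN.
Qed.

Lemma is_cderiveB f g x df dg : is_cderive f x df -> is_cderive g x dg ->
  is_cderive (fun y => f y - g y) x (df - dg).
Proof. by move=> hf hg; apply: is_cderiveD => //; exact: is_cderiveN. Qed.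

Lemma is_cderiveM f g x df dg : is_cderive f x df -> is_cderive g x dg ->
  is_cderive (fun y => f y * g y) x (df * g x + f x * dg).
Proof.
move=> [f1 f2] [g1 g2]; split.
- rewrite (_ : _ \o _ = (reC \o f) * (reC \o g) - (imC \o f) * (imC \o g)).
    apply: is_derive_eq (is_deriveB (is_deriveM f1 g1) (is_deriveM f2 g2)) _.
    rewrite /GRing.scale/= reCD !reCM -!/(reC _) -!/(imC _); ring.
  by apply/funext => y /=; rewrite reCM.
- rewrite (_ : _ \o _ = (reC \o f) * (imC \o g) + (imC \o f) * (reC \o g)).
    apply: is_derive_eq (is_deriveD (is_deriveM f1 g2) (is_deriveM f2 g1)) _.
    rewrite /GRing.scale/= imCD !imCM -!/(reC _) -!/(imC _); ring.
  by apply/funext => y /=; rewrite imCM.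
Qed.

Lemma is_cderiveMl (z : R[i]) f x df : is_cderive f x df ->
  is_cderive (fun y => z * f y) x (z * df).
Proof.
move=> hf; apply: is_cderive_eq (is_cderiveM (is_cderive_cst z x) hf) _.
by rewrite mul0r add0r.
Qed.

Lemma is_cderive_conj f x df : is_cderive f x df ->
  is_cderive (fun y => conjc (f y)) x (conjc df).
Proof.
move=> [f1 f2]; split.
- by rewrite reCconj (_ : _ \o _ = reC \o f)//; apply/funext => y /=; rewrite reCconj.
- rewrite imCconj (_ : _ \o _ = - (imC \o f)); first exact: is_deriveN.
  by apply/funext => y /=; rewrite imCconj.
Qed.

Lemma is_cderive_sum (I : Type) (r : seq I) (P : pred I) (F : I -> R -> R[i])
    (x : R) (dF : I -> R[i]) :
  (forall i, is_cderive (F i) x (dF i)) ->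
  is_cderive (fun y => \sum_(i <- r | P i) F i y) x (\sum_(i <- r | P i) dF i).
Proof.
move=> h; elim: r => [|i r ih].
  rewrite big_nil; apply: is_cderive_ext (is_cderive_cst 0 x).
  by move=> y; rewrite big_nil.
have E y : \sum_(j <- i :: r | P j) F j y =
  (if P i then F i y else 0) + \sum_(j <- r | P j) F j y.
  by rewrite big_cons; case: (P i); rewrite ?add0r.
apply: (is_cderive_ext (fun y => esym (E y))).
rewrite big_cons; case: (P i); first exact: is_cderiveD.
by apply: is_cderive_ext ih => y; rewrite add0r.
Qed.

Lemma is_cderive_cis (m : R) x :
  is_cderive (fun y => cis (m * y)) x ('i * m%:C * cis (m * x)).
Proof.
have l : is_derive x 1 (fun y : R => m * y) m.
  rewrite (_ : (fun y => m * y) = m \*: id).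
    by apply: is_derive_eq; rewrite /GRing.scale/= mulr1.
  by apply/funext => y /=.
split.
- rewrite (_ : _ \o _ = cos \o (fun y => m * y)); last by apply/funext.
  have -> : reC ('i * m%:C * cis (m * x)) = - m * sin (m * x).
    by rewrite !reCM imCM /=; ring.
  by apply: is_derive_eq; rewrite /GRing.scale/=; ring.
- rewrite (_ : _ \o _ = sin \o (fun y => m * y)); last by apply/funext.
  have -> : imC ('i * m%:C * cis (m * x)) = m * cos (m * x).
    by rewrite !imCM reCM /=; ring.
  by apply: is_derive_eq; rewrite /GRing.scale/=; ring.
Qed.

End complex_derivative.

(** * Resonant approximation of the truncated system *)

Section gronwall.
Variable R : realType.

Lemma is_derive_continuous (f : R -> R) (x df : R) :
  is_derive x 1 f df -> {for x, continuous f}.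
Proof. by case=> h _; exact/differentiable_continuous/derivable1_diffP. Qed.

Lemma is_derive_le (g dg : R -> R) (a b : R) : a <= b ->
  (forall x, a <= x <= b -> is_derive x 1 g (dg x)) ->
  (forall x, a <= x <= b -> dg x <= 0) -> g b <= g a.
Proof.
move=> ab gd dg0.
have [||c cab e] := @MVT_segment _ g dg _ _ ab.
- by move=> x; rewrite in_itv/= => /andP[ax xb]; apply: gd; rewrite !ltW.
- apply: continuous_in_subspaceT => x /set_mem /=; rewrite in_itv/= => xab.
  exact: is_derive_continuous (gd _ xab).
- move: cab; rewrite in_itv/= => cab.
  by rewrite -subr_le0 e mulr_le0_ge0 ?dg0 ?subr_ge0.
Qed.

(* [|z|] is not differentiable at 0, hence the smoothing by [kappa]. *)
Definition smooth_norm (kappa : R) (z : R[i]) : R :=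
  Num.sqrt (reC z ^+ 2 + imC z ^+ 2 + kappa ^+ 2).

Lemma normc_le_smooth kappa z : normc z <= smooth_norm kappa z.
Proof.
rewrite normcE /smooth_norm ler_sqrt ?lerDl ?sqr_ge0//.
by rewrite !addr_ge0 ?sqr_ge0.
Qed.

Lemma smooth_le_normc kappa z : 0 <= kappa ->
  smooth_norm kappa z <= normc z + kappa.
Proof.
move=> k0; have n0 := normc_ge0 z.
rewrite /smooth_norm -(ler_pXn2r (ltn0Sn 1)) ?nnegrE ?sqrtr_ge0 ?addr_ge0//.
rewrite sqr_sqrtr ?addr_ge0 ?sqr_ge0// sqrrD sqr_normcE.
by rewrite [leRHS]addrAC lerDl mulrn_wge0// mulr_ge0.
Qed.

Lemma smooth_norm_gt0 kappa z : 0 < kappa -> 0 < smooth_norm kappa z.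
Proof.
by move=> k0; rewrite sqrtr_gt0 ltr_wpDl ?exprn_gt0// addr_ge0 ?sqr_ge0.
Qed.

Lemma is_derive_smooth_norm kappa (f : R -> R[i]) x df : 0 < kappa ->
  is_cderive f x df ->
  is_derive x 1 (fun y => smooth_norm kappa (f y))
    ((reC (f x) * reC df + imC (f x) * imC df) / smooth_norm kappa (f x)).
Proof.
move=> k0 [f1 f2].
have s0 := smooth_norm_gt0 (f x) k0.
have s1 : 0 < reC (f x) ^+ 2 + imC (f x) ^+ 2 + kappa ^+ 2.
  by rewrite -sqrtr_gt0.
pose q := fun y => reC (f y) ^+ 2 + imC (f y) ^+ 2 + kappa ^+ 2.
have dq : is_derive x 1 q (2 * (reC (f x) * reC df + imC (f x) * imC df)).
  rewrite (_ : q = (reC \o f) * (reC \o f) + (imC \o f) * (imC \o f)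
    + cst (kappa ^+ 2)); last by apply/funext => y /=; rewrite /q !expr2.
  have := is_deriveD (is_deriveD (is_deriveM f1 f1) (is_deriveM f2 f2))
    (is_derive_cst (kappa ^+ 2) x (1 : R)).
  move=> h; apply: is_derive_eq h _.
  by rewrite /GRing.scale/= -!/(reC _) -!/(imC _); ring.
have := @is_derive1_comp _ Num.sqrt q x _ _ (is_derive1_sqrt s1) dq.
move=> h; apply: is_derive_eq h _.
rewrite -/(smooth_norm kappa (f x)); field.
by rewrite gt_eqF.
Qed.

Lemma smooth_norm_slope kappa (z dz : R[i]) : 0 < kappa ->
  (reC z * reC dz + imC z * imC dz) / smooth_norm kappa z <= normc dz.
Proof.
move=> k0; rewrite ler_pdivrMr ?smooth_norm_gt0//.
apply: (@le_trans _ _ (normc dz * normc z)); last first.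
  by rewrite ler_wpM2l ?normc_ge0// normc_le_smooth.
rewrite -[in leRHS](normc_conj dz) mulrC -normcM.
apply: le_trans (normr_reC_le _); apply: le_trans (ler_norm _).
rewrite reCM reCconj imCconj; lra.
Qed.

Lemma gronwall_normc (I : finType) (f df : I -> R -> R[i]) (T L m : R) :
  0 <= T -> 0 <= L -> 0 <= m ->
  (forall k s, is_cderive (f k) s (df k s)) ->
  (forall s : R, 0 <= s <= T ->
    \sum_k normc (df k s) <= L * \sum_k normc (f k s) + m) ->
  \sum_k normc (f k T) <= (\sum_k normc (f k 0) + m * T) * expR (L * T).
Proof.
move=> T0 L0 m0 fd dfle.
suff H kappa : 0 < kappa -> \sum_k normc (f k T) <=
    (\sum_k normc (f k 0) + m * T) * expR (L * T)
    + kappa * (#|I|%:R * expR (L * T)).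
  apply/ler_addgt0Pr => e e0.
  have c0 : 0 < #|I|%:R * expR (L * T) + 1.
    by rewrite ltr_wpDl// mulr_ge0 ?ler0n ?expR_ge0.
  apply: le_trans (H (e / (#|I|%:R * expR (L * T) + 1)) _) _.
    by rewrite divr_gt0.
  rewrite lerD2l mulrAC ler_pdivrMr//.
  by apply: ler_wpM2l; rewrite ?lerDl// ltW.
move=> k0.
pose h s := \sum_k smooth_norm kappa (f k s).
pose dh s := \sum_k (reC (f k s) * reC (df k s) + imC (f k s) * imC (df k s))
   / smooth_norm kappa (f k s).
have hd (s : R) : is_derive s 1 h (dh s).
  rewrite (_ : h = \sum_k ((fun y : R => smooth_norm kappa (f k y)) : R -> R)); last first.
    by apply/funext => y; rewrite fct_sumE.
  rewrite /dh; elim/big_ind2: _ => [|? ? ? ? ? ?|k _].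
  - exact: is_derive_cst.
  - exact: is_deriveD.
  - exact: is_derive_smooth_norm.
pose g s := h s * expR (- L * s) - m * s.
have El (s : R) : is_derive s 1 (fun y => expR (- L * y)) (- L * expR (- L * s)).
  have l : is_derive s 1 (fun y : R => - L * y) (- L).
    rewrite (_ : (fun y => - L * y) = (- L) \*: id); last by apply/funext.
    by apply: is_derive_eq; rewrite /GRing.scale/= mulr1.
  rewrite (_ : (fun y => expR (- L * y)) = expR \o (fun y => - L * y))//.
  by apply: is_derive_eq; rewrite mulrC.
have gd (s : R) : is_derive s 1 g ((dh s - L * h s) * expR (- L * s) - m).
  rewrite (_ : g = h * (fun y => expR (- L * y)) - m \*: id).
    have := is_deriveB (is_deriveM (hd s) (El s))
       (is_deriveZ m (is_derive_id s (1:R))).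
    move=> hh; apply: is_derive_eq hh _; rewrite /GRing.scale/= -/(h s); ring.
  by apply/funext => y; rewrite /g /=.
have hge s : 0 <= h s by apply: sumr_ge0 => k _; rewrite sqrtr_ge0.
have gT : g T <= g 0.
  apply: (is_derive_le T0 (fun s _ => gd s)) => s s0T.
  have d1 : dh s <= L * h s + m.
    apply: le_trans (le_trans (dfle s s0T) _).
      by apply: ler_sum => k _; exact: smooth_norm_slope.
    rewrite lerD2r ler_wpM2l//; apply: ler_sum => k _.
    exact: normc_le_smooth.
  rewrite subr_le0; apply: (@le_trans _ _ (m * expR (- L * s))).
    by rewrite ler_wpM2r ?expR_ge0//; lra.
  rewrite ler_piMr// -expR0 ler_expR; move/andP: s0T => [s0 _].
  by rewrite mulNr oppr_le0 mulr_ge0.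
have h0 : h 0 <= \sum_k normc (f k 0) + kappa * #|I|%:R.
  rewrite /h mulr_natr -sumr_const -big_split/=; apply: ler_sum => k _.
  by apply: smooth_le_normc; rewrite ltW.
apply: (@le_trans _ _ (h T)).
  by apply: ler_sum => k _; exact: normc_le_smooth.
move: gT; rewrite /g !mulr0 expR0 mulr1 subr0 lerBlDr => gT.
have -> : h T = h T * expR (- L * T) * expR (L * T).
  by rewrite -mulrA -expRD mulNr addNr expR0 mulr1.
rewrite mulrA -mulrDl ler_wpM2r ?expR_ge0//; lra.
Qed.

(* Bootstrap: a continuous quantity which is at most [K] as long as it is at
   most [K'] cannot jump over the gap. *)
Lemma continuity_method (g : R -> R) (T K K' : R) : K < K' ->
  continuous g -> g 0 <= K ->
  (forall t : R, 0 <= t <= T -> (forall s : R, 0 <= s <= t -> g s <= K') -> g t <= K) ->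
  forall t : R, 0 <= t <= T -> g t <= K.
Proof.
move=> KK' gc g0 step t /andP[t0 tT].
pose A := [set s | 0 <= s <= t /\ forall r, 0 <= r <= s -> g r <= K].
have A0 : A 0.
  split; first by rewrite lexx.
  by move=> r /andP[r0 r1]; rewrite (_ : r = 0)//; apply/eqP; rewrite eq_le r0 r1.
have hsA : has_sup A by split; [exists 0|exists t => s [/andP[]]].
pose s := sup A.
have s0 : 0 <= s by apply: sup_ubound A0; case: hsA.
have st : s <= t by apply: sup_le_ub; [exists 0|move=> ? [/andP[]]].
have lts r : 0 <= r -> r < s -> g r <= K.
  move=> r0 rs; have [a [_ aA] ra] := sup_gt (ex_intro _ 0 A0) rs.
  by apply: aA; rewrite r0 ltW.
have gs : g s <= K.
  move: s0; rewrite le_eqVlt => /predU1P[<-//|s0].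
  rewrite leNgt; apply/negP => Kg.
  have /cvgrPdist_lt /(_ (g s - K)) := gc s; rewrite subr_gt0 => /(_ Kg).
  move=> [e /= e0 he].
  pose r := s - Num.min (e / 2) (s / 2).
  have m0 : 0 < Num.min (e / 2) (s / 2) by rewrite lt_min !divr_gt0.
  have me : Num.min (e / 2) (s / 2) <= e / 2 by rewrite ge_min lexx.
  have ms : Num.min (e / 2) (s / 2) <= s / 2 by rewrite ge_min lexx orbT.
  have : `|g s - g r| < g s - K.
    by apply: he => /=; rewrite /r opprB addrC subrK gtr0_norm//; lra.
  have : g r <= K by apply: lts; rewrite /r; lra.
  by move=> h1 /(le_lt_trans (ler_norm _)); lra.
have les r : 0 <= r <= s -> g r <= K.
  move=> /andP[r0]; rewrite le_eqVlt => /predU1P[->//|]; exact: lts.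
move: st; rewrite le_eqVlt => /predU1P[<-//|st].
have /cvgrPdist_lt /(_ (K' - K)) := gc s; rewrite subr_gt0 => /(_ KK').
move=> [e /= e0 he].
pose r := s + Num.min (e / 2) (t - s).
have m0 : 0 < Num.min (e / 2) (t - s) by rewrite lt_min divr_gt0// subr_gt0.
have me : Num.min (e / 2) (t - s) <= e / 2 by rewrite ge_min lexx.
have ms : Num.min (e / 2) (t - s) <= t - s by rewrite ge_min lexx orbT.
have leK' x : 0 <= x <= r -> g x <= K'.
  move=> /andP[x0 xr]; have [xs|sx] := leP x s.
    by rewrite (le_trans (les _ _)) ?x0// ltW.
  have : `|g s - g x| < K' - K.
    by apply: he => /=; rewrite ltr0_norm /r in xr *; lra.
  by rewrite distrC => /(le_lt_trans (ler_norm _)); lra.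
have : A r.
  split; first by rewrite /r; lra.
  move=> x /andP[x0 xr]; apply: step; first by rewrite x0/= /r in xr *; lra.
  by move=> y /andP[y0 yx]; apply: leK'; rewrite y0 (le_trans yx).
move/sup_ubound; case: (hsA) => _ h /(_ h); rewrite -/s /r; lra.
Qed.

End gronwall.

Section cubic_convolution.
Variables (R : realType) (I : finType) (kap : I -> int).
Hypothesis kap_inj : injective kap.
Implicit Types (k a b c : I) (w : I -> R[i]).

Definition match4 k a b c := kap a - kap b + kap c == kap k.

Definition phase k a b c : int :=
  kap k ^+ 2 - kap a ^+ 2 + kap b ^+ 2 - kap c ^+ 2.

Definition resonant k a c := (a == k) || (c == k).

Definition triad w a b c : R[i] := w a * conjc (w b) * w c.

Definition cubic k (t : R) w : R[i] :=
  \sum_a \sum_b \sum_(c | match4 k a b c)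
    cis ((phase k a b c)%:~R * t) * triad w a b c.

Definition nonresonant_cubic k (t : R) w : R[i] :=
  \sum_a \sum_b \sum_(c | match4 k a b c && ~~ resonant k a c)
    cis ((phase k a b c)%:~R * t) * triad w a b c.

Definition mass w : R := \sum_k normc (w k) ^+ 2.

Definition l1 w : R := \sum_k normc (w k).

Lemma l1_ge0 w : 0 <= l1 w.
Proof. by apply: sumr_ge0 => k _; exact: normc_ge0. Qed.

Lemma normc_le_l1 w k : normc (w k) <= l1 w.
Proof.
rewrite /l1 (bigD1 k)//= lerDl; apply: sumr_ge0 => j _; exact: normc_ge0.
Qed.

Lemma phase_factor k a b c : match4 k a b c ->
  phase k a b c = 2 * (kap k - kap a) * (kap k - kap c).
Proof. rewrite /match4 /phase => /eqP <-; ring. Qed.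

Lemma phase_resonant k a b c : match4 k a b c -> resonant k a c ->
  phase k a b c = 0.
Proof.
move=> /phase_factor -> /orP[]/eqP ->; first by rewrite subrr mulr0 mul0r.
by rewrite subrr mulr0.
Qed.

Lemma phase_nonresonant k a b c : match4 k a b c -> ~~ resonant k a c ->
  1 <= `|(phase k a b c)%:~R : R|.
Proof.
move=> /phase_factor h; rewrite negb_or => /andP[ak ck].
have h0 : phase k a b c != 0.
  rewrite h !mulf_eq0 !subr_eq0 !(inj_eq kap_inj) !negb_or.
  by rewrite !(eq_sym k) ak ck.
by rewrite -intr_norm ler1z -gtz0_ge1 normr_gt0.
Qed.

Lemma sum_match4_le (M : I -> I -> I -> pred I) (F : I -> I -> I -> R) :
  (forall k a b c, M k a b c -> match4 k a b c) ->
  (forall a b c, 0 <= F a b c) ->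
  \sum_k \sum_a \sum_b \sum_(c | M k a b c) F a b c
    <= \sum_a \sum_b \sum_c F a b c.
Proof.
move=> hM F0; rewrite exchange_big/=; apply: ler_sum => a _.
rewrite exchange_big/=; apply: ler_sum => b _.
rewrite (exchange_big_dep xpredT)//=; apply: ler_sum => c _.
have [k Mk|] := pickP (fun k => M k a b c); last first.
  by move=> h; rewrite big_pred0.
rewrite (big_pred1 k)// => j; apply/idP/eqP => [Mj|->//].
apply: kap_inj; move: (hM _ _ _ _ Mk) (hM _ _ _ _ Mj).
by rewrite /match4 => /eqP <- /eqP <-.
Qed.

Lemma sum3_prod (f g h : I -> R) :
  \sum_a \sum_b \sum_c f a * g b * h c = (\sum_a f a) * (\sum_b g b) * (\sum_c h c).
Proof.
rewrite big_distrl/= big_distrl/=; apply: eq_bigr => a _.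
rewrite [f a * _]big_distrr big_distrl/=; apply: eq_bigr => b _.
by rewrite big_distrr/=.
Qed.

Lemma normc_triad w a b c :
  normc (triad w a b c) = normc (w a) * normc (w b) * normc (w c).
Proof. by rewrite /triad !normcM normc_conj. Qed.

Lemma ler_normc_sum3 (M : I -> I -> pred I) (F : I -> I -> I -> R[i]) :
  normc (\sum_a \sum_b \sum_(c | M a b c) F a b c)
  <= \sum_a \sum_b \sum_(c | M a b c) normc (F a b c).
Proof.
apply: le_trans (ler_normc_sum _ _ _) _; apply: ler_sum => a _.
apply: le_trans (ler_normc_sum _ _ _) _; apply: ler_sum => b _.
exact: ler_normc_sum.
Qed.

Lemma l1_cubic t w : \sum_k normc (cubic k t w) <= l1 w ^+ 3.
Proof.
apply: (@le_trans _ _ (\sum_k \sum_a \sum_b \sum_(c | match4 k a b c)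
    normc (w a) * normc (w b) * normc (w c))).
  apply: ler_sum => k _; apply: le_trans (ler_normc_sum3 _ _) _.
  apply: ler_sum => a _; apply: ler_sum => b _; apply: ler_sum => c _.
  by rewrite normcM normc_cis mul1r normc_triad.
apply: le_trans (sum_match4_le _ _) _ => //.
  by move=> a b c; rewrite !mulr_ge0 ?normc_ge0.
by rewrite sum3_prod !exprS expr0 mulr1 mulrA.
Qed.

Lemma cubic_split k t w :
  cubic k t w = nonresonant_cubic k t w
    + (2 * mass w - normc (w k) ^+ 2)%:C * w k.
Proof.
pose G a b c := cis ((phase k a b c)%:~R * t) * triad w a b c.
have -> : cubic k t w = nonresonant_cubic k t w +
    \sum_a \sum_b \sum_(c | match4 k a b c && resonant k a c) G a b c.
  rewrite /cubic /nonresonant_cubic -big_split/=; apply: eq_bigr => a _.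
  rewrite -big_split/=; apply: eq_bigr => b _.
  by rewrite (bigID (resonant k a))/= addrC.
congr (_ + _); rewrite (bigD1 k)//=.
have -> : \sum_b \sum_(c | match4 k k b c && resonant k k c) G k b c =
    (mass w)%:C * w k.
  rewrite /mass rmorph_sum/= big_distrl/=; apply: eq_bigr => b _.
  rewrite (big_pred1 b) => [|c].
    have m : match4 k k b b by rewrite /match4 subrK.
    rewrite /G (phase_resonant m) /resonant ?eqxx// mul0r cis0 mul1r /triad.
    by rewrite -mulrA (mulrC (conjc _)) mulCconj mulrC.
  rewrite /resonant eqxx andbT /match4 -addrA -subr_eq0 addrAC subrr add0r.
  by rewrite addrC subr_eq0 (inj_eq kap_inj).
have -> : \sum_(a | a != k) \sum_b \sum_(c | match4 k a b c && resonant k a c)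
    G a b c = (mass w - normc (w k) ^+ 2)%:C * w k.
  have -> : mass w - normc (w k) ^+ 2 = \sum_(a | a != k) normc (w a) ^+ 2.
    by rewrite /mass [X in X - _](bigD1 k)//= [X in X - _]addrC addrK.
  rewrite rmorph_sum/= big_distrl/=; apply: eq_bigr => a ak.
  rewrite (bigD1 a)//= [X in _ + X]big1 ?addr0 => [|b ba].
    rewrite (big_pred1 k) => [|c].
      have m : match4 k a a k by rewrite /match4 subrr add0r.
      rewrite /G (phase_resonant m) /resonant ?eqxx ?orbT// mul0r cis0 mul1r.
      by rewrite /triad mulCconj.
    rewrite /resonant (negbTE ak)/= /match4 subrr add0r (inj_eq kap_inj).
    by rewrite andbb.
  rewrite big_pred0// => c; rewrite /resonant (negbTE ak)/= /match4.
  apply/negbTE; rewrite negb_and; have [->|_] := eqVneq c k; last by rewrite orbT.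
  rewrite orbF -subr_eq0 addrK subr_eq0 (inj_eq kap_inj).
  by rewrite eq_sym.
by apply: reim_eq; rewrite ?reCD ?imCD ?reCM ?imCM /=; ring.
Qed.

End cubic_convolution.

Section normal_form.
Variables (R : realType) (I : finType) (kap : I -> int).
Hypothesis kap_inj : injective kap.
Variables (lam : R) (w dw : I -> R -> R[i]).
Hypothesis lam0 : 0 < lam.
Hypothesis wd : forall k t, is_cderive (w k) t (dw k t).

Let W t : I -> R[i] := fun k => w k t.
Let DW t : I -> R[i] := fun k => dw k t.
Let err t k := dw k t + 'i * lam%:C * cubic kap k t (W t).

Definition resonant_flow (w0 : I -> R[i]) (t : R) k : R[i] :=
  cis (- lam * (2 * mass w0 - normc (w0 k) ^+ 2) * t) * w0 k.

Definition dtriad t a b c : R[i] :=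
  (dw a t * conjc (w b t) + w a t * conjc (dw b t)) * w c t
  + w a t * conjc (w b t) * dw c t.

Lemma is_cderive_triad t a b c :
  is_cderive (fun s => triad (W s) a b c) t (dtriad t a b c).
Proof.
apply: is_cderiveM (wd c t); apply: is_cderiveM (wd a t) _.
exact: is_cderive_conj (wd b t).
Qed.

Lemma normc_dtriad t a b c : normc (dtriad t a b c) <=
  normc (dw a t) * normc (w b t) * normc (w c t)
  + normc (w a t) * normc (dw b t) * normc (w c t)
  + normc (w a t) * normc (w b t) * normc (dw c t).
Proof.
apply: le_trans (ler_normcD _ _) _.
rewrite !normcM normc_conj lerD2r -mulrDl ler_wpM2r ?normc_ge0//.
by apply: le_trans (ler_normcD _ _) _; rewrite !normcM !normc_conj.
Qed.

(* Primitive in time of the oscillating factor of a nonresonant triad. *)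
Definition osc t k a b c : R[i] :=
  cis ((phase kap k a b c)%:~R * t) * ('i * ((phase kap k a b c)%:~R : R)%:C)^-1.

Lemma is_cderive_osc t k a b c : match4 kap k a b c -> ~~ resonant k a c ->
  is_cderive (fun s => osc s k a b c) t (cis ((phase kap k a b c)%:~R * t)).
Proof.
move=> m r; have p1 := @phase_nonresonant R _ _ kap_inj _ _ _ _ m r.
set p : R := (phase kap k a b c)%:~R in p1 *.
have p0 : p != 0 by apply: contraTneq p1 => ->; rewrite normr0 ler10.
have ip0 : 'i * p%:C != 0 :> R[i].
  rewrite mulf_neq0//; last by rewrite (inj_eq (@complexI R) _ 0).
  by rewrite eq_complex /= oner_eq0 andbF.
rewrite (_ : (fun s => _) = (fun s => ('i * p%:C)^-1 * cis (p * s))).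
  apply: is_cderive_eq (is_cderiveMl _ (is_cderive_cis p t)) _.
  by rewrite mulrA mulVf// mul1r.
by apply/funext => s; rewrite /osc mulrC.
Qed.

Lemma normc_osc t k a b c : match4 kap k a b c -> ~~ resonant k a c ->
  normc (osc t k a b c) <= 1.
Proof.
move=> m r; have p1 := @phase_nonresonant R _ _ kap_inj _ _ _ _ m r.
rewrite /osc normcM normc_cis mul1r normcV normcM normc_i// normc_real mul1r.
by rewrite invf_le1// (lt_le_trans ltr01).
Qed.

Definition nform k t : R[i] :=
  \sum_a \sum_b \sum_(c | match4 kap k a b c && ~~ resonant k a c)
    osc t k a b c * triad (W t) a b c.

Definition nform_rem k t : R[i] :=
  \sum_a \sum_b \sum_(c | match4 kap k a b c && ~~ resonant k a c)
    osc t k a b c * dtriad t a b c.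

Lemma is_cderive_nform k t : is_cderive (nform k) t
  (nonresonant_cubic kap k t (W t) + nform_rem k t).
Proof.
rewrite /nform /nform_rem /nonresonant_cubic -big_split/=.
apply: is_cderive_sum => a; rewrite -big_split/=; apply: is_cderive_sum => b.
pose Q c := match4 kap k a b c && ~~ resonant k a c.
rewrite -/Q -big_split /=.
pose F c s := if Q c then osc s k a b c * triad (W s) a b c else 0.
have E : (fun s => \sum_c F c s) =1
    (fun s => \sum_(c | Q c) osc s k a b c * triad (W s) a b c).
  by move=> s; rewrite /F -big_mkcond.
apply: is_cderive_ext E _; rewrite big_mkcond; apply: is_cderive_sum => c.
rewrite /F /Q; case: ifP => [/andP[m r]|_]; last exact: is_cderive_cst.
exact: is_cderiveM (is_cderive_osc t m r) (is_cderive_triad t a b c).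
Qed.

Lemma l1_nform t : \sum_k normc (nform k t) <= l1 (W t) ^+ 3.
Proof.
apply: (@le_trans _ _ (\sum_k \sum_a \sum_b
    \sum_(c | match4 kap k a b c && ~~ resonant k a c)
    normc (w a t) * normc (w b t) * normc (w c t))).
  apply: ler_sum => k _; apply: le_trans (ler_normc_sum3 _ _) _.
  apply: ler_sum => a _; apply: ler_sum => b _; apply: ler_sum => c /andP[m r].
  rewrite normcM normc_triad ler_piMl ?normc_osc//.
  by rewrite !mulr_ge0 ?normc_ge0.
apply: le_trans (sum_match4_le kap_inj _ _) _.
- by move=> k a b c /andP[].
- by move=> a b c; rewrite !mulr_ge0 ?normc_ge0.
by rewrite sum3_prod !exprS expr0 mulr1 mulrA.
Qed.

Lemma l1_nform_rem t :
  \sum_k normc (nform_rem k t) <= 3 * l1 (W t) ^+ 2 * l1 (DW t).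
Proof.
pose F a b c := normc (dw a t) * normc (w b t) * normc (w c t)
  + normc (w a t) * normc (dw b t) * normc (w c t)
  + normc (w a t) * normc (w b t) * normc (dw c t).
have F0 a b c : 0 <= F a b c.
  by rewrite /F !addr_ge0// !mulr_ge0 ?normc_ge0.
apply: (@le_trans _ _ (\sum_k \sum_a \sum_b
    \sum_(c | match4 kap k a b c && ~~ resonant k a c) F a b c)).
  apply: ler_sum => k _; apply: le_trans (ler_normc_sum3 _ _) _.
  apply: ler_sum => a _; apply: ler_sum => b _; apply: ler_sum => c /andP[m r].
  rewrite normcM; apply: le_trans (normc_dtriad t a b c).
  by rewrite ler_piMl ?normc_osc// normc_ge0.
apply: le_trans (sum_match4_le kap_inj _ F0) _.
  by move=> k a b c /andP[].
under eq_bigr do under eq_bigr do rewrite !big_split/=.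
under eq_bigr do rewrite !big_split/=.
rewrite !big_split/= !sum3_prod /l1 /W /DW; lra.
Qed.

Lemma l1_dw t : l1 (DW t) <= lam * l1 (W t) ^+ 3 + l1 (err t).
Proof.
apply: (@le_trans _ _ (\sum_k (lam * normc (cubic kap k t (W t))
   + normc (err t k)))).
  apply: ler_sum => k _.
  have -> : DW t k = err t k - 'i * lam%:C * cubic kap k t (W t).
    by rewrite /err addrK.
  apply: le_trans (ler_normcB _ _) _.
  by rewrite !normcM normc_i// mul1r normc_real (gtr0_norm lam0) addrC.
rewrite big_split/= -mulr_sumr lerD2r ler_pM2l//; exact: l1_cubic.
Qed.

Lemma normc_resonant_flow w0 t k : normc (resonant_flow w0 t k) = normc (w0 k).
Proof. by rewrite normcM normc_cis mul1r. Qed.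

Lemma l1_resonant_flow w0 t : l1 (resonant_flow w0 t) = l1 w0.
Proof. by apply: eq_bigr => k _; rewrite normc_resonant_flow. Qed.

Lemma mass_resonant_flow w0 t : mass (resonant_flow w0 t) = mass w0.
Proof. by apply: eq_bigr => k _; rewrite normc_resonant_flow. Qed.

Lemma is_cderive_resonant_flow w0 t k :
  is_cderive (fun s => resonant_flow w0 s k) t
    (- ('i * lam%:C * ((2 * mass w0 - normc (w0 k) ^+ 2)%:C
       * resonant_flow w0 t k))).
Proof.
rewrite /resonant_flow; set om := 2 * _ - _.
have h := is_cderiveMl (w0 k) (is_cderive_cis (- lam * om) t).
rewrite (_ : (fun s => _) = (fun s => w0 k * cis (- lam * om * s))); last first.
  by apply/funext => s; rewrite mulrC.
apply: is_cderive_eq h _; rewrite !rmorphM/= rmorphN/=; ring.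
Qed.

Let res (v : I -> R[i]) k : R[i] := (2 * mass v - normc (v k) ^+ 2)%:C * v k.

Lemma res_lipschitz (v1 v2 : I -> R[i]) (K : R) : l1 v1 <= K -> l1 v2 <= K ->
  \sum_k normc (res v1 k - res v2 k) <= 9 * K ^+ 2 * \sum_k normc (v1 k - v2 k).
Proof.
move=> v1K v2K; have K0 : 0 <= K := le_trans (l1_ge0 v1) v1K.
set D := \sum_k normc (v1 k - v2 k).
have D0 : 0 <= D by apply: sumr_ge0 => k _; exact: normc_ge0.
have le1 k : normc (v1 k) <= K := le_trans (normc_le_l1 v1 k) v1K.
have le2 k : normc (v2 k) <= K := le_trans (normc_le_l1 v2 k) v2K.
have g1 k := normc_ge0 (v1 k); have g2 k := normc_ge0 (v2 k).
have sqK k : `|normc (v1 k) ^+ 2 - normc (v2 k) ^+ 2| <=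
    2 * K * normc (v1 k - v2 k).
  rewrite subr_sqr normrM mulrC; apply: ler_pM => //.
    rewrite ger0_norm ?addr_ge0//; have := le1 k; have := le2 k; lra.
  rewrite ler_norml lerNl opprB; apply/andP; split.
    by rewrite normc_distrC; exact: ler_normc_sub.
  exact: ler_normc_sub.
have mK : `|mass v1 - mass v2| <= 2 * K * D.
  rewrite /mass -sumrB; apply: le_trans (ler_norm_sum _ _ _) _.
  by rewrite /D mulr_sumr; apply: ler_sum.
have m1 : 0 <= mass v1 <= K ^+ 2.
  rewrite sumr_ge0//= => [|k _]; last by rewrite sqr_ge0.
  apply: (@le_trans _ _ (\sum_k K * normc (v1 k))).
    by apply: ler_sum => k _; rewrite expr2 ler_wpM2r.
  by rewrite -mulr_sumr expr2 ler_wpM2l.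
apply: (@le_trans _ _ (\sum_k ((2 * K ^+ 2) * normc (v1 k - v2 k)
   + (2 * (2 * K * D)) * normc (v2 k)
   + (K ^+ 2 + 2 * K * K) * normc (v1 k - v2 k)))).
  apply: ler_sum => k _.
  have -> : res v1 k - res v2 k = (2 * mass v1)%:C * (v1 k - v2 k)
    + (2 * (mass v1 - mass v2))%:C * v2 k
    - ((normc (v1 k) ^+ 2)%:C * (v1 k - v2 k)
       + (normc (v1 k) ^+ 2 - normc (v2 k) ^+ 2)%:C * v2 k).
    rewrite /res !rmorphB/= !rmorphM/= !rmorphB/=; ring.
  apply: le_trans (ler_normcB _ _) _.
  apply: lerD.
    apply: le_trans (ler_normcD _ _) _; rewrite !normcM !normc_real.
    apply: lerD; apply: ler_wpM2r; rewrite ?normc_ge0//.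
      by rewrite ger0_norm; lra.
    by rewrite normrM ger0_norm// ler_wpM2l.
  apply: le_trans (ler_normcD _ _) _; rewrite !normcM !normc_real mulrDl.
  apply: lerD.
    rewrite ler_wpM2r ?normc_ge0// ger0_norm ?sqr_ge0//.
    by rewrite ler_pXn2r// nnegrE.
  apply: le_trans (ler_pM _ _ (sqK k) (le2 k)) _ => //.
  by rewrite [leRHS]mulrAC.
rewrite !big_split/= -!mulr_sumr -/D -[\sum_k _]/(l1 v2).
have : 2 * (2 * K * D) * l1 v2 <= 2 * (2 * K * D) * K.
  by rewrite ler_wpM2l// !mulr_ge0.
rewrite !expr2; lra.
Qed.

End normal_form.

Section resonant_approximation.
Variable R : realType.

Lemma continuous_sum (T : topologicalType) (I : Type) (r : seq I)
    (F : I -> T -> R) (x : T) : (forall i, {for x, continuous (F i)}) ->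
  {for x, continuous (fun y => \sum_(i <- r) F i y)}.
Proof.
move=> cF; elim: r => [|i r ih].
  rewrite (_ : (fun y => _) = cst 0); first exact: cvg_cst.
  by apply/funext => y; rewrite big_nil.
rewrite (_ : (fun y => _) = F i \+ (fun y => \sum_(j <- r) F j y)).
  by apply: continuousD.
by apply/funext => y; rewrite big_cons.
Qed.

Lemma continuous_normc_cderive (f df : R -> R[i]) :
  (forall t, is_cderive f t (df t)) -> continuous (fun t => normc (f t)).
Proof.
move=> fd t.
have [f1 f2] := fd t.
rewrite (_ : (fun t => _) = Num.sqrt \o
    ((reC \o f) \* (reC \o f) \+ (imC \o f) \* (imC \o f))); last first.
  by apply/funext => s; rewrite normcE/= !expr2.
apply: continuous_comp; last exact: sqrt_continuous.
apply: cvgD; apply: cvgM; exact: is_derive_continuous.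
Qed.

Lemma normc_cisB1 (x : R) : normc (cis x - 1) <= `|x|.
Proof.
wlog x0 : x / 0 <= x.
  move=> H; have [|x0] := leP 0 x; first exact: H.
  have -> : cis x - 1 = conjc (cis (- x) - 1).
    by apply: reim_eq; rewrite ?reCconj ?imCconj ?reCD ?imCD ?reCN ?imCN /= ?cosN ?sinN; ring.
  by rewrite normc_conj -normrN H// oppr_ge0 ltW.
have d k s : is_cderive ((fun _ : 'I_1 => fun s : R => cis (1 * s) - 1) k) s
    ((fun _ s => 'i * 1%:C * cis (1 * s)) k s).
  apply: is_cderive_eq (is_cderiveB (is_cderive_cis 1 s) (is_cderive_cst 1 s)) _.
  by rewrite subr0.
have : \sum_(k < 1) normc (cis (1 * x) - 1) <=
    (\sum_(k < 1) normc (cis (1 * 0 : R) - 1) + 1 * x) * expR (0 * x).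
  apply: (gronwall_normc x0 (lexx 0) ler01 d) => s _.
  by rewrite !big_ord1 mul0r add0r !normcM normc_i normc_real normr1 normc_cis !mul1r.
rewrite !big_ord1 !mul1r cis0 subrr normc0 add0r mul0r expR0 mulr1.
by rewrite ger0_norm.
Qed.

Section flow.
Variables (I : finType) (kap : I -> int).
Hypothesis kap_inj : injective kap.
Variables (lam : R) (w dw : I -> R -> R[i]).
Hypothesis lam0 : 0 < lam.
Hypothesis wd : forall k t, is_cderive (w k) t (dw k t).

Let W t : I -> R[i] := fun k => w k t.
Let err t k := dw k t + 'i * lam%:C * cubic kap k t (W t).
Let dist t := \sum_k normc (w k t - resonant_flow lam (W 0) t k).

Variables (K tau : R).
Hypothesis K0 : 0 < K.
Hypothesis W0K : l1 (W 0) <= K.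

Let x := lam * K ^+ 2.

Lemma flow_short_time (t : R) : 0 <= t ->
  (forall s : R, 0 <= s <= t -> l1 (err s) <= tau) ->
  (forall s : R, 0 <= s <= t -> l1 (W s) <= 2 * K) ->
  dist t <= t * (8 * x * K + tau) + 2 * x * t * K.
Proof.
move=> t0 et Wt.
have tau0 : 0 <= tau by apply: le_trans (l1_ge0 _) (et 0 _); rewrite lexx.
have x0 : 0 < x by rewrite mulr_gt0// exprn_gt0.
apply: (@le_trans _ _ (\sum_k normc (w k t - w k 0)
  + \sum_k normc (w k 0 - resonant_flow lam (W 0) t k))).
  rewrite -big_split/=; apply: ler_sum => k _.
  by rewrite -[X in normc X](subrKA (w k 0)) ler_normcD.
apply: lerD.
  have d k s : is_cderive (fun s => w k s - w k 0) s (dw k s).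
    apply: is_cderive_eq (is_cderiveB (wd k s) (is_cderive_cst _ s)) _.
    by rewrite subr0.
  have m0 : 0 <= 8 * x * K + tau by rewrite addr_ge0// !mulr_ge0 ?ltW.
  have : \sum_k normc (w k t - w k 0) <=
      (\sum_k normc (w k 0 - w k 0) + (8 * x * K + tau) * t) * expR (0 * t).
    apply: (gronwall_normc t0 (lexx 0) m0 d) => s s0t; rewrite mul0r add0r.
    apply: le_trans (l1_dw kap_inj w dw lam0 s) _; apply: lerD; last exact: et.
    apply: (@le_trans _ _ (lam * (2 * K) ^+ 3)).
      by rewrite ler_pM2l// lerXn2r ?nnegrE ?l1_ge0 ?Wt// mulr_ge0// ltW.
    by rewrite /x !exprS expr0; lra.
  rewrite mul0r expR0 mulr1 [X in X + _]big1 => [|k _].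
    by rewrite add0r [t * _]mulrC.
  by rewrite subrr normc0.
apply: (@le_trans _ _ (\sum_k 2 * x * t * normc (w k 0))); last first.
  by rewrite -mulr_sumr ler_wpM2l// !mulr_ge0// ltW.
apply: ler_sum => k _; rewrite /resonant_flow -/(W 0 k).
rewrite -{1}[W 0 k]mul1r -mulrBl normcM ler_wpM2r ?normc_ge0//.
rewrite normc_distrC; apply: le_trans (normc_cisB1 _) _.
have M0 : 0 <= mass (W 0) by apply: sumr_ge0 => j _; rewrite sqr_ge0.
have kM : normc (W 0 k) ^+ 2 <= mass (W 0).
  by rewrite /mass (bigD1 k)//= lerDl sumr_ge0// => j _; rewrite sqr_ge0.
have MK : mass (W 0) <= K ^+ 2.
  apply: (@le_trans _ _ (\sum_j K * normc (W 0 j))).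
    apply: ler_sum => j _; rewrite expr2 ler_wpM2r ?normc_ge0//.
    by apply: le_trans W0K; exact: normc_le_l1.
  by rewrite -mulr_sumr expr2 ler_wpM2l// ltW.
rewrite normrM (ger0_norm t0) ler_wpM2r// normrM normrN (gtr0_norm lam0).
rewrite /x mulrCA ler_pM2l// ger0_norm; last by move: kM M0; lra.
by have := sqr_ge0 (normc (W 0 k)); move: MK; lra.
Qed.

Lemma flow_long_time (t : R) : 0 <= t -> x <= 1 ->
  (forall s : R, 0 <= s <= t -> l1 (err s) <= tau) ->
  (forall s : R, 0 <= s <= t -> l1 (W s) <= 2 * K) ->
  dist t <= 8 * x * K
    + (8 * x * K + t * (384 * x ^+ 2 * K + 13 * tau)) * expR (36 * (x * t)).
Proof.
move=> t0 x1 et Wt.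
have tau0 : 0 <= tau by apply: le_trans (l1_ge0 _) (et 0 _); rewrite lexx.
have x0 : 0 < x by rewrite mulr_gt0// exprn_gt0.
pose r k s := resonant_flow lam (W 0) s k.
pose res (v : I -> R[i]) k : R[i] := (2 * mass v - normc (v k) ^+ 2)%:C * v k.
pose f k s := w k s + 'i * lam%:C * nform kap w k s - r k s.
pose df k s := err s k - 'i * lam%:C * (res (W s) k - res (fun j => r j s) k)
  + 'i * lam%:C * nform_rem kap w dw k s.
have fd k s : is_cderive (f k) s (df k s).
  apply: is_cderive_eq (is_cderiveB (is_cderiveD (wd k s)
    (is_cderiveMl _ (is_cderive_nform kap_inj wd k s)))
    (is_cderive_resonant_flow lam (W 0) s k)) _.
  rewrite /df /err (cubic_split kap_inj) -/(res (W s) k).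
  rewrite /res mass_resonant_flow normc_resonant_flow -/(r k s); ring.
have Wt3 (s : R) : 0 <= s <= t -> l1 (W s) ^+ 3 <= 8 * K ^+ 3.
  move=> st; rewrite (_ : 8 * K ^+ 3 = (2 * K) ^+ 3); last by ring.
  by rewrite lerXn2r ?nnegrE ?l1_ge0 ?Wt// mulr_ge0// ltW.
have nle (s : R) : 0 <= s <= t ->
    \sum_k normc ('i * lam%:C * nform kap w k s) <= 8 * x * K.
  move=> st; under eq_bigr do rewrite !normcM normc_i// normc_real mul1r.
  rewrite (gtr0_norm lam0) -mulr_sumr.
  rewrite (_ : 8 * x * K = lam * (8 * K ^+ 3)); last by rewrite /x; ring.
  by rewrite ler_pM2l// (le_trans (l1_nform kap_inj w s))// Wt3.
have distle (s : R) : 0 <= s <= t -> dist s <= \sum_k normc (f k s) + 8 * x * K.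
  move=> st; apply: le_trans (_ : _ <= \sum_k normc (f k s)
     + \sum_k normc ('i * lam%:C * nform kap w k s)) _; last first.
    by rewrite lerD2l nle.
  rewrite -big_split/=; apply: ler_sum => k _.
  have -> : w k s - resonant_flow lam (W 0) s k =
      f k s - 'i * lam%:C * nform kap w k s by rewrite /f /r; ring.
  exact: ler_normcB.
have dle (s : R) : 0 <= s <= t -> \sum_k normc (df k s) <=
    (36 * x) * \sum_k normc (f k s) + (384 * x ^+ 2 * K + 13 * tau).
  move=> st.
  apply: (@le_trans _ _ (l1 (err s) + lam * (9 * (2 * K) ^+ 2 * dist s)
     + lam * (3 * (2 * K) ^+ 2 * (lam * (8 * K ^+ 3) + tau)))).
    rewrite /l1 /df.
    have h1 : \sum_k normc (res (W s) k - res (fun j => r j s) k) <=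
        9 * (2 * K) ^+ 2 * dist s.
      apply: res_lipschitz; first exact: Wt.
      by rewrite l1_resonant_flow (le_trans W0K)//; move: K0; lra.
    have h2 : \sum_k normc (nform_rem kap w dw k s) <=
        3 * (2 * K) ^+ 2 * (lam * (8 * K ^+ 3) + tau).
      apply: le_trans (l1_nform_rem kap_inj w dw s) _.
      apply: ler_pM; rewrite ?mulr_ge0 ?sqr_ge0 ?l1_ge0//.
        rewrite ler_wpM2l// lerXn2r ?nnegrE ?l1_ge0 ?Wt//.
        by rewrite mulr_ge0// ltW.
      apply: le_trans (l1_dw kap_inj w dw lam0 s) _.
      by apply: lerD; rewrite ?et// ler_pM2l// Wt3.
    rewrite -(ler_pM2l lam0) in h1; rewrite -(ler_pM2l lam0) in h2.
    apply: le_trans (lerD (lerD (lexx _) h1) h2).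
    rewrite !mulr_sumr -!big_split/=; apply: ler_sum => k _.
    apply: le_trans (ler_normcD _ _) _; apply: lerD.
      apply: le_trans (ler_normcB _ _) _.
      by rewrite !normcM normc_i// mul1r normc_real (gtr0_norm lam0).
    by rewrite !normcM normc_i// mul1r normc_real (gtr0_norm lam0).
  have h3 : lam * (9 * (2 * K) ^+ 2 * dist s) <=
      36 * x * (\sum_k normc (f k s) + 8 * x * K).
    rewrite (_ : lam * _ = 36 * x * dist s); last by rewrite /x; ring.
    by rewrite ler_wpM2l ?distle// mulr_ge0// ltW.
  have h4 : lam * (3 * (2 * K) ^+ 2 * (lam * (8 * K ^+ 3) + tau)) =
      96 * x ^+ 2 * K + 12 * x * tau by rewrite /x; ring.
  have h5 : x * tau <= tau by rewrite ler_piMl.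
  rewrite h4; have := et s st; rewrite expr2; move: h3 h5; lra.
have L0 : 0 <= 36 * x by rewrite mulr_ge0// ltW.
have m0 : 0 <= 384 * x ^+ 2 * K + 13 * tau.
  exact: (addr_ge0 (mulr_ge0 (mulr_ge0 (ler0n _ _) (sqr_ge0 _)) (ltW K0))
    (mulr_ge0 (ler0n _ _) tau0)).
have G := gronwall_normc t0 L0 m0 fd dle.
have tt : 0 <= t <= t by rewrite t0 lexx.
have t00 : 0 <= (0 : R) <= t by rewrite lexx.
apply: le_trans (distle t tt) _; rewrite addrC lerD2l.
apply: le_trans G _; rewrite -(mulrA 36 x t) ler_wpM2r ?expR_ge0//.
rewrite [t * _]mulrC lerD2r.
apply: le_trans (nle 0 t00).
apply: ler_sum => k _; rewrite /f /r /resonant_flow mulr0 cis0 mul1r.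
by rewrite [X in normc X]addrAC subrr add0r.
Qed.

End flow.

(* Uniform closeness to the resonant dynamics: either on the nonlinear time
   scale [1 / (lam * K ^ 2)], provided [lam * K ^ 2] is small, or on shorter
   times. *)
Theorem resonant_approximation (C rho : R) : 0 <= C -> 0 < rho ->
  exists2 mu : R, 0 < mu & forall (I : finType) (kap : I -> int) (lam : R)
    (w dw : I -> R -> R[i]) (K tau T : R),
  injective kap -> 0 < lam -> (forall k t, is_cderive (w k) t (dw k t)) ->
  0 < K -> 0 <= T -> l1 (w^~ 0) <= K ->
  (forall s : R, 0 <= s <= T -> l1 (fun k =>
      dw k s + 'i * lam%:C * cubic kap k s (w^~ s)) <= tau) ->
  (lam * K ^+ 2 * T <= C /\ lam * K ^+ 2 <= mu) \/ lam * K ^+ 2 * T <= mu ->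
  T * tau <= mu * K ->
  \sum_k normc (w k T - resonant_flow lam (w^~ 0) T k) <= rho * K.
Proof.
move=> C0 rho0.
pose e := expR (36 * C); pose E := 8 + (8 + 384 * C) * e.
pose rho' := Num.min rho (1 / 2).
have rho'0 : 0 < rho' by rewrite lt_min rho0 divr_gt0.
have rho'1 : rho' <= rho by rewrite ge_min lexx.
have rho'2 : rho' <= 1 / 2 by rewrite ge_min lexx orbT.
have e1 : 1 <= e by rewrite /e -expR0 ler_expR mulr_ge0.
have E1 : 8 <= E.
  rewrite lerDl.
  exact: (mulr_ge0 (addr_ge0 (ler0n _ _) (mulr_ge0 (ler0n _ _) C0)) (expR_ge0 _)).
have D0 : 0 < E + 13 * e by move: E1 e1; lra.
have D21 : 21 <= E + 13 * e by move: E1 e1; lra.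
pose mu := rho' / (E + 13 * e).
have mu0 : 0 < mu by rewrite divr_gt0.
have muE : mu * (E + 13 * e) = rho' by rewrite /mu divfK// gt_eqF.
have mu21 : mu * 21 <= rho' by rewrite -muE ler_pM2l.
exists mu => // I kap lam w dw K tau T kap_inj lam0 wd K0 T0 W0K et HT Ttau.
have tau0 : 0 <= tau by apply: le_trans (l1_ge0 _) (et 0 _); rewrite lexx.
pose x := lam * K ^+ 2.
have x0 : 0 < x by rewrite mulr_gt0// exprn_gt0.
suff main (t : R) : 0 <= t <= T -> (forall s : R, 0 <= s <= t -> l1 (w^~ s) <= 2 * K) ->
    \sum_k normc (w k t - resonant_flow lam (w^~ 0) t k) <= rho' * K.
  have l1le (t : R) : 0 <= t <= T -> (forall s : R, 0 <= s <= t -> l1 (w^~ s) <= 2 * K) ->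
      l1 (w^~ t) <= 3 / 2 * K.
    move=> tT /(main t tT) h.
    apply: (@le_trans _ _ (rho' * K + l1 (w^~ 0))); last first.
      have : rho' * K <= 1 / 2 * K by rewrite ler_pM2r.
      by move: W0K; lra.
    rewrite -(l1_resonant_flow lam (w^~ 0) t).
    apply: le_trans (lerD h (lexx _)); rewrite -big_split/=.
    by apply: ler_sum => k _; rewrite -lerBlDr; exact: ler_normc_sub.
  have lt2 : 3 / 2 * K < 2 * K by rewrite ltr_pM2r//; lra.
  have cont : continuous (fun t => l1 (w^~ t)).
    by move=> t; apply: continuous_sum => k; exact: continuous_normc_cderive (wd k) t.
  have l10 : l1 (w^~ 0) <= 3 / 2 * K by apply: le_trans W0K _; move: K0; lra.
  have l1T := continuity_method lt2 cont l10 l1le.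
  apply: (@le_trans _ _ (rho' * K)); last by rewrite ler_pM2r.
  apply: main => [|s /l1T]; first by rewrite T0 lexx.
  by move/le_trans; apply; exact: ltW.
move=> /andP[t0 tT] Wt.
have et' (s : R) : 0 <= s <= t -> l1 (fun k =>
      dw k s + 'i * lam%:C * cubic kap k s (w^~ s)) <= tau.
  by move=> /andP[s0 st]; apply: et; rewrite s0 (le_trans st).
have ttau : t * tau <= mu * K by apply: le_trans Ttau; rewrite ler_wpM2r.
have xt : x * t <= x * T by rewrite ler_pM2l.
case: HT => [[xTC xmu]|xTmu].
  have x1 : x <= 1 by apply: (le_trans xmu); move: mu21 rho'2; lra.
  apply: (@le_trans _ _ _ _ _ (flow_long_time kap_inj lam0 wd K0 W0K t0 x1 et' Wt)).
  rewrite -/x.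
  have ele : expR (36 * (x * t)) <= e.
    by rewrite ler_expR ler_pM2l// (le_trans xt).
  have A0 : 0 <= 8 * x * K + t * (384 * x ^+ 2 * K + 13 * tau).
    exact: (addr_ge0 (mulr_ge0 (mulr_ge0 (ler0n _ _) (ltW x0)) (ltW K0)) (mulr_ge0 t0
      (addr_ge0 (mulr_ge0 (mulr_ge0 (ler0n _ _) (sqr_ge0 _)) (ltW K0))
      (mulr_ge0 (ler0n _ _) tau0)))).
  have h1 := ler_wpM2l A0 ele.
  have h2 : 8 * x * K + t * (384 * x ^+ 2 * K + 13 * tau) <=
      8 * x * K + 384 * C * x * K + 13 * (mu * K).
    have : (x * t) * (x * K) <= C * (x * K).
      by rewrite ler_pM2r ?mulr_gt0// (le_trans xt).
    by rewrite expr2; move: ttau; lra.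
  have h3 := ler_wpM2r (expR_ge0 (36 * C)) h2; rewrite -/e in h3.
  have h4 : x * K * (8 + (8 + 384 * C) * e) <= mu * K * (8 + (8 + 384 * C) * e).
    apply: ler_wpM2r; first by rewrite -/E; move: E1; lra.
    by rewrite ler_pM2r.
  have h5 : rho' * K = mu * K * (8 + (8 + 384 * C) * e) + 13 * (mu * K) * e.
    by rewrite -muE /E; ring.
  rewrite h5; move: h1 h3 h4; lra.
apply: (le_trans (flow_short_time kap_inj lam0 wd K0 W0K t0 et' Wt)).
rewrite -/x.
have h1 : x * t * K <= mu * K by rewrite ler_pM2r// (le_trans xt).
have h2 : mu * 21 * K <= rho' * K by rewrite ler_pM2r.
have h3 : 0 <= mu * K by rewrite mulr_ge0 ?ltW.
move: h1 h2 h3 ttau; lra.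
Qed.

End resonant_approximation.

(** * Fourier series of solutions *)

Section complex_integral.
Variable R : realType.
Implicit Types (f g : R -> R[i]) (h : R -> R).

Let D : set R := `[0, 2 * pi]%classic.
Local Notation mu := (@lebesgue_measure R).

Definition bmeas h := measurable_fun D h /\ exists B, forall x, D x -> `|h x| <= B.

Definition rint h : R := \int[mu]_(x in D) h x.

Lemma pi2_gt0 : 0 < 2 * pi :> R.
Proof. by rewrite mulr_gt0// pi_gt0. Qed.

Lemma measure_torus : (mu D = (2 * pi)%:E)%E.
Proof. by rewrite /D lebesgue_measure_itv/= lte_fin pi2_gt0 sube0. Qed.

Lemma measurable_torus : measurable D.
Proof. exact: measurable_itv. Qed.
Hint Resolve measurable_torus : core.

Lemma bmeas_integrable h : bmeas h -> mu.-integrable D (EFin \o h).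
Proof.
move=> [mh [B hB]]; apply: measurable_bounded_integrable => //.
  by rewrite [X in (X < _)%E]measure_torus ltry.
exists B; split; first exact: num_real.
by move=> x Bx y Dy; apply: (le_trans (hB y Dy)); exact: ltW.
Qed.

Lemma bmeas_cst (r : R) : bmeas (fun=> r).
Proof. by split; [exact: measurable_cst|exists `|r|]. Qed.

Lemma bmeasD h1 h2 : bmeas h1 -> bmeas h2 -> bmeas (fun x => h1 x + h2 x).
Proof.
move=> [m1 [B1 b1]] [m2 [B2 b2]]; split; first exact: measurable_funD.
exists (B1 + B2) => x Dx; rewrite (le_trans (ler_normD _ _))// lerD ?b1 ?b2//.
Qed.

Lemma bmeasN h : bmeas h -> bmeas (fun x => - h x).
Proof.
move=> [m [B b]]; split; first exact: measurable_funN.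
by exists B => x Dx; rewrite normrN b.
Qed.

Lemma bmeasB h1 h2 : bmeas h1 -> bmeas h2 -> bmeas (fun x => h1 x - h2 x).
Proof. by move=> b1 b2; apply: bmeasD => //; exact: bmeasN. Qed.

Lemma bmeasM h1 h2 : bmeas h1 -> bmeas h2 -> bmeas (fun x => h1 x * h2 x).
Proof.
move=> [m1 [B1 b1]] [m2 [B2 b2]]; split; first exact: measurable_funM.
by exists (B1 * B2) => x Dx; rewrite normrM ler_pM ?b1 ?b2.
Qed.

Lemma bmeas_continuous h : continuous h -> bmeas h.
Proof.
move=> hc; split.
  by apply: measurable_funS (continuous_measurable_fun hc).
have : compact (h @` D).
  apply: continuous_compact; last exact: segment_compact.
  exact: continuous_subspaceT.
move/compact_bounded => [B [_ /(_ (B + 1))]]; rewrite ltrDl => /(_ ltr01) hB.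
by exists (B + 1) => x Dx; apply: hB; exists x.
Qed.

Lemma rintD h1 h2 : bmeas h1 -> bmeas h2 ->
  rint (fun x => h1 x + h2 x) = rint h1 + rint h2.
Proof. by move=> b1 b2; rewrite /rint RintegralD//; exact: bmeas_integrable. Qed.

Lemma rintZ (r : R) h : bmeas h -> rint (fun x => r * h x) = r * rint h.
Proof. by move=> b; rewrite /rint RintegralZl//; exact: bmeas_integrable. Qed.

Lemma rintN h : bmeas h -> rint (fun x => - h x) = - rint h.
Proof.
move=> b; rewrite -mulN1r -rintZ//; congr rint.
by apply/funext => x; rewrite mulN1r.
Qed.

Lemma rint_cst (r : R) : rint (fun=> r) = 2 * pi * r.
Proof.
by rewrite /rint Rintegral_cst// [X in fine X]measure_torus/= mulrC.
Qed.

Lemma rint_le h1 h2 : bmeas h1 -> bmeas h2 ->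
  (forall x, D x -> h1 x <= h2 x) -> rint h1 <= rint h2.
Proof.
by move=> b1 b2 le12; apply: le_Rintegral => //; exact: bmeas_integrable.
Qed.

Lemma rint_ge0 h : (forall x, D x -> 0 <= h x) -> 0 <= rint h.
Proof. by move=> h0; rewrite /rint; apply: Rintegral_ge0. Qed.

Lemma rint_norm_le h (B : R) : bmeas h -> (forall x, D x -> `|h x| <= B) ->
  `|rint h| <= 2 * pi * B.
Proof.
move=> b hB; rewrite -rint_cst ler_norml; apply/andP; split.
  rewrite -rintN; last exact: bmeas_cst.
  apply: rint_le => // [|x Dx]; first exact: bmeas_cst.
  by have := hB x Dx; rewrite ler_norml => /andP[].
apply: rint_le => // [|x Dx]; first exact: bmeas_cst.
by have := hB x Dx; rewrite ler_norml => /andP[].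
Qed.

Lemma rint_derive h (dh : R -> R) : (forall x : R, is_derive x 1 h (dh x)) -> continuous dh ->
  rint dh = h (2 * pi) - h 0.
Proof.
move=> hd dhc; rewrite /rint /Rintegral (@continuous_FTC2 _ dh h)//.
- exact: pi2_gt0.
- exact: continuous_subspaceT.
- have hc : continuous h by move=> x; exact: is_derive_continuous (hd x).
  split; first by move=> x _; case: (hd x).
  + exact: cvg_at_right_filter (hc 0).
  + exact: cvg_at_left_filter (hc _).
- by move=> x _; rewrite derive1E; case: (hd x).
Qed.

Definition cbmeas f := bmeas (reC \o f) /\ bmeas (imC \o f).

Definition cint f : R[i] := rint (reC \o f) +i* rint (imC \o f).

Definition ccontinuous f := continuous (reC \o f) /\ continuous (imC \o f).

Lemma cbmeas_continuous f : ccontinuous f -> cbmeas f.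
Proof. by move=> [c1 c2]; split; exact: bmeas_continuous. Qed.

Lemma cbmeas_bounded f : measurable_fun D (reC \o f) ->
  measurable_fun D (imC \o f) -> (exists B, forall x, D x -> normc (f x) <= B) ->
  cbmeas f.
Proof.
move=> m1 m2 [B fB]; split; split=> //; exists B => x Dx;
  apply: le_trans (fB x Dx); [exact: normr_reC_le|exact: normr_imC_le].
Qed.

Lemma cbmeas_cst (z : R[i]) : cbmeas (fun=> z).
Proof. by split; exact: bmeas_cst. Qed.

Lemma bmeas_ext h1 h2 : h1 =1 h2 -> bmeas h1 -> bmeas h2.
Proof. by move=> /funext ->. Qed.

Lemma cbmeasD f g : cbmeas f -> cbmeas g -> cbmeas (fun x => f x + g x).
Proof.
move=> [f1 f2] [g1 g2]; split.
  by apply: bmeas_ext (bmeasD f1 g1) => x /=; rewrite reCD.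
by apply: bmeas_ext (bmeasD f2 g2) => x /=; rewrite imCD.
Qed.

Lemma cbmeasN f : cbmeas f -> cbmeas (fun x => - f x).
Proof.
move=> [f1 f2]; split.
  by apply: bmeas_ext (bmeasN f1) => x /=; rewrite reCN.
by apply: bmeas_ext (bmeasN f2) => x /=; rewrite imCN.
Qed.

Lemma cbmeasB f g : cbmeas f -> cbmeas g -> cbmeas (fun x => f x - g x).
Proof. by move=> bf bg; apply: cbmeasD => //; exact: cbmeasN. Qed.

Lemma cbmeasM f g : cbmeas f -> cbmeas g -> cbmeas (fun x => f x * g x).
Proof.
move=> [f1 f2] [g1 g2]; split.
  apply: bmeas_ext (bmeasB (bmeasM f1 g1) (bmeasM f2 g2)) => x /=.
  by rewrite reCM.
apply: bmeas_ext (bmeasD (bmeasM f1 g2) (bmeasM f2 g1)) => x /=.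
by rewrite imCM.
Qed.

Lemma cbmeas_conj f : cbmeas f -> cbmeas (fun x => conjc (f x)).
Proof.
move=> [f1 f2]; split.
  by apply: bmeas_ext f1 => x /=; rewrite reCconj.
by apply: bmeas_ext (bmeasN f2) => x /=; rewrite imCconj.
Qed.

Lemma cbmeas_sum (I : Type) (r : seq I) (P : pred I) (F : I -> R -> R[i]) :
  (forall i, cbmeas (F i)) -> cbmeas (fun x => \sum_(i <- r | P i) F i x).
Proof.
move=> bF; elim: r => [|i r ih].
  rewrite (_ : (fun x => _) = (fun=> 0)); first exact: cbmeas_cst.
  by apply/funext => x; rewrite big_nil.
rewrite (_ : (fun x => _) = (fun x => (if P i then F i x else 0)
    + \sum_(j <- r | P j) F j x)).
  by case: (P i); apply: cbmeasD => //; exact: cbmeas_cst.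
by apply/funext => x; rewrite big_cons; case: (P i); rewrite ?add0r.
Qed.

Lemma cintD f g : cbmeas f -> cbmeas g ->
  cint (fun x => f x + g x) = cint f + cint g.
Proof.
move=> [f1 f2] [g1 g2]; rewrite /cint; simpc; congr (_ +i* _).
  by rewrite -rintD//; congr rint; apply/funext => x /=; rewrite reCD.
by rewrite -rintD//; congr rint; apply/funext => x /=; rewrite imCD.
Qed.

Lemma cintZ (z : R[i]) f : cbmeas f -> cint (fun x => z * f x) = z * cint f.
Proof.
move=> [f1 f2]; rewrite /cint; apply: reim_eq; rewrite ?reCM ?imCM/=.
  rewrite -!rintZ// -rintN ?rintD//; last exact: bmeasM (bmeas_cst _) f2.
  rewrite -rintD; [|exact: bmeasM (bmeas_cst _) f1
    |by apply: bmeasN; exact: bmeasM (bmeas_cst _) f2].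
  by congr rint; apply/funext => x /=; rewrite reCM.
rewrite -!rintZ// -rintD; [|exact: bmeasM (bmeas_cst _) f2
    |exact: bmeasM (bmeas_cst _) f1].
by congr rint; apply/funext => x /=; rewrite imCM.
Qed.

Lemma cintN f : cbmeas f -> cint (fun x => - f x) = - cint f.
Proof.
move=> bf; rewrite -mulN1r -cintZ//; congr cint.
by apply/funext => x; rewrite mulN1r.
Qed.

Lemma cintB f g : cbmeas f -> cbmeas g ->
  cint (fun x => f x - g x) = cint f - cint g.
Proof. by move=> bf bg; rewrite cintD ?cintN//; exact: cbmeasN. Qed.

Lemma cint_conj f : cbmeas f -> cint (fun x => conjc (f x)) = conjc (cint f).
Proof.
move=> [f1 f2]; rewrite /cint /=; congr (_ +i* _).
  by congr rint; apply/funext => x /=; rewrite reCconj.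
by rewrite -rintN//; congr rint; apply/funext => x /=; rewrite imCconj.
Qed.

Lemma cint_cst (z : R[i]) : cint (fun=> z) = (2 * pi)%:C * z.
Proof.
rewrite /cint; apply: reim_eq; rewrite ?reCM ?imCM/= rint_cst mul0r.
  by rewrite subr0.
by rewrite addr0.
Qed.

Lemma cint_sum (I : Type) (r : seq I) (F : I -> R -> R[i]) :
  (forall i, cbmeas (F i)) ->
  cint (fun x => \sum_(i <- r) F i x) = \sum_(i <- r) cint (F i).
Proof.
move=> bF; elim: r => [|i r ih].
  rewrite big_nil -[RHS](mulr0 (2 * pi)%:C) -cint_cst; congr cint.
  by apply/funext => x; rewrite big_nil.
rewrite big_cons -ih -cintD//; last exact: cbmeas_sum.
by congr cint; apply/funext => x; rewrite big_cons.
Qed.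

Lemma normc_cint_le f (B : R) : cbmeas f -> (forall x, D x -> normc (f x) <= B) ->
  normc (cint f) <= 4 * pi * B.
Proof.
move=> [f1 f2] fB; apply: le_trans (normc_le_reim _) _; rewrite /=.
have h1 : `|rint (reC \o f)| <= 2 * pi * B.
  by apply: rint_norm_le => // x Dx; apply: le_trans (fB x Dx); exact: normr_reC_le.
have h2 : `|rint (imC \o f)| <= 2 * pi * B.
  by apply: rint_norm_le => // x Dx; apply: le_trans (fB x Dx); exact: normr_imC_le.
by apply: le_trans (lerD h1 h2) _; rewrite -mulrDl -mulrDl; lra.
Qed.

Lemma cint_derive f df : (forall x, is_cderive f x (df x)) -> ccontinuous df ->
  cint df = f (2 * pi) - f 0.
Proof.
move=> fd [c1 c2]; rewrite /cint.
have e1 : rint (reC \o df) = reC (f (2 * pi)) - reC (f 0).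
  by apply: (@rint_derive (reC \o f) (reC \o df)) => // x; case: (fd x).
have e2 : rint (imC \o df) = imC (f (2 * pi)) - imC (f 0).
  by apply: (@rint_derive (imC \o f) (imC \o df)) => // x; case: (fd x).
by apply: reim_eq; rewrite ?reCD ?imCD ?reCN ?imCN /= ?e1 ?e2.
Qed.

Lemma ccontinuous_derive f df : (forall x, is_cderive f x (df x)) -> ccontinuous f.
Proof. by move=> fd; split=> x; apply: is_derive_continuous; case: (fd x). Qed.

Lemma ccontinuous_cis (m : R) : ccontinuous (fun x => cis (m * x)).
Proof. exact: ccontinuous_derive (is_cderive_cis m). Qed.

Lemma ccontinuous_cst (z : R[i]) : ccontinuous (fun=> z).
Proof. by split; exact: cst_continuous. Qed.

Lemma ccontinuousD f g : ccontinuous f -> ccontinuous g ->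
  ccontinuous (fun x => f x + g x).
Proof.
move=> [f1 f2] [g1 g2]; split.
  rewrite (_ : _ \o _ = (reC \o f) \+ (reC \o g)) => [x|].
    by apply: continuousD; [exact: f1|exact: g1].
  by apply/funext => x /=; rewrite reCD.
rewrite (_ : _ \o _ = (imC \o f) \+ (imC \o g)) => [x|].
  by apply: continuousD; [exact: f2|exact: g2].
by apply/funext => x /=; rewrite imCD.
Qed.

Lemma ccontinuousM f g : ccontinuous f -> ccontinuous g ->
  ccontinuous (fun x => f x * g x).
Proof.
move=> [f1 f2] [g1 g2]; split.
  rewrite (_ : _ \o _ = ((reC \o f) \* (reC \o g)) \- ((imC \o f) \* (imC \o g))) => [x|].
    by apply: continuousB; apply: continuousM; [exact: f1|exact: g1|exact: f2|exact: g2].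
  by apply/funext => x /=; rewrite reCM.
rewrite (_ : _ \o _ = ((reC \o f) \* (imC \o g)) \+ ((imC \o f) \* (reC \o g))) => [x|].
  by apply: continuousD; apply: continuousM; [exact: f1|exact: g2|exact: f2|exact: g1].
by apply/funext => x /=; rewrite imCM.
Qed.

End complex_integral.

Section fourier.
Variable R : realType.
Implicit Types (f g : R -> R[i]).

Local Notation D := (`[0, 2 * pi]%classic : set R).

Lemma conjcM (z w : R[i]) : conjc (z * w) = conjc z * conjc w.
Proof. exact: rmorphM. Qed.

Lemma conjcB (z w : R[i]) : conjc (z - w) = conjc z - conjc w.
Proof. exact: rmorphB. Qed.

Lemma conjc_sum (I : Type) (r : seq I) (F : I -> R[i]) :
  conjc (\sum_(i <- r) F i) = \sum_(i <- r) conjc (F i).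
Proof. exact: (rmorph_sum conjc). Qed.

Lemma realCM (x y : R) : (x * y)%:C = x%:C * y%:C.
Proof. exact: rmorphM. Qed.

Lemma realC_sum (I : Type) (r : seq I) (F : I -> R) :
  (\sum_(i <- r) F i)%:C = \sum_(i <- r) (F i)%:C.
Proof. exact: (rmorph_sum (real_complex R)). Qed.

Lemma cis_2pi_nat (n : nat) : cis (n%:R * (2 * pi) : R) = 1.
Proof.
elim: n => [|n ih]; first by rewrite mul0r cis0.
rewrite -natr1 mulrDl mul1r cisD ih mul1r /cis mulr_natl cos2pi.
by rewrite sin2pi.
Qed.

Lemma cis_2pi (m : int) : cis (m%:~R * (2 * pi) : R) = 1.
Proof.
case: m => n; first exact: cis_2pi_nat.
rewrite NegzE mulrNz mulNr cisN -[n.+1%:~R]/(n.+1%:R) cis_2pi_nat.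
exact: rmorph1.
Qed.

Lemma cint_ext f g : (forall x, D x -> f x = g x) -> cint f = cint g.
Proof.
move=> fg; rewrite /cint /rint; congr (_ +i* _);
  by apply: eq_Rintegral => x /set_mem Dx /=; rewrite fg.
Qed.

Lemma cint_cis (m : int) :
  cint (fun x : R => cis (m%:~R * x)) = if m == 0 then (2 * pi)%:C else 0.
Proof.
case: eqVneq => [->|m0].
  rewrite (_ : (fun x => _) = (fun=> 1)) ?cint_cst ?mulr1//.
  by apply/funext => x; rewrite mul0r cis0.
have im0 : 'i * (m%:~R : R)%:C != 0 :> R[i].
  rewrite mulf_neq0//; last by rewrite (inj_eq (@complexI R) _ 0) intr_eq0.
  by rewrite eq_complex /= oner_eq0 andbF.
pose F (x : R) := ('i * (m%:~R : R)%:C)^-1 * cis (m%:~R * x).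
rewrite (@cint_derive _ F).
- by rewrite /F cis_2pi mulr0 cis0 subrr.
- move=> x; apply: is_cderive_eq (is_cderiveMl _ (is_cderive_cis _ x)) _.
  by rewrite mulrA mulVf// mul1r.
- exact: ccontinuous_cis.
Qed.

Definition fc f (k : int) : R[i] :=
  ((2 * pi)^-1)%:C * cint (fun x => f x * cis (- k%:~R * x)).

Lemma cbmeas_cis (m : R) : cbmeas (fun x => cis (m * x)).
Proof. by apply: cbmeas_continuous; exact: ccontinuous_cis. Qed.

Lemma cbmeas_fc f k : cbmeas f -> cbmeas (fun x => f x * cis (- k%:~R * x)).
Proof. by move=> bf; apply: cbmeasM => //; exact: cbmeas_cis. Qed.

Lemma cint_fc f k :
  cint (fun x => f x * cis (- k%:~R * x)) = (2 * pi)%:C * fc f k.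
Proof.
rewrite /fc mulrA -rmorphM/= divff ?mul1r// gt_eqF//; exact: pi2_gt0.
Qed.

Lemma fcD f g k : cbmeas f -> cbmeas g ->
  fc (fun x => f x + g x) k = fc f k + fc g k.
Proof.
move=> bf bg; rewrite /fc -mulrDr -cintD; [|exact: cbmeas_fc..].
by congr (_ * cint _); apply/funext => x; rewrite mulrDl.
Qed.

Lemma fcZ (z : R[i]) f k : cbmeas f -> fc (fun x => z * f x) k = z * fc f k.
Proof.
move=> bf; rewrite /fc [RHS]mulrCA -(cintZ z (cbmeas_fc k bf)).
by congr (_ * cint _); apply/funext => x; rewrite mulrA.
Qed.

Lemma fcN f k : cbmeas f -> fc (fun x => - f x) k = - fc f k.
Proof.
move=> bf; have := fcZ (-1) k bf; rewrite [RHS]mulN1r => <-.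
by congr (fc _ k); apply/funext => x; rewrite mulN1r.
Qed.

Lemma fcB f g k : cbmeas f -> cbmeas g ->
  fc (fun x => f x - g x) k = fc f k - fc g k.
Proof. by move=> bf bg; rewrite fcD ?fcN//; exact: cbmeasN. Qed.

Lemma fc_sum (I : Type) (r : seq I) (F : I -> R -> R[i]) k :
  (forall i, cbmeas (F i)) ->
  fc (fun x => \sum_(i <- r) F i x) k = \sum_(i <- r) fc (F i) k.
Proof.
move=> bF; rewrite /fc -mulr_sumr -cint_sum; last first.
  by move=> i; exact: cbmeas_fc.
by congr (_ * cint _); apply/funext => x; rewrite mulr_suml.
Qed.

Lemma fc_ext f g k : (forall x, D x -> f x = g x) -> fc f k = fc g k.
Proof. by move=> fg; rewrite /fc; congr (_ * _); apply: cint_ext => x /fg ->. Qed.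

Lemma normc_fc_le f k (B : R) : cbmeas f -> (forall x, D x -> normc (f x) <= B) ->
  normc (fc f k) <= 2 * B.
Proof.
move=> bf fB; rewrite /fc normcM normc_real ger0_norm; last first.
  by rewrite invr_ge0 ltW// pi2_gt0.
rewrite mulrC ler_pdivrMr ?pi2_gt0//.
rewrite (_ : 2 * B * _ = 4 * pi * B); last by ring.
apply: normc_cint_le; first exact: cbmeas_fc.
by move=> x Dx; rewrite normcM normc_cis mulr1 fB.
Qed.

Lemma fc_cis (j k : int) : fc (fun x => cis (j%:~R * x)) k = (j == k)%:R.
Proof.
rewrite /fc (_ : (fun x => _) = (fun x : R => cis ((j - k)%:~R * x))).
  rewrite cint_cis subr_eq0; case: eqP => _; last by rewrite mulr0.
  by rewrite -(rmorphM (real_complex R)) mulVf ?rmorph1// gt_eqF// pi2_gt0.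
by apply/funext => x; rewrite -cisD intrB; congr cis; ring.
Qed.

Lemma fcMcis f (j k : int) : fc (fun x => cis (j%:~R * x) * f x) k = fc f (k - j).
Proof.
rewrite /fc; congr (_ * cint _); apply/funext => x.
rewrite mulrAC -cisD mulrC; congr (_ * cis _); rewrite intrB; ring.
Qed.

Definition trig_poly (I : finType) (kap : I -> int) (z : I -> R[i]) (x : R) :=
  \sum_i z i * cis ((kap i)%:~R * x).

Lemma cbmeas_trig_poly (I : finType) (kap : I -> int) z :
  cbmeas (trig_poly kap z).
Proof.
apply: cbmeas_sum => i; apply: cbmeasM; first exact: cbmeas_cst.
exact: cbmeas_cis.
Qed.

Lemma fc_trig_poly (I : finType) (kap : I -> int) z i : injective kap ->
  fc (trig_poly kap z) (kap i) = z i.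
Proof.
move=> inj; rewrite /trig_poly fc_sum => [|j]; last first.
  by apply: cbmeasM; [exact: cbmeas_cst|exact: cbmeas_cis].
rewrite (bigD1 i)//= big1 => [|j ji]; rewrite fcZ ?fc_cis; try exact: cbmeas_cis.
  by rewrite eqxx mulr1 addr0.
by rewrite (inj_eq inj) (negbTE ji) mulr0.
Qed.

Lemma bessel (I : finType) (kap : I -> int) g (B : R) : injective kap ->
  cbmeas g -> 0 <= B -> (forall x, D x -> normc (g x) <= B) ->
  \sum_i normc (fc g (kap i)) ^+ 2 <= B ^+ 2.
Proof.
move=> inj bg B0 gB.
pose z i := fc g (kap i); pose p := trig_poly kap z; pose S := \sum_i normc (z i) ^+ 2.
have bp : cbmeas p by exact: cbmeas_trig_poly.
have cintp h : cbmeas h -> (forall i, fc h (kap i) = z i) ->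
    cint (fun x => h x * conjc (p x)) = (2 * pi * S)%:C.
  move=> bh hz.
  have -> : (fun x => h x * conjc (p x)) =
      (fun x => \sum_i conjc (z i) * (h x * cis (- (kap i)%:~R * x))).
    apply/funext => x; rewrite /p /trig_poly conjc_sum mulr_sumr.
    by apply: eq_bigr => i _; rewrite conjcM -cisN mulNr mulrCA.
  rewrite cint_sum => [|i]; last first.
    by apply: cbmeasM; [exact: cbmeas_cst|exact: cbmeas_fc].
  rewrite realCM /S realC_sum mulr_sumr; apply: eq_bigr => i _.
  rewrite (cintZ _ (cbmeas_fc _ bh)) cint_fc hz -mulCconj; ring.
have e : cint (fun x => (g x - p x) * conjc (g x - p x)) =
    cint (fun x => g x * conjc (g x)) - (2 * pi * S)%:C.
  have bgp := cbmeasM bg (cbmeas_conj bp).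
  have bgg := cbmeasM bg (cbmeas_conj bg).
  have bpp := cbmeasM bp (cbmeas_conj bp).
  have -> : (fun x => (g x - p x) * conjc (g x - p x)) = (fun x =>
      g x * conjc (g x) - (g x * conjc (p x) + conjc (g x * conjc (p x)))
        + p x * conjc (p x)).
    apply/funext => x; rewrite conjcB conjcM conjcK; ring.
  rewrite cintD//; last by apply: cbmeasB => //; apply: cbmeasD => //; exact: cbmeas_conj.
  rewrite cintB//; last by apply: cbmeasD => //; exact: cbmeas_conj.
  rewrite cintD//; last exact: cbmeas_conj.
  rewrite cint_conj// cintp// cintp//; last by move=> i; exact: fc_trig_poly.
  by rewrite conjc_real; ring.
have : 0 <= reC (cint (fun x => (g x - p x) * conjc (g x - p x))).
  rewrite /cint /=; apply: rint_ge0 => x _ /=.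
  by rewrite mulCconj /= sqr_ge0.
rewrite e reCD reCN /cint/= subr_ge0 => h.
have : 2 * pi * S <= 2 * pi * B ^+ 2.
  apply: (le_trans h); rewrite -rint_cst; apply: rint_le.
  - by have [] := cbmeasM bg (cbmeas_conj bg).
  - exact: bmeas_cst.
  - move=> x Dx /=; rewrite mulCconj /=.
    by rewrite lerXn2r ?nnegrE ?normc_ge0 ?gB.
by rewrite ler_pM2l// pi2_gt0.
Qed.

Lemma measurable_invr : measurable_fun setT (fun x : R => x^-1).
Proof.
have -> : [set: R] = [set x : R | x != 0] `|` [set 0].
  apply/seteqP; split => // x _ /=; have [->|] := eqVneq x 0; [by right|by left].
have o : open [set x : R | x != 0].
  rewrite (_ : mkset _ = ~` [set 0]); last by apply/seteqP; split => x /eqP.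
  by rewrite openC; exact: closed_eq.
apply/measurable_funU; [exact: open_measurable|exact: measurable_set1|split].
  apply: open_continuous_measurable_fun => // x /set_mem /= x0.
  by apply: continuousV => //; exact: cvg_id.
exact: measurable_fun_set1.
Qed.

Lemma cis_chord : exists2 c : R, 0 < c & forall x y : R, `|x - y| <= pi ->
  c * `|x - y| <= normc (cis x - cis y).
Proof.
have c1 : 0 < cos (1 : R) := cos1_gt0 R.
have pi2 : 2 <= pi :> R by exact: pi_ge2.
have inpi (z : R) : 0 <= z -> z <= pi -> z \in `[0, pi] by rewrite in_itv/= => -> ->.
have i1 : (1 : R) \in `[0, pi] by apply: inpi => //; lra.
have c2 : cos (1 : R) < 1.
  by rewrite -[ltRHS](@cos0 R) ltr_cos//; apply: inpi => //; rewrite ltW// pi_gt0.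
pose c := Num.min (cos (1 : R)) ((1 - cos 1) / pi).
have cc1 : c <= cos 1 by rewrite ge_min lexx.
have cc2 : c <= (1 - cos 1) / pi by rewrite ge_min lexx orbT.
have c0 : 0 < c by rewrite lt_min c1 divr_gt0 ?pi_gt0 ?subr_gt0.
exists c => // x y.
wlog yx : x y / y <= x.
  move=> H; have [yx|/ltW xy] := leP y x; first exact: H.
  by rewrite distrC normc_distrC; exact: H.
rewrite ger0_norm ?subr_ge0//; set t := x - y => tpi.
have t0 : 0 <= t by rewrite subr_ge0.
have -> : cis x - cis y = cis y * (cis t - 1).
  by rewrite mulrBr mulr1 -cisD /t (addrC y) subrK.
rewrite normcM normc_cis mul1r.
have [t1|t1] := leP t 1.
  apply: le_trans (normr_imC_le _); rewrite imCD imCN/= subr0.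
  have [s st e] := @MVT_segment _ sin cos _ _ t0 (fun x _ => is_derive_sin x)
    (continuous_subspaceT (@continuous_sin R)).
  move: e; rewrite sin0 !subr0 => ->; move: st; rewrite in_itv/= => /andP[s0 st].
  have h : cos 1 <= cos s.
    have [->//|s1] := eqVneq s 1; apply: ltW; rewrite ltr_cos//.
      by rewrite lt_neqAle s1 (le_trans st).
    by apply: inpi => //; lra.
  rewrite ger0_norm ?mulr_ge0//; last by apply: le_trans h; exact: ltW.
  by rewrite ler_wpM2r// (le_trans cc1).
apply: le_trans (normr_reC_le _); rewrite reCD reCN/=.
have h : cos t <= cos 1.
  by apply: ltW; rewrite ltr_cos//; apply: inpi.
rewrite ler0_norm; last by rewrite subr_le0 cos_le1.
have h2 : c * t <= (1 - cos 1) / pi * pi.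
  by apply: ler_pM => //; exact: ltW.
rewrite divfK in h2; last by rewrite gt_eqF// pi_gt0.
by rewrite opprB; apply: (le_trans h2); move: h; lra.
Qed.

End fourier.

Section inversion.
Variable R : realType.
Implicit Types (f g : R -> R[i]).

Local Notation D := (`[0, 2 * pi]%classic : set R).

Lemma cderive_lipschitz f df (a b B : R) : (forall x, is_cderive f x (df x)) ->
  (forall x : R, a <= x <= b -> normc (df x) <= B) ->
  forall x y : R, a <= x <= b -> a <= y <= b -> normc (f x - f y) <= 2 * B * `|x - y|.
Proof.
move=> fd dB x y; wlog yx : x y / y <= x.
  move=> H hx hy; have [yx|/ltW xy] := leP y x; first exact: H.
  by rewrite distrC normc_distrC; exact: H.
move=> /andP[ax xb] /andP[ay yb].
have MVT1 (h dh : R -> R) : (forall s : R, is_derive s 1 h (dh s)) ->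
    (forall s : R, a <= s <= b -> `|dh s| <= B) -> `|h x - h y| <= B * `|x - y|.
  move=> hd hB; have [c cxy ->] := @MVT_segment _ h dh _ _ yx (fun s _ => hd s)
    (continuous_subspaceT (fun s => is_derive_continuous (hd s))).
  rewrite normrM ler_wpM2r// hB//; move: cxy; rewrite in_itv/= => /andP[yc cx].
  by rewrite (le_trans ay yc) (le_trans cx xb).
have h1 : `|reC (f x) - reC (f y)| <= B * `|x - y|.
  apply: (MVT1 (reC \o f) (reC \o df)) => s; first by case: (fd s).
  by move=> /dB; apply: le_trans; exact: normr_reC_le.
have h2 : `|imC (f x) - imC (f y)| <= B * `|x - y|.
  apply: (MVT1 (imC \o f) (imC \o df)) => s; first by case: (fd s).
  by move=> /dB; apply: le_trans; exact: normr_imC_le.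
apply: le_trans (normc_le_reim _) _.
by rewrite reCD imCD reCN imCN; lra.
Qed.

Lemma ccontinuous_bounded f (a b : R) : ccontinuous f ->
  exists B, forall x : R, a <= x <= b -> normc (f x) <= B.
Proof.
move=> [c1 c2].
have bd (h : R -> R) : continuous h -> exists B, forall x : R, a <= x <= b -> `|h x| <= B.
  move=> hc.
  have : compact (h @` `[a, b]%classic).
    apply: continuous_compact; last exact: segment_compact.
    exact: continuous_subspaceT.
  move/compact_bounded => [B [_ /(_ (B + 1))]]; rewrite ltrDl => /(_ ltr01) hB.
  by exists (B + 1) => x xab; apply: hB; exists x => //=; rewrite in_itv.
have [B1 h1] := bd _ c1; have [B2 h2] := bd _ c2.
exists (B1 + B2) => x xab; apply: le_trans (normc_le_reim _) _.
by apply: lerD; [exact: h1|exact: h2].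
Qed.

Lemma periodic_chord_lipschitz f df : (forall x, f (x + 2 * pi) = f x) ->
  (forall x, is_cderive f x (df x)) -> ccontinuous df ->
  exists2 C : R, 0 <= C & forall x y, D x -> D y ->
    normc (f x - f y) <= C * normc (cis x - cis y).
Proof.
move=> per fd dc.
have p0 := pi_gt0 R.
have [B hB] := @ccontinuous_bounded df (- (2 * pi)) (4 * pi) dc.
have B0 : 0 <= B.
  apply: le_trans (normc_ge0 (df 0)) (hB 0 _); move: p0; lra.
have [c c0 chord] := cis_chord R.
have lip := cderive_lipschitz fd hB.
have per' x : f (x - 2 * pi) = f x by rewrite -(per (x - 2 * pi)) subrK.
have cper (x : R) : cis (x + 2 * pi) = cis x.
  by rewrite cisD; have := @cis_2pi_nat R 1; rewrite mul1r => ->; rewrite mulr1.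
have cper' (x : R) : cis (x - 2 * pi) = cis x.
  by rewrite -(cper (x - 2 * pi)) subrK.
exists (2 * B / c); first by rewrite divr_ge0 ?mulr_ge0// ltW.
have main (x y : R) : - (2 * pi) <= x <= 4 * pi -> - (2 * pi) <= y <= 4 * pi ->
    `|x - y| <= pi -> normc (f x - f y) <= 2 * B / c * normc (cis x - cis y).
  move=> hx hy xy; apply: le_trans (lip x y hx hy) _.
  rewrite -[leRHS]mulrA ler_wpM2l ?mulr_ge0// [leRHS]mulrC ler_pdivlMr// mulrC.
  exact: chord.
move=> x y Dx Dy.
have /andP[x0 x1] : 0 <= x <= 2 * pi by move: Dx; rewrite /= in_itv.
have /andP[y0 y1] : 0 <= y <= 2 * pi by move: Dy; rewrite /= in_itv.
have [xy|xy] := leP `|x - y| pi; first by apply: main => //; move: p0; lra.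
have [yx|xy'] := leP y x.
- rewrite ger0_norm ?subr_ge0// in xy.
  rewrite -(per y) -(cper y); apply: main; try by move: p0; lra.
  by rewrite ler_norml; move: p0; lra.
- rewrite ltr0_norm ?subr_lt0// in xy.
  rewrite -(per' y) -(cper' y); apply: main; try by move: p0; lra.
  by rewrite ler_norml; move: p0; lra.
Qed.

Lemma measurable_reC_div f g : ccontinuous f -> ccontinuous g ->
  measurable_fun D (reC \o (fun x => f x / g x)) /\
  measurable_fun D (imC \o (fun x => f x / g x)).
Proof.
move=> [f1 f2] [g1 g2].
have mf h : continuous h -> measurable_fun D (h : R -> R).
  by move=> hc; apply: measurable_funS (continuous_measurable_fun hc).
have mden : measurable_fun D (fun x => (reC (g x) ^+ 2 + imC (g x) ^+ 2)^-1).
  apply: (measurableT_comp (@measurable_invr R)).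
  by apply: measurable_funD; apply: measurable_funX; exact: mf.
have ere x : reC (f x / g x) = (reC (f x) * reC (g x) + imC (f x) * imC (g x))
    * (reC (g x) ^+ 2 + imC (g x) ^+ 2)^-1.
  by rewrite reCM; case: (f x) => p q; case: (g x) => r s /=; ring.
have eim x : imC (f x / g x) = (imC (f x) * reC (g x) - reC (f x) * imC (g x))
    * (reC (g x) ^+ 2 + imC (g x) ^+ 2)^-1.
  by rewrite imCM; case: (f x) => p q; case: (g x) => r s /=; ring.
split.
- rewrite (_ : _ \o _ = (fun x => (reC (f x) * reC (g x) + imC (f x) * imC (g x))
    * (reC (g x) ^+ 2 + imC (g x) ^+ 2)^-1)); last by apply/funext => x /=.
  apply: measurable_funM => //.
  by apply: measurable_funD; apply: measurable_funM; exact: mf.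
- rewrite (_ : _ \o _ = (fun x => (imC (f x) * reC (g x) - reC (f x) * imC (g x))
    * (reC (g x) ^+ 2 + imC (g x) ^+ 2)^-1)); last by apply/funext => x /=.
  apply: measurable_funM => //.
  by apply: measurable_funB; apply: measurable_funM; exact: mf.
Qed.

Lemma bessel_cvg0 g (B : R) : cbmeas g -> 0 <= B ->
  (forall x, D x -> normc (g x) <= B) ->
  (fun n : nat => normc (fc g n%:Z) + normc (fc g (- n.+1%:Z))) @ \oo --> (0 : R).
Proof.
move=> bg B0 gB.
have sqcvg (kap : nat -> int) : injective kap ->
    (fun n => normc (fc g (kap n)) ^+ 2) @ \oo --> (0 : R).
  move=> inj; apply: cvg_series_cvg_0; apply: nondecreasing_is_cvgn.
    by apply: nondecreasing_series => n _; rewrite sqr_ge0.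
  exists (B ^+ 2) => _ [n _ <-]; rewrite seriesEnat/= big_mkord.
  apply: (@bessel _ _ (fun i : 'I_n => kap i) g B) => // i j /inj.
  exact: ord_inj.
have ncvg (kap : nat -> int) : injective kap ->
    (fun n => normc (fc g (kap n))) @ \oo --> (0 : R).
  move=> inj; rewrite -(sqrtr0 R).
  rewrite (_ : (fun n => _) = (fun n => Num.sqrt (normc (fc g (kap n)) ^+ 2))).
    by apply: (continuous_cvg _ _ (sqcvg _ inj)); exact: sqrt_continuous.
  by apply/funext => n; rewrite sqrtr_sqr ger0_norm// normc_ge0.
rewrite -(addr0 (0 : R)); apply: cvgD; first by apply: ncvg => i j [].
by apply: (ncvg (fun n => - n.+1%:Z)) => i j /oppr_inj [].
Qed.

(* Chernoff's argument: f - f(x0) = (cis - cis x0) * g with g bounded, so that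
   the partial sums of the Fourier series telescope. *)
Lemma fourier_inversion f df (x0 : R) : (forall x, f (x + 2 * pi) = f x) ->
  (forall x, is_cderive f x (df x)) -> ccontinuous df -> D x0 ->
  is_zsum (fun k => fc f k * cis (k%:~R * x0)) (f x0).
Proof.
move=> per fd dc Dx0.
have [C C0 lip] := periodic_chord_lipschitz per fd dc.
have fc1 := ccontinuous_derive fd.
pose p := f x0; pose q := cis x0.
pose g x := (f x - p) / (cis (1 * x) - q).
have cc z h : ccontinuous h -> ccontinuous (fun x : R => h x - z : R[i]).
  by move=> hc; apply: ccontinuousD hc (ccontinuous_cst _).
have gB x : D x -> normc (g x) <= C.
  move=> Dx; rewrite /g normcM normcV mul1r.
  have := normc_ge0 (cis x - q); rewrite le_eqVlt => /predU1P[<-|q0].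
    by rewrite invr0 mulr0.
  by rewrite ler_pdivrMr//; exact: lip.
have bg : cbmeas g.
  have [m1 m2] := measurable_reC_div (cc p f fc1) (cc q _ (ccontinuous_cis 1)).
  by apply: cbmeas_bounded => //; exists C.
have fg x : D x -> f x - p = cis (1%:~R * x) * g x - q * g x.
  move=> Dx; rewrite -mulrBl (_ : 1%:~R = 1 :> R)// /g.
  have [e|ne] := eqVneq (cis (1 * x) - q) 0; last by rewrite mulrC divfK.
  rewrite e mul0r; apply: eq0_normc; apply/eqP; rewrite eq_le normc_ge0 andbT.
  by apply: le_trans (lip _ _ Dx Dx0) _; rewrite -/q -[x]mul1r e normc0 mulr0.
have bf : cbmeas f by exact: cbmeas_continuous.
have fck k : fc f k = p * (0 == k)%:R + (fc g (k - 1) - q * fc g k).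
  rewrite -fcMcis -(fcZ q k bg) -fcB; last 2 first.
  - by apply: cbmeasM => //; exact: cbmeas_cis.
  - by apply: cbmeasM => //; exact: cbmeas_cst.
  rewrite -fc_cis -fcZ; last exact: cbmeas_cis.
  rewrite -fcD; last 2 first.
  - by apply: cbmeasM; [exact: cbmeas_cst|exact: cbmeas_cis].
  - by apply: cbmeasB; apply: cbmeasM => //; [exact: cbmeas_cis|exact: cbmeas_cst].
  by apply: fc_ext => x /fg <-; rewrite mul0r cis0 mulr1 addrC subrK.
pose b (k : int) := cis ((k + 1)%:~R * x0) * fc g k.
have term k : fc f k * cis (k%:~R * x0) = p * (0 == k)%:R + (b (k - 1) - b k).
  rewrite fck /b subrK intrD (_ : 1%:~R = 1 :> R)// [(_ + 1) * x0]mulrDl mul1r cisD -/q.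
  have [<-|_] := eqVneq 0 k; last by rewrite mulr0; ring.
  by rewrite mulr0z mul0r cis0 mulr1; ring.
rewrite /is_zsum.
have zsE (N : nat) : \sum_(j < N.*2.+1) fc f (j%:Z - N%:Z) * cis ((j%:Z - N%:Z)%:~R * x0)
    - f x0 = b (- N.+1%:Z) - b N%:Z.
  under eq_bigr do rewrite term.
  rewrite big_split/= -mulr_sumr.
  have -> : \sum_(j < N.*2.+1) ((0 == j%:Z - N%:Z)%:R : R[i]) = 1.
    have NN : (N < N.*2.+1)%N by rewrite ltnS -addnn leq_addr.
    rewrite (bigD1 (Ordinal NN))//= subrr eqxx big1 ?addr0// => j jN.
    rewrite eq_sym subr_eq0 eqz_nat; case: eqP => // e.
    by move/eqP: jN; case; apply: val_inj.
  rewrite mulr1 -/p [p + _]addrC addrK.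
  rewrite (eq_bigr (fun j : 'I_(N.*2.+1) =>
     (- b (j.+1%:Z - N.+1%:Z)) - (- b (j%:Z - N.+1%:Z)))); last first.
    move=> j _; rewrite opprK [RHS]addrC; congr (b _ - b _).
      by rewrite (intS N); ring.
    by rewrite (intS N) (intS j); ring.
  rewrite -(big_mkord xpredT (fun j => - b (j.+1%:Z - N.+1%:Z) - - b (j%:Z - N.+1%:Z))).
  rewrite (telescope_sumr (fun j : nat => - b (j%:Z - N.+1%:Z)))//.
  rewrite opprK addrC sub0r; congr (_ - b _).
  by rewrite -addnn -addnS PoszD addrK.
have h := bessel_cvg0 bg C0 gB.
apply: (@squeeze_cvgr _ _ _ _ (fun=> 0) _ _ _ _ _ h); last exact: cvg_cst.
apply: nearW => N; apply/andP; split; first exact: normc_ge0.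
rewrite zsE; apply: le_trans (ler_normcB _ _) _; rewrite [leLHS]addrC.
by rewrite /b !(normcM (cis _)) !normc_cis !mul1r.
Qed.

End inversion.

Section symmetric_sums.

Definition zs (V : nmodType) (F : int -> V) (N : nat) : V :=
  \sum_(j < N.*2.+1) F (j%:Z - N%:Z).

Definition zidx (N : nat) (j : 'I_N.*2.+1) : int := j%:Z - N%:Z.

Lemma zidx_inj N : injective (@zidx N).
Proof. by move=> i j /addIr [] /ord_inj. Qed.

Lemma zsS (V : nmodType) (F : int -> V) N :
  zs F N.+1 = zs F N + (F N.+1%:Z + F (- N.+1%:Z)).
Proof.
rewrite /zs doubleS big_ord_recl big_ord_recr/= sub0r.
rewrite addrC -addrA; congr (_ + (_ + _)).
  by apply: eq_bigr => j _; congr F; rewrite /bump/= add1n !intS; ring.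
by congr F; rewrite /bump/= add1n -addnn !intS PoszD; ring.
Qed.

Lemma zs0 (V : nmodType) (F : int -> V) : zs F 0 = F 0.
Proof. by rewrite /zs big_ord1 subrr. Qed.

End symmetric_sums.

Section fourier_c2.
Variable R : realType.
Implicit Types (f g : R -> R[i]).

Local Notation D := (`[0, 2 * pi]%classic : set R).

Lemma fc_derive f df (k : int) : (forall x, f (x + 2 * pi) = f x) ->
  (forall x, is_cderive f x (df x)) -> ccontinuous df ->
  fc df k = 'i * (k%:~R : R)%:C * fc f k.
Proof.
move=> per fd dc.
have fc1 := ccontinuous_derive fd.
pose e (x : R) := cis (- k%:~R * x).
pose g x := df x * e x + f x * ('i * (- k%:~R : R)%:C * e x).
have ce : ccontinuous e by exact: ccontinuous_cis.
have gd x : is_cderive (fun x => f x * e x) x (g x).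
  exact: is_cderiveM (fd x) (is_cderive_cis _ x).
have b1 : cbmeas (fun x => df x * e x).
  by apply: cbmeas_fc; exact: cbmeas_continuous.
have b2 : cbmeas (fun x => f x * e x).
  by apply: cbmeas_fc; exact: cbmeas_continuous.
have gc : ccontinuous g.
  apply: ccontinuousD; first exact: ccontinuousM.
  by apply: ccontinuousM => //; apply: ccontinuousM => //; exact: ccontinuous_cst.
have := cint_derive gd gc.
have -> : f (2 * pi) * e (2 * pi) - f 0 * e 0 = 0.
  rewrite -(per 0) add0r /e mulr0 cis0 mulr1 -mulrNz cis_2pi mulr1.
  by rewrite subrr.
have -> : g = fun x => df x * e x + (- ('i * (k%:~R : R)%:C)) * (f x * e x).
  by apply/funext => x; rewrite /g rmorphN; ring.
rewrite cintD//; last by apply: cbmeasM => //; exact: cbmeas_cst.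
rewrite cintZ// mulNr => /subr0_eq e1.
by rewrite /fc e1 mulrCA.
Qed.

Lemma zs_geo_tail (F : int -> R[i]) (A : R) (N M : nat) : 0 <= A ->
  (forall k : int, k != 0 -> normc (F k) <= A / (k%:~R ^+ 2)) ->
  (0 < N)%N -> (N <= M)%N ->
  normc (zs F M - zs F N) <= 2 * A * (N%:R^-1 - M%:R^-1).
Proof.
move=> A0 FA N0; elim: M => [|M ih].
  by rewrite leqn0 => /eqP e; rewrite e in N0.
rewrite leq_eqVlt => /predU1P[->|]; first by rewrite !subrr normc0 mulr0.
rewrite ltnS => NM; have M0 : (0 < M)%N := leq_trans N0 NM.
rewrite zsS addrAC; apply: le_trans (ler_normcD _ _) _.
have h1 : normc (F M.+1%:Z) <= A / M.+1%:R ^+ 2 by exact: FA.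
have h2 : normc (F (- M.+1%:Z)) <= A / M.+1%:R ^+ 2.
  by apply: le_trans (FA _ _) _; rewrite ?oppr_eq0// mulrNz sqrrN.
have h3 := le_trans (ler_normcD _ _) (lerD h1 h2).
apply: le_trans (lerD (ih NM) h3) _.
have m0 : 0 < M%:R :> R by rewrite ltr0n.
have m1 : 0 < M.+1%:R :> R by rewrite ltr0n.
have h4 : (M.+1%:R ^+ 2)^-1 <= M%:R^-1 - M.+1%:R^-1 :> R.
  rewrite -natr1 in m1 *.
  have -> : M%:R^-1 - (M%:R + 1)^-1 = (M%:R * (M%:R + 1))^-1 :> R.
    by field; rewrite !gt_eqF.
  by rewrite lef_pV2 ?posrE ?exprn_gt0 ?mulr_gt0// expr2 ler_pM2r// lerDl.
have := ler_wpM2l A0 h4.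
move: N%:R^-1 M%:R^-1 M.+1%:R^-1 (M.+1%:R ^+ 2)^-1 => p q r s; lra.
Qed.

Lemma periodic_cderive f (p x : R) df : (forall y, f (y + p) = f y) ->
  is_cderive f (x + p) df -> is_cderive f x df.
Proof.
move=> per [h1 h2].
have sh (h : R -> R) (dh : R) : (forall y, h (y + p) = h y) ->
    is_derive (x + p) 1 h dh -> is_derive x 1 h dh.
  move=> hper hd.
  have s : is_derive x (1 : R) (fun y : R => y + p) 1.
    apply: is_derive_eq (is_deriveD (is_derive_id x 1) (is_derive_cst p x 1)) _.
    by rewrite addr0.
  have := @is_derive1_comp _ h (fun y => y + p) x dh 1 hd s; rewrite mulr1.
  by rewrite (_ : h \o _ = h)//; apply/funext => y /=.
by split; apply: sh => // y /=; rewrite per.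
Qed.

Lemma fourier_rate f df ddf (B : R) : (forall x, f (x + 2 * pi) = f x) ->
  (forall x, is_cderive f x (df x)) -> (forall x, is_cderive df x (ddf x)) ->
  ccontinuous ddf -> (forall x, D x -> normc (ddf x) <= B) ->
  forall (N : nat) x0, (0 < N)%N -> D x0 ->
  normc (f x0 - zs (fun k => fc f k * cis (k%:~R * x0)) N) <= 4 * B / N%:R.
Proof.
move=> per fd dfd ddc ddB N x0 N0 Dx0.
have D0 : D 0 by rewrite /= in_itv/= lexx ltW// pi2_gt0.
have B0 : 0 <= B by exact: le_trans (normc_ge0 _) (ddB 0 D0).
have dfc := ccontinuous_derive dfd.
have dper x : df (x + 2 * pi) = df x.
  rewrite -(is_cderiveE (fd x)).
  by rewrite (is_cderiveE (periodic_cderive per (fd (x + 2 * pi)))).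
have fcB k : k != 0 -> normc (fc f k) <= 2 * B / k%:~R ^+ 2.
  move=> k0; have kR : 0 < (k%:~R : R) ^+ 2 by rewrite exprn_even_gt0//= intr_eq0.
  have e := fc_derive k dper dfd ddc.
  rewrite (fc_derive k per fd dfc) in e.
  rewrite ler_pdivlMr//; apply: le_trans (_ : _ <= normc (fc ddf k)) _; last first.
    by apply: normc_fc_le => //; exact: cbmeas_continuous.
  rewrite e !normcM normc_i normc_real !mul1r mulrC mulrA -expr2.
  by rewrite real_normK ?num_real.
have inv := fourier_inversion per fd dfc Dx0.
pose F k := fc f k * cis (k%:~R * x0).
have FA k : k != 0 -> normc (F k) <= 2 * B / k%:~R ^+ 2.
  by move=> k0; rewrite normcM normc_cis mulr1 fcB.
apply/ler_addgt0Pr => e e0.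
move: inv; rewrite /is_zsum => /cvgrPdist_lt /(_ e e0)[M _ hM].
pose M' := maxn M N.
have := hM M' (leq_maxl _ _); rewrite sub0r normrN ger0_norm ?normc_ge0//.
rewrite -/(zs F M') => h1.
have h2 := zs_geo_tail (mulr_ge0 (ler0n _ 2) B0) FA N0 (leq_maxr M N).
rewrite -(subrKA (zs F M')); apply: le_trans (ler_normcD _ _) _.
rewrite addrC lerD//; last by rewrite normc_distrC ltW.
apply: (le_trans h2); rewrite mulrA (_ : 2 * 2 = 4 :> R); last by ring.
by rewrite ler_wpM2l ?mulr_ge0// lerBlDr lerDl invr_ge0.
Qed.

Lemma continuous_slicel (h : R * R -> R) (t : R) : continuous h ->
  continuous (fun x => h (t, x)).
Proof.
move=> hc x; apply: (@continuous_comp _ _ _ (fun x => (t, x)) h).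
  exact: (@cvg_pair _ _ _ _ (nbhs t) (nbhs x) _ _ _ (fun=> t) id (cvg_cst t) cvg_id).
exact: hc.
Qed.

Lemma continuous2_bounded (h : R * R -> R) (a b a' b' : R) : continuous h ->
  exists B, forall t x : R, a <= t <= b -> a' <= x <= b' -> `|h (t, x)| <= B.
Proof.
move=> hc.
have : compact (h @` (`[a, b]%classic `*` `[a', b']%classic)).
  apply: continuous_compact; first exact: continuous_subspaceT.
  by apply: compact_setX; exact: segment_compact.
move/compact_bounded => [B [_ /(_ (B + 1))]]; rewrite ltrDl => /(_ ltr01) hB.
exists (B + 1) => t x tab xab; apply: hB.
by exists (t, x) => //=; rewrite !in_itv.
Qed.

Lemma is_derive_rint (h dh : R -> R -> R) :
  (forall t x : R, is_derive t 1 (h^~ x) (dh t x)) ->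
  (forall t, continuous (h t)) ->
  continuous (fun p : R * R => dh p.1 p.2) ->
  forall t : R, is_derive t 1 (fun s => rint (h s)) (rint (dh t)).
Proof.
move=> hd hc dhc t.
have [B hB] := @continuous2_bounded (fun p => dh p.1 p.2) (t - 1) (t + 1) 0 (2 * pi) dhc.
have It : `]t - 1, t + 1[%classic t by rewrite /= in_itv/=; lra.
have ih (s : R) : `]t - 1, t + 1[%classic s ->
    lebesgue_measure.-integrable D (EFin \o h s).
  by move=> _; apply: bmeas_integrable; apply: bmeas_continuous; exact: hc.
have dh1 (s x : R) : `]t - 1, t + 1[%classic s -> D x -> derivable (h^~ x) s 1.
  by move=> _ _; case: (hd s x).
have dB (s x : R) : `]t - 1, t + 1[%classic s -> D x ->
    `|partial1of2 h s x| <= `|B|.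
  rewrite /= !in_itv/= => /andP[s1 s2] xD.
  rewrite partial1of2E (_ : 'D_1 _ s = dh s x); last by case: (hd s x).
  by apply: le_trans (hB s x _ xD) (ler_norm B); rewrite !ltW.
have ib : lebesgue_measure.-integrable D (EFin \o (fun=> `|B|)).
  by apply: bmeas_integrable; exact: bmeas_cst.
have dr := @derivable_under_integral R _ _ (@lebesgue_measure R) h D (measurable_itv _) _ _ _ It ih dh1 _ (fun=> normr_ge0 B) ib dB.
have de := @differentiation_under_integral R _ _ (@lebesgue_measure R) h D (measurable_itv _) _ _ _ It ih dh1 _ (fun=> normr_ge0 B) ib dB.
apply: DeriveDef => //; rewrite -derive1E /rint de.
apply: eq_Rintegral => x _; rewrite partial1of2E.
by case: (hd t x).
Qed.

Lemma is_cderive_fc (v dv : R -> R -> R[i]) (k : int) :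
  (forall t x, is_cderive (v^~ x) t (dv t x)) ->
  (forall t, ccontinuous (v t)) -> ccontinuous2 dv ->
  forall t, is_cderive (fun s => fc (v s) k) t (fc (dv t) k).
Proof.
move=> vd vc [c1 c2] t; rewrite /fc; apply: is_cderiveMl.
pose e (x : R) := cis (- k%:~R * x).
have ce : ccontinuous e by exact: ccontinuous_cis.
have d s x : is_cderive (fun s => v s x * e x) s (dv s x * e x).
  apply: is_cderive_eq (is_cderiveM (vd s x) (is_cderive_cst _ s)) _.
  by rewrite mulr0 addr0.
have jc (g : R -> R) : continuous g -> continuous (fun p : R * R => g p.2).
  by move=> gc p; apply: continuous_comp; [exact: cvg_snd|exact: gc].
split.
- apply: (@is_derive_rint (fun s x => reC (v s x * e x))
    (fun s x => reC (dv s x * e x))).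
  + by move=> s x; case: (d s x).
  + by move=> s; case: (ccontinuousM (vc s) ce).
  + rewrite (_ : (fun p => _) = ((fun p : R * R => reC (dv p.1 p.2)) \* (fun p => reC (e p.2))
       \- (fun p => imC (dv p.1 p.2)) \* (fun p => imC (e p.2)))); last by apply/funext => p; rewrite reCM.
    move=> p; apply: continuousB; apply: continuousM;
      [exact: c1|exact: jc ce.1 p|exact: c2|exact: jc ce.2 p].
- apply: (@is_derive_rint (fun s x => imC (v s x * e x))
    (fun s x => imC (dv s x * e x))).
  + by move=> s x; case: (d s x).
  + by move=> s; case: (ccontinuousM (vc s) ce).
  + rewrite (_ : (fun p => _) = ((fun p : R * R => reC (dv p.1 p.2)) \* (fun p => imC (e p.2))
       \+ (fun p => imC (dv p.1 p.2)) \* (fun p => reC (e p.2)))); last by apply/funext => p; rewrite imCM.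
    move=> p; apply: continuousD; apply: continuousM;
      [exact: c1|exact: jc ce.2 p|exact: c2|exact: jc ce.1 p].
Qed.

End fourier_c2.

Section nls_fourier.
Variable R : realType.

Local Notation D := (`[0, 2 * pi]%classic : set R).

Definition cubeC (z : R[i]) : R[i] := (normc z ^+ 2)%:C * z.

Lemma cubeCE (z : R[i]) : cubeC z = z * conjc z * z.
Proof. by rewrite /cubeC mulCconj. Qed.

Lemma cubeC_lipschitz (z w : R[i]) (B : R) : normc z <= B -> normc w <= B ->
  normc (cubeC z - cubeC w) <= 3 * B ^+ 2 * normc (z - w).
Proof.
move=> zB wB; have B0 := le_trans (normc_ge0 z) zB.
have -> : cubeC z - cubeC w = z * conjc z * (z - w)
    + (z * conjc (z - w) * w + (z - w) * conjc w * w).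
  by rewrite !cubeCE conjcB; ring.
have gz := normc_ge0 z; have gw := normc_ge0 w; have gd := normc_ge0 (z - w).
apply: le_trans (ler_normcD _ _) _.
apply: le_trans (lerD (lexx _) (ler_normcD _ _)) _.
rewrite !normcM !normc_conj.
have h1 : normc z * normc z <= B * B by exact: ler_pM.
have h2 : normc z * normc w <= B * B by exact: ler_pM.
have h3 : normc w * normc w <= B * B by exact: ler_pM.
have := ler_wpM2r gd h1; have := ler_wpM2r gd h2; have := ler_wpM2r gd h3.
by rewrite expr2; lra.
Qed.

Lemma fc_cubic (I : finType) (kap : I -> int) (z : I -> R[i]) k :
  fc (fun x => cubeC (trig_poly kap z x)) (kap k) =
  \sum_a \sum_b \sum_(c | match4 kap k a b c) triad z a b c.
Proof.
pose G a b c (x : R) := triad z a b c * cis ((kap a - kap b + kap c)%:~R * x).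
have bG a b c : cbmeas (G a b c).
  by apply: cbmeasM; [exact: cbmeas_cst|exact: cbmeas_cis].
have -> : (fun x => cubeC (trig_poly kap z x)) =
    (fun x => \sum_a \sum_b \sum_c G a b c x).
  apply/funext => x; rewrite cubeCE /trig_poly conjc_sum.
  rewrite big_distrl/= big_distrl/=; apply: eq_bigr => a _.
  rewrite [_ * cis _ * _]big_distrr big_distrl/=; apply: eq_bigr => b _.
  rewrite big_distrr/=; apply: eq_bigr => c _.
  rewrite /G /triad conjcM -cisN intrD intrB.
  have -> : ((kap a)%:~R - (kap b)%:~R + (kap c)%:~R) * x =
      (kap a)%:~R * x + - ((kap b)%:~R * x) + (kap c)%:~R * x by ring.
  by rewrite !cisD; ring.
rewrite fc_sum => [|a]; last by apply: cbmeas_sum => b; exact: cbmeas_sum.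
apply: eq_bigr => a _.
rewrite fc_sum => [|b]; last exact: cbmeas_sum.
apply: eq_bigr => b _.
rewrite fc_sum// [RHS]big_mkcond/=; apply: eq_bigr => c _.
rewrite /G fcZ; last exact: cbmeas_cis.
by rewrite fc_cis /match4; case: eqP => _; rewrite ?mulr1 ?mulr0.
Qed.

Lemma cbmeas_cube f : cbmeas f -> cbmeas (fun x : R => cubeC (f x)).
Proof.
move=> bf; rewrite (_ : (fun x => _) = (fun x => f x * conjc (f x) * f x)).
  by apply: cbmeasM => //; apply: cbmeasM => //; exact: cbmeas_conj.
by apply/funext => x; rewrite cubeCE.
Qed.

Lemma sum_le_bessel (I : finType) (a : I -> R) (B th : R) : 0 < th ->
  \sum_i a i ^+ 2 <= B ^+ 2 ->
  \sum_i a i <= (#|I|%:R * th + B ^+ 2 / th) / 2.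
Proof.
move=> th0 aB.
apply: (@le_trans _ _ (\sum_i (th + a i ^+ 2 / th) / 2)).
  apply: ler_sum => i _; rewrite ler_pdivlMr//.
  rewrite -(ler_pM2r th0) mulrDl divfK ?gt_eqF// -subr_ge0.
  by rewrite (_ : _ - _ = (th - a i) ^+ 2) ?sqr_ge0//; ring.
rewrite -mulr_suml big_split/= ler_wpM2r// lerD//.
  by rewrite sumr_const mulr_natl.
by rewrite -mulr_suml ler_wpM2r// invr_ge0 ltW.
Qed.

Section solution.
Variables (lam : R) (v : R -> R -> R[i]).
Hypothesis sol : nls_solution lam v.

Definition nls_mode (k : int) (t : R) : R[i] :=
  cis ((k%:~R) ^+ 2 * t) * fc (v t) k.

Definition nls_dmode (k : int) (t : R) : R[i] :=
  - ('i * lam%:C * (cis ((k%:~R) ^+ 2 * t) * fc (fun x => cubeC (v t x)) k)).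

Lemma nls_per t x : v t (x + 2 * pi) = v t x.
Proof. by case: sol. Qed.

Lemma nls_dt t x : is_cderive (v^~ x) t (dt v t x).
Proof. by apply: cderivableP; case: sol => _ /(_ t x)[]. Qed.

Lemma nls_dx t x : is_cderive (v t) x (dx v t x).
Proof. by apply: cderivableP; case: sol => _ /(_ t x)[]. Qed.

Lemma nls_dxx t x : is_cderive (dx v t) x (dx (dx v) t x).
Proof. by apply: cderivableP; case: sol => _ /(_ t x)[]. Qed.

Lemma ccontinuous2_slice (g : R -> R -> R[i]) t : ccontinuous2 g -> ccontinuous (g t).
Proof. move=> [c1 c2].
by split; [exact: (@continuous_slicel R _ t c1)|exact: (@continuous_slicel R _ t c2)]. Qed.

Lemma dx_per t x : dx v t (x + 2 * pi) = dx v t x.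
Proof.
rewrite -[RHS](is_cderiveE (nls_dx t x)).
have h : is_cderive (v t) x (dx v t (x + 2 * pi)).
  exact: periodic_cderive (nls_per t) (nls_dx t _).
by rewrite (is_cderiveE h).
Qed.

Lemma is_cderive_mode k t : is_cderive (nls_mode k) t (nls_dmode k t).
Proof.
have [_ _ [cv cdt cdx cdxx] eqn] := sol.
have vc s : ccontinuous (v s) by exact: ccontinuous2_slice.
have h := is_cderive_fc k nls_dt vc cdt t.
apply: is_cderive_eq (is_cderiveM (is_cderive_cis _ t) h) _.
have b1 : cbmeas (dt v t) by apply: cbmeas_continuous; exact: ccontinuous2_slice.
have b2 : cbmeas (dx (dx v) t) by apply: cbmeas_continuous; exact: ccontinuous2_slice.
have b3 : cbmeas (fun x => cubeC (v t x)).
  by apply: cbmeas_cube; exact: cbmeas_continuous.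
have e2 : fc (dx (dx v) t) k = - ((k%:~R ^+ 2 : R)%:C * fc (v t) k).
  rewrite (fc_derive k (dx_per t) (nls_dxx t)); last exact: ccontinuous2_slice.
  rewrite (fc_derive k (nls_per t) (nls_dx t)); last exact: ccontinuous2_slice.
  rewrite expr2 realCM; have := sqr_i R; rewrite expr2 => i2.
  transitivity ('i * 'i * ((k%:~R : R)%:C * (k%:~R : R)%:C * fc (v t) k)).
    by ring.
  by rewrite i2 mulN1r.
have e1 : 'i * fc (dt v t) k = lam%:C * fc (fun x => cubeC (v t x)) k
    - fc (dx (dx v) t) k.
  rewrite -fcZ// -fcZ// -fcB//; last by apply: cbmeasM => //; exact: cbmeas_cst.
  apply: fc_ext => x _; apply/eqP; rewrite eq_sym subr_eq; apply/eqP.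
  by rewrite -[X in X * dt _ _ _]/(0 +i* 1) eqn realCM /cubeC mulrA.
have e3 : fc (dt v t) k = - ('i * (lam%:C * fc (fun x => cubeC (v t x)) k
    + (k%:~R ^+ 2 : R)%:C * fc (v t) k)).
  rewrite -[X in _ + X]opprK -e2 -e1 mulrA -expr2 sqr_i.
  by rewrite mulN1r opprK.
rewrite /nls_dmode e3; ring.
Qed.

Let I N := 'I_N.*2.+1.

Lemma cubic_mode N (k : I N) t :
  cubic (@zidx N) k t (fun j => nls_mode (zidx j) t) =
  cis ((zidx k)%:~R ^+ 2 * t) * fc (fun x =>
    cubeC (trig_poly (@zidx N) (fun j => fc (v t) (zidx j)) x)) (zidx k).
Proof.
rewrite fc_cubic mulr_sumr; apply: eq_bigr => a _.
rewrite mulr_sumr; apply: eq_bigr => b _.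
rewrite mulr_sumr; apply: eq_bigr => c _.
rewrite /triad /nls_mode conjcM -cisN.
set A := fc _ _; set B := conjc _; set C := fc _ _.
transitivity (cis ((phase (@zidx N) k a b c)%:~R * t) * cis ((zidx a)%:~R ^+ 2 * t)
  * cis (- ((zidx b)%:~R ^+ 2 * t)) * cis ((zidx c)%:~R ^+ 2 * t) * (A * B * C)).
  by ring.
rewrite -!cisD; congr (cis _ * _).
rewrite /phase; move: (zidx k) (zidx a) (zidx b) (zidx c) => m p q r.
by rewrite !(intrB, intrD) !rmorphXn; ring.
Qed.

Lemma trig_poly_zs t N x :
  trig_poly (@zidx N) (fun j => fc (v t) (zidx j)) x =
  zs (fun k => fc (v t) k * cis (k%:~R * x)) N.
Proof. by []. Qed.

Lemma nls_fourier (T eta : R) : 0 < lam -> 0 < eta ->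
  exists N0, forall N, (N0 <= N)%N ->
  (forall s, 0 <= s <= T -> l1 (fun k : I N =>
     nls_dmode (zidx k) s + 'i * lam%:C *
       cubic (@zidx N) k s (fun j => nls_mode (zidx j) s)) <= eta) /\
  (forall s x, 0 <= s <= T -> D x ->
     normc (v s x - zs (fun k => fc (v s) k * cis (k%:~R * x)) N) <= eta).
Proof.
move=> lam0 eta0.
have [_ _ [cv cdt cdx cdxx] _] := sol.
have bounded2 (g : R -> R -> R[i]) : ccontinuous2 g -> exists B, forall s x,
    0 <= s <= T -> D x -> normc (g s x) <= B.
  move=> [c1 c2].
  have [B1 h1] := @continuous2_bounded R _ 0 T 0 (2 * pi) c1.
  have [B2 h2] := @continuous2_bounded R _ 0 T 0 (2 * pi) c2.
  exists (B1 + B2) => s x sT; rewrite /= in_itv/= => xD.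
  apply: le_trans (normc_le_reim _) _; apply: lerD; first exact: (h1 s x).
  exact: (h2 s x).
have [B1 hB1] := bounded2 _ cv; have [B2 hB2] := bounded2 _ cdxx.
have vc s : ccontinuous (v s) by exact: ccontinuous2_slice.
pose E := 4 * `|B2|; have E0 : 0 <= E by rewrite mulr_ge0.
pose B := `|B1| + E.
have B0 : 0 <= B by rewrite addr_ge0.
have rate N s x : (0 < N)%N -> 0 <= s <= T -> D x ->
    normc (v s x - zs (fun k => fc (v s) k * cis (k%:~R * x)) N) <= E / N%:R.
  move=> N0 sT Dx.
  apply: (fourier_rate (nls_per s) (nls_dx s) (nls_dxx s)) => //.
    exact: ccontinuous2_slice.
  by move=> y Dy; apply: le_trans (hB2 s y sT Dy) (ler_norm _).
pose Q := 3 * B ^+ 2 * E.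
have Q0 : 0 <= Q by rewrite !mulr_ge0 ?sqr_ge0.
(* the weight [eta / (3 N lam)] balances the number of modes against the
   quadratic decay of the error *)
have err N s : (0 < N)%N -> 0 <= s <= T -> l1 (fun k : I N =>
     nls_dmode (zidx k) s + 'i * lam%:C *
       cubic (@zidx N) k s (fun j => nls_mode (zidx j) s)) <=
   eta / 2 + (3 * lam ^+ 2 * Q ^+ 2 / (2 * eta)) / N%:R.
  move=> N0 sT.
  have n0 : 0 < N%:R :> R by rewrite ltr0n.
  pose p := trig_poly (@zidx N) (fun j => fc (v s) (zidx j)).
  have bp : cbmeas p by exact: cbmeas_trig_poly.
  pose g x := cubeC (v s x) - cubeC (p x).
  have bv : cbmeas (fun x => cubeC (v s x)).
    by apply: cbmeas_cube; exact: cbmeas_continuous.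
  have bpc : cbmeas (fun x => cubeC (p x)) by exact: cbmeas_cube.
  have gQ x : D x -> normc (g x) <= Q / N%:R.
    move=> Dx; have r := rate N s x N0 sT Dx; rewrite -trig_poly_zs -/p in r.
    have v1 : normc (v s x) <= `|B1| by apply: le_trans (hB1 s x sT Dx) (ler_norm _).
    have v2 : normc (v s x) <= B by rewrite (le_trans v1)// lerDl.
    have p2 : normc (p x) <= B.
      rewrite -[p x](subKr (v s x)); apply: le_trans (ler_normcB _ _) _.
      apply: lerD => //; apply: (le_trans r).
      by rewrite ler_pdivrMr// ler_peMr// ler1n.
    apply: le_trans (cubeC_lipschitz v2 p2) _.
    by rewrite /Q -[leRHS]mulrA ler_wpM2l// mulr_ge0// sqr_ge0.
  have QN : 0 <= Q / N%:R by rewrite divr_ge0.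
  have bes := bessel (@zidx_inj N) (cbmeasB bv bpc) QN gQ.
  have th0 : 0 < eta / (3 * N%:R * lam) by rewrite divr_gt0// !mulr_gt0.
  have := sum_le_bessel th0 bes.
  set S := \sum_i _ => hS.
  apply: (@le_trans _ _ (lam * S)).
    rewrite /l1 /S mulr_sumr; apply: ler_sum => k _.
    rewrite cubic_mode /nls_dmode -/p.
    rewrite (_ : _ + _ = - ('i * lam%:C * (cis ((zidx k)%:~R ^+ 2 * s)
       * (fc (fun x => cubeC (v s x)) (zidx k) - fc (fun x => cubeC (p x)) (zidx k))))).
      by rewrite -fcB// normcN !normcM normc_i normc_cis normc_real !mul1r gtr0_norm.
    ring.
  have card : #|I N|%:R <= 3 * N%:R :> R.
    by rewrite card_ord -natrM ler_nat -addn1 (mulnDl 2 1) mul1n mul2n leq_add2l.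
  have h2 : lam * S <= lam * ((3 * N%:R * (eta / (3 * N%:R * lam))
     + (Q / N%:R) ^+ 2 / (eta / (3 * N%:R * lam))) / 2).
    rewrite ler_pM2l//; apply: (le_trans hS).
    by rewrite ler_wpM2r// lerD2r ler_wpM2r// ltW.
  apply: (le_trans h2); rewrite le_eqVlt; apply/orP; left; apply/eqP.
  by field; rewrite !gt_eqF.
pose Z := Num.max (E / eta) ((3 * lam ^+ 2 * Q ^+ 2 / (2 * eta)) / (eta / 2)).
exists (Num.truncn Z).+1 => N NZ.
have N0 : (0 < N)%N by exact: leq_trans NZ.
have n0 : 0 < N%:R :> R by rewrite ltr0n.
have ZN : Z <= N%:R.
  apply: (le_trans (ltW (truncnS_gt Z))); by rewrite ler_nat.
have Z1 : E / eta <= N%:R by apply: le_trans ZN; rewrite le_max lexx.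
have Z2 : (3 * lam ^+ 2 * Q ^+ 2 / (2 * eta)) / (eta / 2) <= N%:R.
  by apply: le_trans ZN; rewrite le_max lexx orbT.
split.
- move=> s sT; apply: le_trans (err N s N0 sT) _.
  rewrite [leRHS](splitr eta) lerD2l ler_pdivrMr//.
  by rewrite [leRHS]mulrC -ler_pdivrMr// divr_gt0.
- move=> s x sT Dx; apply: le_trans (rate N s x N0 sT Dx) _.
  by rewrite ler_pdivrMr// mulrC -ler_pdivrMr.
Qed.

End solution.
End nls_fourier.

Section nls_resonant.
Variable R : realType.

Local Notation D := (`[0, 2 * pi]%classic : set R).

Lemma initial_fc (c : int -> R) (e : int -> R[i]) (g : R -> R[i]) (A : R) k :
  0 <= A -> (forall j : int, j != 0 -> normc ((c j)%:C * e j) <= A / j%:~R ^+ 2) ->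
  ccontinuous g -> initial_datum c e g -> fc g k = (c k)%:C * e k.
Proof.
move=> A0 cA gc ini.
have bg : cbmeas g by exact: cbmeas_continuous.
pose z j := (c j)%:C * e j.
have rate N x : (0 < N)%N -> normc (g x - trig_poly (@zidx N) (z \o @zidx N) x)
    <= 2 * A / N%:R.
  move=> N0; apply/ler_addgt0Pr => eta eta0.
  move: (ini x); rewrite /is_zsum => /cvgrPdist_lt /(_ eta eta0)[M _ hM].
  pose M' := maxn M N.
  have := hM M' (leq_maxl _ _); rewrite sub0r normrN ger0_norm ?normc_ge0//.
  pose F j := z j * cis (j%:~R * x).
  rewrite -/(zs F M') => h1.
  have FA j : j != 0 -> normc (F j) <= A / j%:~R ^+ 2.
    by move=> j0; rewrite normcM normc_cis mulr1 cA.
  have h2 := zs_geo_tail A0 FA N0 (leq_maxr M N).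
  rewrite -/(zs F N) -(subrKA (zs F M')); apply: le_trans (ler_normcD _ _) _.
  rewrite addrC lerD//; last by rewrite normc_distrC ltW.
  apply: (le_trans h2).
  by rewrite ler_wpM2l ?mulr_ge0// lerBlDr lerDl invr_ge0.
apply/eqP; rewrite -subr_eq0; apply/eqP; apply: eq0_normc.
apply/eqP; rewrite eq_le normc_ge0 andbT.
have main N : (`|k|%N < N)%N -> normc (fc g k - z k) <= 4 * A / N%:R.
  move=> kN; have N0 : (0 < N)%N by exact: leq_ltn_trans kN.
  have jN : (absz (k + N%:Z)%R < N.*2.+1)%N by rewrite -addnn; lia.
  have ej : zidx (Ordinal jN) = k.
    by rewrite /zidx/= gez0_abs ?addrK//; lia.
  have := @fc_trig_poly R _ (@zidx N) (z \o @zidx N) (Ordinal jN) (@zidx_inj N).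
  rewrite ej /= ej => <-.
  rewrite -fcB//; last exact: cbmeas_trig_poly.
  rewrite (_ : 4 * A / N%:R = 2 * (2 * A / N%:R)); last by ring.
  apply: normc_fc_le => [|x _]; last exact: rate.
  by apply: cbmeasB => //; exact: cbmeas_trig_poly.
apply/ler_addgt0Pr => eta eta0; rewrite add0r.
pose N := (maxn `|k| (Num.truncn (4 * A / eta))).+1.
have kN : (`|k| < N)%N by rewrite ltnS leq_maxl.
apply: le_trans (main N kN) _.
rewrite ler_pdivrMr ?ltr0n// [leRHS]mulrC -ler_pdivrMr//.
apply: (le_trans (ltW (truncnS_gt _))); rewrite ler_nat ltnS.
by rewrite leq_maxr.
Qed.

(* The phases in the lower bound are those of the resonant flow, up to the
   common factor coming from the conserved mass. *)
Theorem nls_resonant (C rho : R) : 0 <= C -> 0 < rho ->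
  exists2 mu : R, 0 < mu & forall (lam : R) (v : R -> R -> R[i]) (K T : R),
  0 < lam -> nls_solution lam v -> 0 < K -> 0 <= T ->
  (forall N, zs (fun k => normc (fc (v 0) k)) N <= K) ->
  (lam * K ^+ 2 * T <= C /\ lam * K ^+ 2 <= mu) \/ lam * K ^+ 2 * T <= mu ->
  forall eta, 0 < eta -> exists N0, forall N, (N0 <= N)%N ->
  (forall x, D x ->
    normc (v T x) <= zs (fun k => normc (fc (v 0) k)) N + rho * K + eta) /\
  normc (zs (fun k => cis (lam * normc (fc (v 0) k) ^+ 2 * T - k%:~R ^+ 2 * T)
     * fc (v 0) k) N) <= normc (v T 0) + rho * K + eta.
Proof.
move=> C0 rho0; have [mu mu0 main] := resonant_approximation C0 rho0.
exists mu => // lam v K T lam0 sol K0 T0 v0K HT eta eta0.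
pose eta' := Num.min eta (mu * K / (T + 1)).
have T10 : 0 < T + 1 by rewrite ltr_wpDl.
have eta'0 : 0 < eta' by rewrite lt_min eta0 divr_gt0// mulr_gt0.
have eta'1 : eta' <= eta by rewrite ge_min lexx.
have eta'2 : T * eta' <= mu * K.
  apply: (@le_trans _ _ ((T + 1) * (mu * K / (T + 1)))).
    by apply: ler_pM; rewrite ?lerDl// ?(ltW eta'0)// ge_min lexx orbT.
  by rewrite mulrC divfK// gt_eqF.
have [N0 hN0] := nls_fourier sol T lam0 eta'0.
exists N0 => N /hN0 [herr hrate].
pose w (k : 'I_N.*2.+1) := nls_mode v (zidx k).
have w0 k : w k 0 = fc (v 0) (zidx k) by rewrite /w /nls_mode mulr0 cis0 mul1r.
have l1w0 : l1 (w^~ 0) = zs (fun k => normc (fc (v 0) k)) N.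
  by apply: eq_bigr => k _; rewrite w0.
have W0K : l1 (w^~ 0) <= K by rewrite l1w0.
have dist := main _ (@zidx N) lam w (fun k => nls_dmode lam v (zidx k)) K eta' T
  (@zidx_inj N) lam0 (fun k => is_cderive_mode sol (zidx k)) K0 T0 W0K herr HT eta'2.
have TT : 0 <= T <= T by rewrite T0 lexx.
split.
- move=> x Dx; have r := hrate T x TT Dx.
  set z := zs _ N in r.
  rewrite -[v T x](subrK z); apply: le_trans (ler_normcD _ _) _.
  rewrite [leLHS]addrC; apply: lerD; last exact: le_trans r eta'1.
  rewrite -l1w0 -(l1_resonant_flow lam (w^~ 0) T).
  apply: le_trans (lerD (lexx _) dist).
  rewrite -big_split; apply: le_trans (ler_normc_sum _ _ _) _.
  apply: ler_sum => k _; rewrite normcM normc_cis mulr1.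
  have -> : normc (fc (v T) (k%:Z - N%:Z)) = normc (w k T).
    by rewrite /w /nls_mode [RHS]normcM normc_cis mul1r.
  rewrite -lerBlDl; exact: ler_normc_sub.
- have D0 : D 0 by rewrite /= in_itv/= lexx ltW// pi2_gt0.
  have r := hrate T 0 TT D0; set z := zs _ N in r.
  pose y := \sum_k cis (- (zidx k)%:~R ^+ 2 * T) * resonant_flow lam (w^~ 0) T k.
  have zE : z = \sum_k cis (- (zidx k)%:~R ^+ 2 * T) * w k T.
    apply: eq_bigr => k _; rewrite mulr0 cis0 mulr1 /w /nls_mode mulrA.
    by rewrite mulNr -cisD addNr cis0 mul1r.
  have zy : normc (y - z) <= rho * K.
    rewrite zE /y -sumrB; apply: le_trans (ler_normc_sum _ _ _) _.
    apply: le_trans dist; apply: ler_sum => k _.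
    by rewrite -mulrBr normcM normc_cis mul1r normc_distrC.
  have yE : normc y = normc (zs (fun k => cis (lam * normc (fc (v 0) k) ^+ 2 * T
      - k%:~R ^+ 2 * T) * fc (v 0) k) N).
    rewrite (_ : y = cis (- (2 * lam * mass (w^~ 0) * T)) * zs (fun k =>
       cis (lam * normc (fc (v 0) k) ^+ 2 * T - k%:~R ^+ 2 * T) * fc (v 0) k) N).
      by rewrite normcM normc_cis mul1r.
    rewrite /y /zs mulr_sumr; apply: eq_bigr => k _.
    rewrite /resonant_flow w0 -[k%:Z - N%:Z]/(zidx k) [LHS]mulrA [RHS]mulrA -!cisD.
    congr (cis _ * _); ring.
  have zv : normc z <= normc (v T 0) + eta.
    have := ler_normcD (v T 0) (z - v T 0); rewrite (addrC (v T 0)) subrK => h.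
    by apply: (le_trans h); rewrite lerD2l normc_distrC (le_trans r).
  have := ler_normcD (y - z) z; rewrite subrK -yE; move: zy zv; lra.
Qed.

End nls_resonant.

(** * Gaussian tails *)

Section normal_moments.
Variable R : realType.
Implicit Types (m s a : R).
Local Notation mu := (@lebesgue_measure R).

Lemma integral_normal_prob m s (f : R -> \bar R) : measurable_fun setT f ->
  (\int[normal_prob m s]_x `|f x| < +oo)%E ->
  (\int[normal_prob m s]_x f x = \int[mu]_x (f x * (normal_pdf m s x)%:E))%E.
Proof.
move=> mf fi; have dom := normal_prob_dominates m s.
have intf : (normal_prob m s).-integrable setT f by apply/integrableP.
rewrite -(Radon_Nikodym_change_of_variables dom _ intf)//=.
have mpdf : measurable_fun setT (EFin \o normal_pdf m s).
  by apply/measurable_EFinP; exact: measurable_normal_pdf.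
apply: ae_eq_integral => //.
- exact: emeasurable_funM.
- exact: emeasurable_funM.
apply: ae_eqe_mul2l => /=; rewrite Radon_NikodymE//=.
case: cid => h [h1 h2 h3] /=; apply: integral_ae_eq => //.
by move=> E _ mE; rewrite -h3.
Qed.

Lemma normal_pdf_pos m s : 0 < s ->
  normal_pdf m s = (fun x => normal_peak s * expR (- (x - m) ^+ 2 / (s ^+ 2 *+ 2))).
Proof. by move=> s0; rewrite normal_pdfE ?gt_eqF. Qed.

Lemma is_derive_normal_pdf m s (x : R) : 0 < s -> is_derive x 1 (normal_pdf m s)
  (- (x - m) / s ^+ 2 * normal_pdf m s x).
Proof.
move=> s0; rewrite normal_pdf_pos//.
have dq : is_derive x 1 (fun y : R => - (y - m) ^+ 2 / (s ^+ 2 *+ 2)) (- (x - m) / s ^+ 2).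
  have d1 : is_derive x 1 (fun y : R => y - m) 1.
    apply: is_derive_eq (is_deriveB (is_derive_id x 1) (is_derive_cst m x 1)) _.
    by rewrite subr0.
  rewrite (_ : (fun y => _) = (- (s ^+ 2 *+ 2)^-1) \*: ((fun y => y - m) * (fun y => y - m))).
    apply: is_derive_eq (is_deriveZ _ (is_deriveM d1 d1)) _.
    by rewrite /GRing.scale/=; field; rewrite gt_eqF.
  by apply/funext => y; rewrite /= /GRing.scale/= fctE; field; rewrite gt_eqF.
have de := @is_derive1_comp _ expR _ x _ _ (is_derive_expR _) dq.
rewrite (_ : (fun y => _) = normal_peak s \*: (expR \o (fun y : R => - (y - m) ^+ 2 / (s ^+ 2 *+ 2)))); last by apply/funext => y.
apply: is_derive_eq (is_deriveZ _ de) _.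
by rewrite /GRing.scale/=; ring.
Qed.

Lemma sqr_normal_pdf_le m s (x : R) : 0 < s ->
  (x - m) ^+ 2 * normal_pdf m s x <= 2 * s ^+ 2 * normal_peak s.
Proof.
move=> s0; have s20 : 0 < s ^+ 2 *+ 2 by rewrite pmulrn_lgt0// exprn_gt0.
rewrite normal_pdf_pos//.
set y := (x - m) ^+ 2 / (s ^+ 2 *+ 2).
have -> : (x - m) ^+ 2 = y * (s ^+ 2 *+ 2) by rewrite /y divfK// gt_eqF.
rewrite mulNr mulfK ?gt_eqF//.
have y0 : 0 <= y by rewrite divr_ge0 ?sqr_ge0// ltW.
have h : y * expR (- y) <= 1.
  rewrite expRN ler_pdivrMr ?expR_gt0// mul1r.
  by apply: le_trans (expR_ge1Dx y); rewrite lerDr.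
have := ler_wpM2l (mulr_ge0 (ltW s20) (normal_peak_ge0 s)) h.
by rewrite -mulr_natl; lra.
Qed.

Lemma normal_second_moment m s a : 0 < s ->
  (\int[mu]_x (((x - a) ^+ 2)%:E * (normal_pdf m s x)%:E) =
   (s ^+ 2 + (m - a) ^+ 2)%:E)%E.
Proof.
move=> s0.
pose p := normal_pdf m s.
pose f (x : R) : R := (x - a) ^+ 2 * p x.
pose c := s ^+ 2 + (m - a) ^+ 2.
pose G (x : R) : R := - s ^+ 2 * (x + m - 2 * a) * p x.
have pc : continuous p by apply: continuous_normal_pdf; rewrite gt_eqF.
have p0 x : 0 <= p x by exact: normal_pdf_ge0.
have sq (x : R) : is_derive x 1 (fun y : R => y - a) 1.
  apply: is_derive_eq (is_deriveB (is_derive_id x 1) (is_derive_cst a x 1)) _.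
  by rewrite subr0.
have fc : continuous f.
  move=> x; rewrite (_ : f = ((fun y => y - a) \* (fun y => y - a)) \* p).
    apply: continuousM; last exact: pc.
    by apply: continuousM; exact: is_derive_continuous (sq x).
  by apply/funext => y; rewrite /f /= expr2.
have Gd (x : R) : is_derive x 1 G (f x - c * p x).
  have d1 : is_derive x 1 (fun y : R => y + (m - 2 * a)) 1.
    apply: is_derive_eq (is_deriveD (is_derive_id x 1) (is_derive_cst _ x 1)) _.
    by rewrite addr0.
  rewrite (_ : G = (- s ^+ 2) \*: ((fun y => y + (m - 2 * a)) * p)).
    apply: is_derive_eq (is_deriveZ _ (is_deriveM d1 (is_derive_normal_pdf m x s0))) _.
    by rewrite /GRing.scale/= /f /c -/p; field; rewrite gt_eqF.
  by apply/funext => y; rewrite /= /GRing.scale/= fctE /G; ring.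
pose J (n : nat) : set R := `[- n.+1%:R, n.+1%:R]%classic.
have mJ n : measurable (J n) by exact: measurable_itv.
have iJ (h : R -> R) n : continuous h -> mu.-integrable (J n) (EFin \o h).
  move=> hc; apply: continuous_compact_integrable; first exact: segment_compact.
  exact: continuous_subspaceT.
have key n : (\int[mu]_(x in J n) (f x)%:E =
    c%:E * \int[mu]_(x in J n) (p x)%:E + (G n.+1%:R - G (- n.+1%:R))%:E)%E.
  have gc : continuous (fun x => f x - c * p x).
    move=> x; apply: continuousB; first exact: fc.
    by apply: continuousM; [exact: cst_continuous|exact: pc].
  have : (\int[mu]_(x in J n) (f x - c * p x)%:E = (G n.+1%:R)%:E - (G (- n.+1%:R))%:E)%E.
    apply: continuous_FTC2.
    - by rewrite -subr_gt0 opprK addr_gt0 ?ltr0n.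
    - exact: continuous_subspaceT.
    - have Gc : continuous G by move=> x; exact: is_derive_continuous (Gd x).
      split; first by move=> x _; case: (Gd x).
      + exact: cvg_at_right_filter (Gc _).
      + exact: cvg_at_left_filter (Gc _).
    - by move=> x _; rewrite derive1E; case: (Gd x).
  have mJn := mJ n; under eq_integral do rewrite EFinB (EFinM c).
  rewrite integralB//; last 2 first.
  - exact: iJ.
  - by apply: integrableZl; [exact: mJ|exact: (iJ _ _ pc)].
  rewrite integralZl//; last exact: iJ.
  move=> e; rewrite EFinB -e [RHS]addeC subeK//.
  rewrite fin_numM//; apply: integrable_fin_num; [exact: mJ|exact: (iJ _ _ pc)].
have JT : \bigcup_n J n = setT.
  apply/seteqP; split => // x _; exists (Num.truncn `|x|); first by [].
  by rewrite /J /= in_itv/= -ler_norml ltW// truncnS_gt.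
have ndJ : nondecreasing_seq J.
  move=> i j ij; apply/subsetPset => x; rewrite /J /= !in_itv/= => /andP[x1 x2].
  have : i.+1%:R <= j.+1%:R :> R by rewrite ler_nat.
  by move: x1 x2; lra.
have cvgI (h : R -> R) : continuous h -> (forall x, 0 <= h x) ->
    (\int[mu]_(x in J n) (h x)%:E @[n --> \oo] --> \int[mu]_x (h x)%:E)%E.
  move=> hc h0; rewrite -JT; apply: ge0_nondecreasing_set_cvg_integral => //.
  - by move=> n; apply/measurable_EFinP; apply: measurable_funTS; exact: continuous_measurable_fun.
  - by move=> n x _; rewrite lee_fin.
have G0 : G n.+1%:R - G (- n.+1%:R) @[n --> \oo] --> (0 : R).
  pose Kc := s ^+ 2 * (1 + 2 * `|m - a|) * (2 * s ^+ 2 * normal_peak s).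
  have Kc0 : 0 <= Kc.
    by do ?[exact: sqr_ge0|exact: normal_peak_ge0|exact: normr_ge0|exact: ler0n
      |exact: ler01|apply: addr_ge0|apply: mulr_ge0].
  have Gle (x : R) : 1 <= `|x - m| -> `|G x| <= Kc / `|x - m|.
    move=> xm; have xm0 : 0 < `|x - m| by rewrite (lt_le_trans ltr01).
    rewrite ler_pdivlMr// /G !normrM normrN (ger0_norm (p0 x)) (ger0_norm (sqr_ge0 s)).
    have h1 : `|x + m - 2 * a| <= (1 + 2 * `|m - a|) * `|x - m|.
      have -> : x + m - 2 * a = (x - m) + 2 * (m - a) by ring.
      apply: le_trans (ler_normD _ _) _; rewrite normrM (ger0_norm (ler0n R 2)) [leRHS]mulrDl mul1r.
      by rewrite lerD2l ler_peMr// mulr_ge0.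
    have h2 := sqr_normal_pdf_le m x s0.
    have h3 : s ^+ 2 * `|x + m - 2 * a| * p x * `|x - m| <=
        s ^+ 2 * ((1 + 2 * `|m - a|) * `|x - m|) * p x * `|x - m|.
      by rewrite ler_wpM2r// ler_wpM2r// ler_wpM2l// sqr_ge0.
    apply: (le_trans h3).
    have -> : s ^+ 2 * ((1 + 2 * `|m - a|) * `|x - m|) * p x * `|x - m| =
        s ^+ 2 * (1 + 2 * `|m - a|) * ((x - m) ^+ 2 * p x).
      by rewrite -(real_normK (num_real (x - m))); ring.
    rewrite ler_wpM2l//.
    by do ?[exact: sqr_ge0|exact: normal_peak_ge0|exact: normr_ge0|exact: ler0n
      |exact: ler01|apply: addr_ge0|apply: mulr_ge0].
  apply/cvgrPdist_le => e e0.
  near=> n.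
  have nB : `|m| + 1 + 2 * Kc / e <= n.+1%:R :> R.
    near: n; exists (Num.truncn (`|m| + 1 + 2 * Kc / e)) => // k /= hk.
    apply: le_trans (ltW (truncnS_gt _)) _.
    by rewrite ler_nat ltnS.
  have d0 : 0 <= 2 * Kc / e by apply: divr_ge0; [exact: mulr_ge0|exact: ltW].
  have half (x : R) : `|x| = n.+1%:R -> `|G x| <= e / 2.
    move=> xn; have h : 1 + 2 * Kc / e <= `|x - m|.
      have := lerB_normD x (- m); rewrite normrN xn; move: nB; lra.
    apply: le_trans (Gle x _) _; first by move: h d0; lra.
    have xm0 : 0 < `|x - m| by move: h d0; lra.
    rewrite ler_pdivrMr// mulrAC ler_pdivlMr//.
    have : 2 * Kc / e * e <= `|x - m| * e by rewrite ler_pM2r//; move: h; lra.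
    by rewrite divfK ?gt_eqF//; lra.
  rewrite sub0r normrN; apply: le_trans (ler_normB _ _) _.
  have h1 : `|G n.+1%:R| <= e / 2 by apply: half; rewrite ger0_norm.
  have h2 : `|G (- n.+1%:R)| <= e / 2 by apply: half; rewrite normrN ger0_norm.
  by rewrite [leRHS](splitr e) lerD.
have L1 : (\int[mu]_(x in J n) (f x)%:E @[n --> \oo] --> \int[mu]_x (f x)%:E)%E.
  by apply: cvgI => // x; rewrite mulr_ge0 ?sqr_ge0.
have L2 : (\int[mu]_(x in J n) (f x)%:E @[n --> \oo] --> c%:E)%E.
  have h1 : (c%:E * \int[mu]_(x in J n) (p x)%:E @[n --> \oo] --> c%:E * 1)%E.
    by apply: cvgeZl => //; have := cvgI p pc p0; rewrite integral_normal_pdf.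
  have h2 : ((G n.+1%:R - G (- n.+1%:R))%:E @[n --> \oo] --> 0%:E)%E.
    by apply: cvg_EFin; [exact: nearW|exact: G0].
  have h0 : (c%:E * 1 +? 0%:E)%E by rewrite mule1.
  have h3 := cvgeD h0 h1 h2; rewrite mule1 adde0 in h3.
  by under eq_fun do rewrite key; exact: (h3 _).
under eq_integral do rewrite -EFinM.
exact: cvg_unique L1 L2.
Unshelve. all: by end_near. Qed.

End normal_moments.

Section gaussian_projections.
Context (d : measure_display) (Omega : measurableType d) (R : realType).
Variable P : probability Omega R.
Implicit Types X : Omega -> R.

Lemma measurable_reC (Z : Omega -> R[i]) : complex_rv Z ->
  measurable_fun setT (reC \o Z).
Proof. by move=> mZ; apply: (measurableT_comp measurable_fst mZ). Qed.

Lemma measurable_imC (Z : Omega -> R[i]) : complex_rv Z ->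
  measurable_fun setT (imC \o Z).
Proof. by move=> mZ; apply: (measurableT_comp measurable_snd mZ). Qed.

Lemma integral_sqr_law X (nu : {measure set (measurableTypeR R) -> \bar R}) (a : R) :
  measurable_fun setT X ->
  (forall A : set R, measurable A -> P (X @^-1` A) = nu A) ->
  (\int[P]_w ((X w - a) ^+ 2)%:E = \int[nu]_x ((x - a) ^+ 2)%:E)%E.
Proof.
move=> mX law.
have mf : measurable_fun [set: measurableTypeR R] (fun x : R => ((x - a) ^+ 2)%:E).
  by apply/measurable_EFinP; apply: measurable_funX; apply: measurable_funB.
have mX' : @measurable_fun _ _ Omega (measurableTypeR R) setT X by exact: mX.
pose Y : {RV P >-> measurableTypeR R} := @mfun_Sub _ _ Omega (measurableTypeR R) X (mem_set mX').
transitivity (\int[distribution P Y]_x ((x - a) ^+ 2)%:E)%E.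
  by rewrite ge0_integral_distribution// => x; rewrite lee_fin sqr_ge0.
by apply: eq_measure_integral => A mA _; exact: law.
Qed.

Lemma gaussian_centered X (v : R) : measurable_fun setT X -> 0 < v ->
  real_gaussian P X ->
  (forall a, \int[P]_w ((X w - a) ^+ 2)%:E = (v + a ^+ 2)%:E)%E ->
  forall A, measurable A -> P (X @^-1` A) = normal_prob 0 (Num.sqrt v) A.
Proof.
move=> mX v0 [[m [s [s0 law]]]|[m law]] hX; last first.
  have h a : (m - a) ^+ 2 = v + a ^+ 2.
    pose nu : {measure set (measurableTypeR R) -> \bar R} := @dirac _ (measurableTypeR R) m R.
    have lawnu A : measurable A -> P (X @^-1` A) = nu A by exact: law.
    have := hX a; rewrite (integral_sqr_law a mX lawnu) integral_dirac//.
      by rewrite diracT mul1e => -[].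
    by apply/measurable_EFinP; apply: measurable_funX; apply: measurable_funB.
  have m0 : m = 0 by have := h 1; have := h (-1); rewrite !expr2; lra.
  by have := h 0; rewrite m0 !expr2; move: v0; lra.
pose nu : {measure set (measurableTypeR R) -> \bar R} := normal_prob m s.
have lawnu A : measurable A -> P (X @^-1` A) = nu A by exact: law.
have h a : s ^+ 2 + (m - a) ^+ 2 = v + a ^+ 2.
  have e := hX a; rewrite (integral_sqr_law a mX lawnu) in e.
  move: (e); rewrite integral_normal_prob.
  - by rewrite normal_second_moment// => -[].
  - by apply/measurable_EFinP; apply: measurable_funX; apply: measurable_funB.
  - under eq_integral do rewrite gee0_abs ?lee_fin ?sqr_ge0//.
    by rewrite e ltry.
have m0 : m = 0 by have := h 0; have := h 1; rewrite !expr2; lra.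
have vs : v = s ^+ 2 by have := h 0; rewrite m0 !expr2; lra.
by move=> A mA; rewrite law// m0 vs sqrtr_sqr gtr0_norm.
Qed.

Local Notation integ f := (P.-integrable setT (EFin \o f)).

Lemma EX_lin X Y (x y : R) : integ X -> integ Y ->
  (\int[P]_w (X w)%:E = x%:E -> \int[P]_w (Y w)%:E = y%:E ->
  forall p q : R, integ (fun w => (p * X w + q * Y w)%R) /\
  \int[P]_w (p * X w + q * Y w)%:E = (p * x + q * y)%:E)%E.
Proof.
move=> iX iY eX eY p q.
have i1 : integ (fun w => p * X w).
  rewrite (_ : EFin \o _ = (fun w => p%:E * (X w)%:E)%E); last by apply/funext.
  exact: integrableZl.
have i2 : integ (fun w => q * Y w).
  rewrite (_ : EFin \o _ = (fun w => q%:E * (Y w)%:E)%E); last by apply/funext.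
  exact: integrableZl.
split.
  rewrite (_ : EFin \o _ = ((EFin \o (fun w => (p * X w)%R)) \+
    (EFin \o (fun w => (q * Y w)%R)))%E); last by apply/funext.
  exact: integrableD.
under eq_integral do rewrite EFinD.
rewrite integralD//.
under eq_integral do rewrite EFinM; rewrite integralZl// eX.
under eq_integral do rewrite EFinM; rewrite integralZl// eY.
by rewrite EFinD !EFinM.
Qed.

Lemma gaussian_projection (eta : int -> Omega -> R[i]) k (p q : R) :
  standard_complex_gaussians P eta -> 0 < p ^+ 2 + q ^+ 2 ->
  forall A, measurable A ->
  P ((fun w => p * reC (eta k w) + q * imC (eta k w)) @^-1` A) =
  normal_prob 0 (Num.sqrt ((p ^+ 2 + q ^+ 2) / 2)) A.
Proof.
move=> [gau _ _ [E1 E2 E3]] pq0.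
pose X := reC \o eta k; pose Y := imC \o eta k.
have [mZ gZ] := gau k.
have mX : measurable_fun setT X by exact: measurable_reC.
have mY : measurable_fun setT Y by exact: measurable_imC.
have eX : (\int[P]_w (X w)%:E = 0%:E)%E.
  by have [+ _] := E1 k; rewrite unlock.
have eY : (\int[P]_w (Y w)%:E = 0%:E)%E.
  by have [_] := E1 k; rewrite unlock.
have eS : (\int[P]_w (X w ^+ 2 + Y w ^+ 2)%:E = 1%:E)%E.
  have [+ _] := E3 k k; rewrite unlock eqxx => <-.
  apply: eq_integral => w _ /=; congr EFin.
  by rewrite reCM reCconj imCconj /X /Y /= !expr2; ring.
have eD : (\int[P]_w (X w ^+ 2 - Y w ^+ 2)%:E = 0%:E)%E.
  have [+ _] := E2 k k; rewrite unlock => <-.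
  apply: eq_integral => w _ /=; congr EFin.
  by rewrite reCM /X /Y /= !expr2; ring.
have eM : (\int[P]_w (2 * (X w * Y w))%:E = 0%:E)%E.
  have [_] := E2 k k; rewrite unlock => <-.
  apply: eq_integral => w _ /=; congr EFin.
  by rewrite imCM /X /Y /=; ring.
have mS : measurable_fun setT (fun w => X w ^+ 2 + Y w ^+ 2).
  by apply: measurable_funD; apply: measurable_funX.
have iS : integ (fun w => X w ^+ 2 + Y w ^+ 2).
  apply/integrableP; split; first exact/measurable_EFinP.
  under eq_integral do rewrite /= ger0_norm ?addr_ge0 ?sqr_ge0//.
  by rewrite eS ltry.
have i1 : integ (fun=> 1 : R).
  by rewrite (_ : EFin \o _ = cst 1%E)//; exact: finite_measure_integrable_cst.
have e1 : (\int[P]_w (1 : R)%:E = 1%:E)%E.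
  by rewrite integral_cst// mul1e; exact: probability_setT.
have dom (Z : Omega -> R) : measurable_fun setT Z ->
    (forall w, `|Z w| <= 2 * 1 + 2 * (X w ^+ 2 + Y w ^+ 2)) -> integ Z.
  move=> mZ' hZ; have [iB _] := EX_lin i1 iS e1 eS 2 2.
  apply: le_integrable iB => //; first exact/measurable_EFinP.
  move=> w _ /=; rewrite lee_fin; apply: le_trans (hZ w) (ler_norm _).
have sq0 (Z : Omega -> R) w : 0 <= Z w ^+ 2 by exact: sqr_ge0.
have iX : integ X.
  apply: dom => // w; have := sq0 X w; have := sq0 Y w.
  by rewrite ler_norml !expr2 => h1 h2; apply/andP; split; nra.
have iY : integ Y.
  apply: dom => // w; have := sq0 X w; have := sq0 Y w.
  by rewrite ler_norml !expr2 => h1 h2; apply/andP; split; nra.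
have iD : integ (fun w => X w ^+ 2 - Y w ^+ 2).
  apply: dom => [|w]; first by apply: measurable_funB; apply: measurable_funX.
  have := sq0 X w; have := sq0 Y w.
  by rewrite ler_norml => h1 h2; apply/andP; split; lra.
have iM : integ (fun w => 2 * (X w * Y w)).
  apply: dom => [|w]; first by apply: measurable_funM => //; exact: measurable_funM.
  have := sq0 (X \+ Y) w; have := sq0 (X \- Y) w; have := sq0 X w; have := sq0 Y w.
  by rewrite ler_norml /= !expr2 => h1 h2 h3 h4; apply/andP; split; nra.
apply: gaussian_centered.
- by apply: measurable_funD; apply: measurable_funM.
- by rewrite divr_gt0.
- exact: gZ.
move=> a.
have [j1 f1] := EX_lin iS iD eS eD ((p ^+ 2 + q ^+ 2) / 2) ((p ^+ 2 - q ^+ 2) / 2).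
have [j2 f2] := EX_lin iM i1 eM e1 (p * q) (a ^+ 2).
have [j3 f3] := EX_lin iX iY eX eY (- 2 * a * p) (- 2 * a * q).
have [j4 f4] := EX_lin j1 j2 f1 f2 1 1.
have [_ f5] := EX_lin j4 j3 f4 f3 1 1.
transitivity (\int[P]_w (1 * (1 * ((p ^+ 2 + q ^+ 2) / 2 * (X w ^+ 2 + Y w ^+ 2) +
  (p ^+ 2 - q ^+ 2) / 2 * (X w ^+ 2 - Y w ^+ 2)) +
  1 * (p * q * (2 * (X w * Y w)) + a ^+ 2 * 1)) +
  1 * (- 2 * a * p * X w + - 2 * a * q * Y w))%R%:E)%E.
  by apply: eq_integral => w _; congr EFin; rewrite -/(X w) -/(Y w); field.
by rewrite f5; congr EFin; field.
Qed.

End gaussian_projections.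

Section outer_probability.
Context (d : measure_display) (Omega : measurableType d) (R : realType).
Variable P : probability Omega R.
Implicit Types A B : set Omega.

Definition pr A : R := fine (Prob P A).

Lemma Prob_ge0 A : (0 <= Prob P A)%E.
Proof. exact: mu_ext_ge0. Qed.

Lemma Prob_le A B : A `<=` B -> (Prob P A <= Prob P B)%E.
Proof. by move=> AB; exact: (le_mu_ext P AB). Qed.

Lemma Prob_measurable A : measurable A -> Prob P A = P A.
Proof. exact: measurable_mu_extE. Qed.

Lemma Prob_le1 A : (Prob P A <= 1)%E.
Proof.
apply: le_trans (Prob_le (@subsetT _ A)) _.
by rewrite Prob_measurable// probability_setT.
Qed.

Lemma prE A : (pr A)%:E = Prob P A.
Proof.
rewrite /pr fineK// ge0_fin_numE; last exact: Prob_ge0.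
exact: le_lt_trans (Prob_le1 A) (ltry _).
Qed.

Lemma pr_ge0 A : 0 <= pr A.
Proof. by rewrite -lee_fin prE Prob_ge0. Qed.

Lemma pr_le1 A : pr A <= 1.
Proof. by rewrite -lee_fin prE Prob_le1. Qed.

Lemma pr_le A B : A `<=` B -> pr A <= pr B.
Proof. by move=> AB; rewrite -lee_fin !prE; exact: Prob_le. Qed.

Lemma pr0 : pr set0 = 0.
Proof. by rewrite /pr /Prob mu_ext0. Qed.

Lemma pr_measurable A : measurable A -> (pr A)%:E = P A.
Proof. by move=> mA; rewrite prE Prob_measurable. Qed.

Lemma pr_bigcup (A : nat -> set Omega) (b : nat -> R) (B : R) :
  (forall n, pr (A n) <= b n) -> (forall n, \sum_(k < n) b k <= B) ->
  pr (\bigcup_n A n) <= B.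
Proof.
move=> Ab bB; rewrite -lee_fin prE.
have sub : (mu_ext P (\bigcup_n A n) <= \sum_(n <oo) mu_ext P (A n))%E.
  exact: mu_ext_sigma_subadditive.
apply: (le_trans sub).
apply: lime_le; first by apply: is_cvg_nneseries => n _ _; exact: mu_ext_ge0.
apply: nearW => n; rewrite big_mkord.
apply: (@le_trans _ _ (\sum_(k < n) b k)%:E); last by rewrite lee_fin.
rewrite -sumEFin; apply: lee_sum => k _.
by have := Ab k; rewrite -lee_fin prE.
Qed.

Lemma pr_bigU (I : finType) (A : I -> set Omega) E :
  E `<=` [set w | exists i, A i w] -> pr E <= \sum_i pr (A i).
Proof.
move=> EA.
pose F n := if insub n is Some i then A (enum_val (i : 'I_#|I|)) else set0.
apply: (@le_trans _ _ (pr (\bigcup_n F n))).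
  apply: pr_le => w /EA [i Aiw]; exists (enum_rank i) => //.
  by rewrite /F valK enum_rankK.
apply: (@pr_bigcup F (fun n => pr (F n))) => // n.
have -> : \sum_i pr (A i) = \sum_(j < #|I|) pr (F j).
  rewrite (reindex (@enum_val I I)); last first.
    by apply: onW_bij; exact: enum_val_bij.
  by apply: eq_bigr => j _; rewrite /F valK.
have e N : \sum_(j < N) pr (F j) = \sum_(0 <= j < N) pr (F j) by rewrite big_mkord.
rewrite !e; have [nI|In] := leqP n #|I|.
  rewrite (@big_cat_nat _ _ _ n 0 #|I|)//= lerDl.
  by apply: sumr_ge0 => j _; exact: pr_ge0.
rewrite (@big_cat_nat _ _ _ #|I| 0 n)//= ?(ltnW In)// gerDl.
rewrite big_nat_cond big1// => j /andP[/andP[Ij _] _].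
by rewrite /F insubF ?pr0// ltnNge Ij.
Qed.

Lemma prU A B : pr (A `|` B) <= pr A + pr B.
Proof.
have := @pr_bigU bool (fun b => if b then A else B) (A `|` B).
by rewrite big_bool; apply => w [Aw|Bw]; [exists true|exists false].
Qed.

Lemma pr_ae (Q : Omega -> Prop) : {ae P, forall w, Q w} -> pr [set w | ~ Q w] = 0.
Proof.
move=> [N [mN N0 QN]]; apply/eqP; rewrite eq_le pr_ge0 andbT.
apply: le_trans (pr_le QN) _.
by rewrite -lee_fin pr_measurable// N0.
Qed.

End outer_probability.

Section normal_tails.
Variable R : realType.
Local Notation mu := (@lebesgue_measure R).

Lemma normal_tail_ub (v r : R) : 0 < v -> 0 <= r ->
  (normal_prob 0 (Num.sqrt v) `[r, +oo[%classic <= (expR (- r ^+ 2 / (2 * v)))%:E)%E.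
Proof.
move=> v0 r0; have s0 : 0 < Num.sqrt v by rewrite sqrtr_gt0.
set s := Num.sqrt v in s0 *.
have s2 : s ^+ 2 = v by rewrite sqr_sqrtr// ltW.
have mpdf m : measurable_fun setT (fun x => (normal_pdf m s x)%:E).
  by apply/measurable_EFinP; exact: measurable_normal_pdf.
have pdf0 m (x : R) : (0 <= (normal_pdf m s x)%:E)%E by rewrite lee_fin normal_pdf_ge0.
have mI : measurable (`[r, +oo[%classic : set R) by exact: measurable_itv.
rewrite /normal_prob; apply: (@le_trans _ _
  (\int[mu]_(x in `[r, +oo[) ((expR (- r ^+ 2 / (2 * v)))%:E * (normal_pdf r s x)%:E))%E).
  apply: ge0_le_integral => //.
  - exact: (measurable_funTS (mpdf _)).
  - by apply: emeasurable_funM => //; exact: (measurable_funTS (mpdf _)).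
  - move=> x; rewrite /= in_itv/= andbT => rx.
    rewrite -EFinM lee_fin !normal_pdf_pos// mulrCA -expRD.
    rewrite ler_wpM2l ?normal_peak_ge0// ler_expR subr0 s2 mulr_natl.
    rewrite -mulrDl ler_wpM2r ?invr_ge0 ?mulrn_wge0 ?(ltW v0)//.
    have : 0 <= r * (x - r) by rewrite mulr_ge0// subr_ge0.
    by rewrite !expr2; lra.
rewrite ge0_integralZl//; last exact: (measurable_funTS (mpdf _)).
rewrite -[leRHS]mule1; apply: lee_wpmul2l; first by rewrite lee_fin expR_ge0.
rewrite -(integral_normal_pdf r s); apply: ge0_subset_integral => //.
exact: mpdf.
Qed.

Lemma normal_tail_lb (v : R) : 0 < v -> exists2 c : R, 0 < c & forall r, 0 <= r ->
  ((c * expR (- (r + 1) ^+ 2 / (2 * v)))%:E <=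
   normal_prob 0 (Num.sqrt v) `[r, +oo[%classic)%E.
Proof.
move=> v0; have s0 : 0 < Num.sqrt v by rewrite sqrtr_gt0.
set s := Num.sqrt v in s0 *.
have s2 : s ^+ 2 = v by rewrite sqr_sqrtr// ltW.
exists (normal_peak s) => [|r r0]; first by rewrite normal_peak_gt0// gt_eqF.
have mpdf m : measurable_fun setT (fun x => (normal_pdf m s x)%:E).
  by apply/measurable_EFinP; exact: measurable_normal_pdf.
have pdf0 m (x : R) : (0 <= (normal_pdf m s x)%:E)%E by rewrite lee_fin normal_pdf_ge0.
apply: (@le_trans _ _ (\int[mu]_(x in `[r, (r + 1)%R]) (normal_pdf 0 s x)%:E)%E).
  set k := _ * _.
  have -> : k%:E = (\int[mu]_(x in `[r, (r + 1)%R]) (cst k%:E x))%E.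
    rewrite integral_cst//= lebesgue_measure_itv/= lte_fin ltrDl ltr01.
    by rewrite -EFinB addrAC subrr add0r mule1.
  have k0 : 0 <= k by rewrite mulr_ge0 ?normal_peak_ge0 ?expR_ge0.
  apply: ge0_le_integral => //.
  - exact: (measurable_funTS (mpdf _)).
  - move=> x; rewrite /= in_itv/= => /andP[rx xr].
    rewrite lee_fin normal_pdf_pos// ler_wpM2l ?normal_peak_ge0// ler_expR subr0.
    rewrite s2 mulr_natl ler_wpM2r ?invr_ge0 ?mulrn_wge0 ?(ltW v0)//.
    by rewrite lerN2 lerXn2r ?nnegrE//; lra.
apply: ge0_subset_integral => //.
- exact: (measurable_funTS (mpdf _)).
- by move=> x; rewrite /= !in_itv/= andbT => /andP[].
Qed.

End normal_tails.

Section gaussian_tails.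
Context (d : measure_display) (Omega : measurableType d) (R : realType).
Variable P : probability Omega R.
Variable eta : int -> Omega -> R[i].
Hypothesis Heta : standard_complex_gaussians P eta.

Local Notation pr := (pr P).

Lemma measurable_reC_eta k : measurable_fun setT (reC \o eta k).
Proof. by case: Heta => /(_ k)[m _] _ _ _; exact: measurable_reC. Qed.

Lemma measurable_imC_eta k : measurable_fun setT (imC \o eta k).
Proof. by case: Heta => /(_ k)[m _] _ _ _; exact: measurable_imC. Qed.

Lemma pr_halfplane k (p q r : R) : 0 < p ^+ 2 + q ^+ 2 ->
  (pr [set w | r <= p * reC (eta k w) + q * imC (eta k w)])%:E =
  normal_prob 0 (Num.sqrt ((p ^+ 2 + q ^+ 2) / 2)) `[r, +oo[%classic.
Proof.
move=> pq; rewrite -(gaussian_projection k Heta pq); last exact: measurable_itv.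
pose X w := p * reC (eta k w) + q * imC (eta k w); rewrite -/X.
have -> : [set w | r <= p * reC (eta k w) + q * imC (eta k w)] = X @^-1` `[r, +oo[.
  by apply/seteqP; split => w; rewrite /X /preimage /= in_itv/= andbT.
rewrite pr_measurable// -[X in measurable X]setTI.
have mX : measurable_fun setT X.
  apply: measurable_funD; apply: measurable_funM => //.
    exact: measurable_reC_eta.
  exact: measurable_imC_eta.
by apply: mX => //; exact: measurable_itv.
Qed.

Lemma halfplane_ub k (p q r : R) : 0 < p ^+ 2 + q ^+ 2 -> 0 <= r ->
  pr [set w | r <= p * reC (eta k w) + q * imC (eta k w)] <=
  expR (- r ^+ 2 / (p ^+ 2 + q ^+ 2)).
Proof.
move=> pq r0; rewrite -lee_fin pr_halfplane//.
have v0 : 0 < (p ^+ 2 + q ^+ 2) / 2 by rewrite divr_gt0.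
apply: le_trans (normal_tail_ub v0 r0) _.
by rewrite (mulrC 2) divfK.
Qed.

Lemma halfplane_lb : exists2 c : R, 0 < c & forall k (p q r : R),
  p ^+ 2 + q ^+ 2 = 1 -> 0 <= r ->
  c * expR (- (r + 1) ^+ 2) <= pr [set w | r <= p * reC (eta k w) + q * imC (eta k w)].
Proof.
have v0 : 0 < 1 / 2 :> R by rewrite divr_gt0.
have [c c0 hc] := normal_tail_lb v0; exists c => // k p q r pq r0.
rewrite -lee_fin pr_halfplane ?pq//; apply: le_trans (hc r r0).
by rewrite (mulrC 2) divfK// divr1.
Qed.

Lemma halfplane_cover (J : nat) (z : R[i]) : (0 < J)%N -> 0 < normc z ->
  exists i : 'I_J.+1 * bool * ('I_J.+1 * bool),
  let p := (-1) ^+ i.1.2 * (i.1.1%:R / J%:R) in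
  let q := (-1) ^+ i.2.2 * (i.2.1%:R / J%:R) in
  p ^+ 2 + q ^+ 2 <= 1 /\
  normc z * (1 - 2 / J%:R) <= p * reC z + q * imC z.
Proof.
move=> J0; set n := normc z => n0.
have j0 : 0 < J%:R :> R by rewrite ltr0n.
have one (x : R) : `|x| <= n -> exists i : 'I_J.+1 * bool,
    let p := (-1) ^+ i.2 * (i.1%:R / J%:R) in
    p ^+ 2 <= (x / n) ^+ 2 /\ x ^+ 2 / n - n / J%:R <= p * x.
  move=> xn; pose a := J%:R * (`|x| / n).
  have xn1 : `|x| / n <= 1 by rewrite ler_pdivrMr// mul1r.
  have xn0 : 0 <= `|x| / n by rewrite divr_ge0// ltW.
  have a0 : 0 <= a by rewrite mulr_ge0.
  have ta : (Num.truncn a)%:R <= a by rewrite truncn_le.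
  have aJ : (Num.truncn a < J.+1)%N.
    by rewrite ltnS -(ler_nat R) (le_trans ta)// /a ler_piMr// ltW.
  exists (Ordinal aJ, x < 0) => /=.
  set t := (Num.truncn a)%:R in ta *.
  have t0 : 0 <= t by rewrite /t ler0n.
  have tJ : t / J%:R <= `|x| / n by rewrite ler_pdivrMr// mulrC.
  split.
    rewrite exprMn sqrr_sign mul1r -[leRHS]real_normK ?num_real// normrM.
    rewrite normfV (gtr0_norm n0) lerXn2r ?nnegrE//.
    by rewrite divr_ge0.
  have -> : (-1) ^+ (x < 0)%R * (t / J%:R) * x = t / J%:R * `|x|.
    by rewrite normrEsign [RHS]mulrA; congr (_ * _); rewrite mulrC.
  have ta1 : a - 1 <= t.
    by rewrite lerBlDr /t natr1 ltW// truncnS_gt.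
  apply: (@le_trans _ _ ((a - 1) / J%:R * `|x|)); last first.
    by rewrite ler_wpM2r// ler_wpM2r// invr_ge0 ltW.
  have -> : (a - 1) / J%:R * `|x| = `|x| ^+ 2 / n - `|x| / J%:R.
    by rewrite /a; field; rewrite !gt_eqF.
  rewrite real_normK ?num_real// lerD2l lerN2 ler_wpM2r// invr_ge0 ltW//.
have [i [hi1 hi2]] := one (reC z) (normr_reC_le z).
have [j [hj1 hj2]] := one (imC z) (normr_imC_le z).
exists (i, j) => /=; split.
  apply: le_trans (lerD hi1 hj1) _.
  by rewrite !expr_div_n -mulrDl -sqr_normcE -/n divff// gt_eqF// exprn_gt0.
apply: le_trans (lerD hi2 hj2).
have -> : n * (1 - 2 / J%:R) = n ^+ 2 / n - n / J%:R - n / J%:R.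
  by field; rewrite !gt_eqF.
rewrite [X in X / n](_ : n ^+ 2 = reC z ^+ 2 + imC z ^+ 2); last exact: sqr_normcE.
by rewrite mulrDl; lra.
Qed.

Lemma norm_ub (th : R) : 0 < th -> th < 1 -> exists2 C : R, 1 <= C &
  forall k (r : R), 0 <= r -> pr [set w | r <= normc (eta k w)] <= C * expR (- (th * r ^+ 2)).
Proof.
move=> th0 th1.
pose J := (Num.truncn (4 / (1 - th))).+3.
have j0 : 0 < J%:R :> R by rewrite ltr0n.
have hJ : 4 / J%:R <= 1 - th.
  rewrite ler_pdivrMr// mulrC -ler_pdivrMr ?subr_gt0//.
  apply: (le_trans (ltW (truncnS_gt _))); by rewrite ler_nat; exact: (leq_addl 2).
have hJ2 : 0 < 1 - 2 / J%:R :> R.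
  by rewrite subr_gt0 ltr_pdivrMr// mul1r ltr_nat.
have hth : th <= (1 - 2 / J%:R) ^+ 2.
  have := sqr_ge0 (2 / J%:R : R); rewrite sqrrB !mul1r expr1n; lra.
pose I := ('I_J.+1 * bool * ('I_J.+1 * bool))%type.
pose C : R := #|{: I}|%:R.
have C1 : 1 <= C.
  rewrite ler1n; apply/card_gt0P.
  by exists ((ord0, true), (ord0, true)).
exists C => // k r; rewrite le_eqVlt => /predU1P[<-|r0].
  rewrite expr0n/= mulr0 oppr0 expR0 mulr1.
  exact: le_trans (pr_le1 P _) C1.
pose A (i : I) : set Omega :=
  let p := (-1) ^+ i.1.2 * (i.1.1%:R / J%:R) in
  let q := (-1) ^+ i.2.2 * (i.2.1%:R / J%:R) in
  if 0 < p ^+ 2 + q ^+ 2 <= 1 then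
    [set w | r * (1 - 2 / J%:R) <= p * reC (eta k w) + q * imC (eta k w)]
  else set0.
apply: (@le_trans _ _ (\sum_(i : I) pr (A i))).
  apply: pr_bigU => w /= rn.
  have n0 : 0 < normc (eta k w) := lt_le_trans r0 rn.
  have [i [h1 h2]] := @halfplane_cover J (eta k w) (ltn0Sn _) n0.
  exists i; rewrite /A; move: h1 h2.
  set p := (-1) ^+ _ * _; set q := (-1) ^+ _ * _ => h1 h2.
  have rp : r * (1 - 2 / J%:R) <= p * reC (eta k w) + q * imC (eta k w).
    by apply: le_trans h2; rewrite ler_wpM2r// ltW.
  rewrite h1 andbT ifT//.
  rewrite lt_neqAle addr_ge0 ?sqr_ge0// andbT eq_sym.
  apply/negP; rewrite paddr_eq0 ?sqr_ge0// !sqrf_eq0 => /andP[/eqP p0 /eqP q0].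
  move: rp; rewrite p0 q0 !mul0r addr0 leNgt.
  by rewrite mulr_gt0.
rewrite /C mulr_natl -sumr_const; apply: ler_sum => i _.
rewrite /A /=; set p := (-1) ^+ _ * _; set q := (-1) ^+ _ * _.
case: ifPn => [/andP[pq0 pq1]|_]; last by rewrite pr0 expR_ge0.
have r'0 : 0 <= r * (1 - 2 / J%:R) by rewrite mulr_ge0// ltW.
apply: le_trans (halfplane_ub k pq0 r'0) _.
rewrite ler_expR mulNr lerN2 exprMn.
apply: (@le_trans _ _ (r ^+ 2 * (1 - 2 / J%:R) ^+ 2)).
  by rewrite mulrC ler_wpM2l// sqr_ge0.
by rewrite ler_pdivlMr// ler_piMr//; apply: mulr_ge0; exact: sqr_ge0.
Qed.

End gaussian_tails.

Section gaussian_families.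
Context (d : measure_display) (Omega : measurableType d) (R : realType).
Variable P : probability Omega R.
Variable eta : int -> Omega -> R[i].
Hypothesis Heta : standard_complex_gaussians P eta.

Local Notation pr := (pr P).

Lemma pr_independent (I : finType) (idx : I -> int) (A : I -> set (R * R)) :
  injective idx -> (forall i, measurable (A i)) ->
  pr [set w | forall i, A i (pairC (eta (idx i) w))] =
  \prod_i pr [set w | A i (pairC (eta (idx i) w))].
Proof.
move=> idxI mA.
have meta k B : measurable B -> measurable ((@pairC R \o eta k) @^-1` B).
  move=> mB; rewrite -[X in measurable X]setTI.
  by case: Heta => /(_ k)[m _] _ _ _; exact: m.
pose B k := if [pick i | idx i == k] is Some i then A i else setT.
have BE i : B (idx i) = A i.
  rewrite /B; case: pickP => [j /eqP/idxI ->//|/(_ i)].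
  by rewrite eqxx.
have mB k : measurable (B k) by rewrite /B; case: pickP.
pose s := [seq idx i | i <- enum I].
have us : uniq s by rewrite map_inj_uniq// enum_uniq.
have E : [set w | forall i, A i (pairC (eta (idx i) w))] =
    \bigcap_(k in [set` s]) ((@pairC R \o eta k) @^-1` B k).
  apply/seteqP; split => w /=.
    by move=> Aw k /mapP[i _ ->]; rewrite /preimage /= BE; exact: Aw.
  move=> Bw i; rewrite -BE; apply: (Bw (idx i)).
  by apply: map_f; rewrite mem_enum.
case: Heta => _ ind _ _.
apply: EFin_inj; rewrite E pr_measurable; last first.
  by apply: fin_bigcap_measurable => // k _; exact: meta.
rewrite ind// big_map big_enum/= -prodEFin; apply: eq_bigr => i _.
by rewrite BE pr_measurable//; exact: (meta _ _ (mA i)).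
Qed.

Lemma measurable_sqdist (x y r : R) :
  measurable [set p : R * R | (p.1 - x) ^+ 2 + (p.2 - y) ^+ 2 <= r].
Proof.
have m : measurable_fun setT (fun p : R * R => (p.1 - x) ^+ 2 + (p.2 - y) ^+ 2).
  apply: measurable_funD; apply: measurable_funX; apply: measurable_funB => //.
rewrite (_ : [set p : R * R | _] = (fun p => (p.1 - x) ^+ 2 + (p.2 - y) ^+ 2) @^-1` `]-oo, r]%classic).
  by rewrite -[X in measurable X]setTI; apply: m => //; exact: measurable_itv.
by apply/seteqP; split => p; rewrite /preimage /= in_itv.
Qed.

Lemma measurable_sqnorm (r : R) : measurable [set p : R * R | r <= p.1 ^+ 2 + p.2 ^+ 2].
Proof.
have m : measurable_fun setT (fun p : R * R => p.1 ^+ 2 + p.2 ^+ 2).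
  by apply: measurable_funD; apply: measurable_funX.
rewrite (_ : [set p : R * R | _] = (fun p => p.1 ^+ 2 + p.2 ^+ 2) @^-1` `[r, +oo[%classic).
  by rewrite -[X in measurable X]setTI; apply: m => //; exact: measurable_itv.
by apply/seteqP; split => p; rewrite /preimage /= in_itv/= andbT.
Qed.

Lemma ball_lb (y rho kappa : R) : 0 <= y -> 0 < rho -> 0 < kappa ->
  exists2 eps0, 0 < eps0 & forall eps, 0 < eps -> eps < eps0 ->
  forall k (p q : R), p ^+ 2 + q ^+ 2 = 1 ->
  expR (- ((y ^+ 2 + kappa) / eps)) <=
  pr [set w | (reC (eta k w) - y * p / Num.sqrt eps) ^+ 2 +
              (imC (eta k w) - y * q / Num.sqrt eps) ^+ 2 <= rho ^+ 2 / eps].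
Proof.
move=> y0 rho0 kappa0.
have rho2 : 0 < rho ^+ 2 by rewrite exprn_gt0.
have y2 : 0 <= y ^+ 2 by rewrite sqr_ge0.
have s0 : 0 < y ^+ 2 + rho ^+ 2 by lra.
pose th := 1 - rho ^+ 2 / (2 * (y ^+ 2 + rho ^+ 2)).
have t20 : 0 < 2 * (y ^+ 2 + rho ^+ 2) by rewrite mulr_gt0.
have th0 : 0 < th by rewrite subr_gt0 ltr_pdivrMr//; lra.
have th1 : th < 1 by rewrite gtrBl divr_gt0.
have thE : th * (y ^+ 2 + rho ^+ 2) = y ^+ 2 + rho ^+ 2 / 2.
  by rewrite /th; field; rewrite gt_eqF.
have [C C1 hC] := norm_ub Heta th0 th1.
have [c c0 hc] := halfplane_lb Heta.
pose m := Num.min kappa (rho ^+ 2 / 2).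
have m0 : 0 < m by rewrite lt_min kappa0 divr_gt0.
have mk : m <= kappa by rewrite ge_min lexx.
have mr : m <= rho ^+ 2 / 2 by rewrite ge_min lexx orbT.
pose D := Num.min 1 (m / 2 / (2 * y + 1)).
have y1 : 0 < 2 * y + 1 by lra.
have D0 : 0 < D by rewrite lt_min ltr01 !divr_gt0.
have D1 : D <= 1 by rewrite ge_min lexx.
have Dm : D * (2 * y + 1) <= m / 2 by rewrite -ler_pdivlMr// ge_min lexx orbT.
have C0 : 0 < C + 1 by lra.
exists (Num.min (D ^+ 2) (c * m / (2 * (C + 1)))).
  by rewrite lt_min exprn_gt0//= divr_gt0// ?mulr_gt0.
move=> eps e0; rewrite lt_min => /andP[eD ec] k p q pq.
set s := Num.sqrt eps; have sp : 0 < s by rewrite sqrtr_gt0.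
have s2 : s ^+ 2 = eps by rewrite sqr_sqrtr// ltW.
have sD : s <= D by rewrite -[D]gtr0_norm// -sqrtr_sqr ler_sqrt ?sqr_ge0// ltW.
set Ball := [set w | _].
pose Big := [set w | Num.sqrt ((y ^+ 2 + rho ^+ 2) / eps) <= normc (eta k w)].
have sub : [set w | y / s <= p * reC (eta k w) + q * imC (eta k w)] `<=` Ball `|` Big.
  move=> w /= hw.
  case: (lerP ((reC (eta k w) - y * p / s) ^+ 2 + (imC (eta k w) - y * q / s) ^+ 2)
    (rho ^+ 2 / eps)) => [|h]; [by left|right].
  rewrite /Big /=.
  rewrite -(ler_pXn2r (n := 2))// ?nnegrE ?sqrtr_ge0 ?normc_ge0//.
  rewrite sqr_sqrtr; last by rewrite divr_ge0// ltW.
  rewrite sqr_normcE; move: h hw.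
  set u := reC _; set v := imC _ => h hw.
  have e1 : (u - y * p / s) ^+ 2 + (v - y * q / s) ^+ 2 =
     u ^+ 2 + v ^+ 2 - 2 * (y / s) * (p * u + q * v) + y ^+ 2 / eps.
    have -> : y ^+ 2 / eps = (p ^+ 2 + q ^+ 2) * (y ^+ 2 / s ^+ 2) by rewrite pq mul1r s2.
    by field; rewrite gt_eqF.
  have ys0 : 0 <= y / s by rewrite divr_ge0// ltW.
  have := ler_wpM2l ys0 hw.
  have -> : y / s * (y / s) = y ^+ 2 / eps by rewrite -s2; field; rewrite gt_eqF.
  rewrite mulrDl; move: h; rewrite e1 -mulrA; lra.
have h1 : c * expR (- (y / s + 1) ^+ 2) <= pr Ball + pr Big.
  have ys0 : 0 <= y / s by rewrite divr_ge0// ltW.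
  apply: (le_trans (hc k p q (y / s) pq ys0)).
  exact: le_trans (pr_le _ sub) (prU _ _ _).
pose X := expR (- ((y ^+ 2 + m) / eps)).
have h2 : pr Big <= C * X.
  apply: (le_trans (hC k _ (sqrtr_ge0 _))).
  rewrite ler_pM2l; last lra.
  rewrite sqr_sqrtr; last by rewrite divr_ge0// ltW.
  rewrite ler_expR lerN2 mulrA thE ler_pM2r ?invr_gt0//; lra.
have h3 : c * (X * expR (m / 2 / eps)) <= c * expR (- (y / s + 1) ^+ 2).
  rewrite ler_pM2l// -expRD ler_expR.
  have -> : - ((y ^+ 2 + m) / eps) + m / 2 / eps = - ((y ^+ 2 + m / 2) / eps).
    by field; rewrite gt_eqF.
  rewrite lerN2.
  have -> : (y / s + 1) ^+ 2 = (y + s) ^+ 2 / eps.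
    by rewrite -s2; field; rewrite gt_eqF.
  rewrite ler_pM2r ?invr_gt0// sqrrD -addrA lerD2l.
  apply: le_trans Dm.
  have -> : y * s *+ 2 + s ^+ 2 = s * (2 * y + s) by ring.
  by apply: ler_pM => //; lra.
have h4 : C + 1 <= c * expR (m / 2 / eps).
  apply: (@le_trans _ _ (c * (m / 2 / eps))).
    move: ec; rewrite ltr_pdivlMr ?mulr_gt0// => ec.
    have -> : c * (m / 2 / eps) = (c * m / 2) / eps by ring.
    by rewrite ler_pdivlMr// mulrC; lra.
  rewrite ler_pM2l//; apply: le_trans (expR_ge1Dx _); lra.
have X0 : 0 < X by rewrite expR_gt0.
have h5 : (C + 1) * X <= c * (X * expR (m / 2 / eps)).
  by rewrite mulrCA mulrC ler_pM2l.
apply: (@le_trans _ _ X); last lra.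
by rewrite ler_expR lerN2 ler_pM2r ?invr_gt0//; lra.
Qed.

Lemma geometric_sum_le (q : R) n : 0 <= q -> q < 1 -> \sum_(k < n) q ^+ k <= (1 - q)^-1.
Proof.
move=> q0 q1; have p : 0 < 1 - q by rewrite subr_gt0.
rewrite -[leRHS]mul1r ler_pdivlMr//.
have -> : (\sum_(k < n) q ^+ k) * (1 - q) = 1 - q ^+ n.
  elim: n => [|n IH]; first by rewrite big_ord0 mul0r expr0 subrr.
  by rewrite big_ord_recr/= mulrDl IH exprSr; ring.
by rewrite gerBl exprn_ge0.
Qed.

Lemma large_modes_ub : exists2 C : R, 0 < C & forall N (eps : R), 0 < eps -> eps <= 1 ->
  pr [set w | exists k : int, (N < absz k)%N /\
     (absz k)%:R / Num.sqrt eps < normc (eta k w)] <= C * expR (- (N%:R / (2 * eps))).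
Proof.
have h0 : 0 < 2^-1 :> R by rewrite invr_gt0.
have h1 : 2^-1 < 1 :> R by rewrite invf_lt1// ltr1n.
have [C C1 hC] := norm_ub Heta h0 h1.
pose q : R := expR (- 2^-1).
have q0 : 0 <= q by rewrite expR_ge0.
have q1 : q < 1 by rewrite expR_lt1 oppr_lt0.
have C0 : 0 < C by lra.
exists (2 * C * (1 - q)^-1); first by rewrite !mulr_gt0// invr_gt0 subr_gt0.
move=> N eps e0 e1; set s := Num.sqrt eps.
have s0 : 0 < s by rewrite sqrtr_gt0.
have s2 : s ^+ 2 = eps by rewrite sqr_sqrtr// ltW.
set X := expR _; have X0 : 0 <= X by rewrite expR_ge0.
pose A n := [set w | (N + n.+1)%:R / s <= normc (eta (N + n.+1)%N%:Z w)] `|`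
  [set w | (N + n.+1)%:R / s <= normc (eta (- (N + n.+1)%N%:Z) w)].
apply: (@le_trans _ _ (pr (\bigcup_n A n))).
  apply: pr_le => w [k [Nk /ltW hk]]; exists (absz k - N.+1)%N => //.
  have e : (N + (absz k - N.+1).+1)%N = absz k by rewrite addnS -addSn subnKC.
  rewrite /A e; case: k {Nk e} hk => n /= hk; [left|right] => //=.
apply: (@pr_bigcup _ _ _ _ _ (fun n => 2 * C * X * q ^+ n)) => [n|n].
  apply: (le_trans (prU _ _ _)).
  have one k : pr [set w | (N + n.+1)%:R / s <= normc (eta k w)] <= C * X * q ^+ n.
    have r0 : 0 <= (N + n.+1)%:R / s by rewrite divr_ge0// ltW.
    apply: (le_trans (hC k _ r0)); rewrite -mulrA ler_pM2l//.
    rewrite -expRM_natl -expRD ler_expR.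
    rewrite expr_div_n s2 mulrN -opprD lerN2 -natrX.
    apply: (@le_trans _ _ ((N + n)%:R / (2 * eps))).
      rewrite [(N + n)%:R]natrD [leRHS]mulrDl lerD2l ler_wpM2l// lef_pV2 ?posrE// ?mulr_gt0//; lra.
    rewrite invfM mulrCA ler_pM2l// ler_pM2r ?invr_gt0// ler_nat.
    by rewrite expnS expn1; apply: (@leq_trans (N + n.+1)); rewrite ?leq_add2l// leq_pmulr// addnS.
  have -> : 2 * C * X * q ^+ n = C * X * q ^+ n + C * X * q ^+ n by ring.
  by apply: lerD; exact: one.
rewrite -mulr_sumr [leRHS]mulrAC ler_wpM2l ?geometric_sum_le//.
by rewrite !mulr_ge0// ltW.
Qed.

Lemma energy_ub N (r kappa : R) : 0 < kappa -> kappa < r ->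
  exists2 C : R, 0 < C & forall eps, 0 < eps ->
  pr [set w | r <= \sum_(j < N.*2.+1) eps * normc (eta (zidx j) w) ^+ 2] <=
  C * expR (- ((r - kappa) / eps)).
Proof.
set n := N.*2.+1 => kappa0 kr.
have r0 : 0 < r by lra.
pose th := 1 - kappa / (2 * r).
have r20 : 0 < 2 * r by lra.
have th0 : 0 < th by rewrite subr_gt0 ltr_pdivrMr//; lra.
have th1 : th < 1 by rewrite gtrBl divr_gt0.
have hth : r - kappa <= th * (r - kappa / 2).
  have -> : th * (r - kappa / 2) = r - kappa + kappa ^+ 2 / (4 * r).
    by rewrite /th; field; rewrite gt_eqF.
  by rewrite lerDl divr_ge0 ?sqr_ge0//; lra.
have [C C1 hC] := norm_ub Heta th0 th1.
pose h := kappa / (2 * n%:R).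
have n0 : 0 < n%:R :> R by rewrite ltr0n.
have h0 : 0 < h by rewrite divr_gt0// mulr_gt0.
pose J := (Num.truncn (r / h)).+1.
have Jh : r <= J%:R * h by rewrite -ler_pdivrMr// ltW// truncnS_gt.
pose I := {ffun 'I_n -> 'I_J.+1}.
exists (#|{: I}|%:R * C ^+ n).
  rewrite mulr_gt0//; last by rewrite exprn_gt0//; lra.
  by rewrite ltr0n; apply/card_gt0P; exists [ffun=> ord0].
move=> eps e0.
pose A (f : I) : set Omega :=
  if r - kappa / 2 <= \sum_j (f j)%:R * h then
    [set w | forall j, [set p : R * R | (f j)%:R * h / eps <= p.1 ^+ 2 + p.2 ^+ 2]
      (pairC (eta (zidx j) w))]
  else set0.
apply: (@le_trans _ _ (\sum_f pr (A f))).
  apply: pr_bigU => w /= hr.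
  pose x j := eps * normc (eta (@zidx N j) w) ^+ 2.
  have x0 j : 0 <= x j by rewrite mulr_ge0 ?sqr_ge0// ltW.
  pose f : I := [ffun j => inord (minn (Num.truncn (x j / h)) J)].
  have fE j : f j = minn (Num.truncn (x j / h)) J :> nat.
    by rewrite ffunE inordK// ltnS geq_minr.
  have xh j : 0 <= x j / h by rewrite divr_ge0// ltW.
  have fx j : (f j)%:R * h <= x j.
    rewrite -ler_pdivlMr//; apply: (@le_trans _ _ (Num.truncn (x j / h))%:R).
      by rewrite fE ler_nat geq_minl.
    by rewrite truncn_le.
  exists f; rewrite /A ifT.
    move=> j /=; rewrite -sqr_normcE ler_pdivrMr// mulrC.
    by rewrite mulrC [leRHS]mulrC; exact: fx.
  have fh0 j : 0 <= (f j)%:R * h by rewrite mulr_ge0// ltW.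
  have [/existsP[j /eqP fj]|/existsPn fJ] := boolP [exists j, f j == J :> nat].
    rewrite (bigD1 j)//= fj.
    have : 0 <= \sum_(i < n | i != j) (f i)%:R * h by apply: sumr_ge0.
    lra.
  apply: (@le_trans _ _ (\sum_j (x j - h))); last first.
    apply: ler_sum => j _; rewrite lerBlDr -[X in _ + X]mul1r -mulrDl natr1.
    rewrite -ler_pdivrMr//.
    move: (fJ j); rewrite fE /minn; case: ltnP => [_ _|]; last by rewrite eqxx.
    by rewrite ltW// truncnS_gt.
  rewrite sumrB sumr_const card_ord.
  have -> : h *+ n = kappa / 2 by rewrite -mulr_natr /h; field; rewrite gt_eqF.
  by rewrite lerD2r.
rewrite -mulrA mulr_natl -sumr_const; apply: ler_sum => f _.
rewrite /A; case: ifPn => [hf|_]; last by rewrite pr0 mulr_ge0 ?expR_ge0// exprn_ge0//; lra.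
rewrite (@pr_independent 'I_n (@zidx N)
  (fun j => [set p : R * R | (f j)%:R * h / eps <= p.1 ^+ 2 + p.2 ^+ 2])) => [|i j /zidx_inj//|j]; last exact: measurable_sqnorm.
apply: (@le_trans _ _ (\prod_(j < n) (C * expR (- (th * ((f j)%:R * h / eps)))))).
  apply: ler_prod => j _; rewrite pr_ge0 /=.
  have e : 0 <= (f j)%:R * h / eps by rewrite divr_ge0 ?mulr_ge0// ltW.
  apply: le_trans (le_trans (hC (zidx j) _ (sqrtr_ge0 ((f j)%:R * h / eps))) _).
    apply: pr_le => w /=; rewrite -sqr_normcE => hw.
    by rewrite -(ler_pXn2r (n := 2))// ?nnegrE ?sqrtr_ge0 ?normc_ge0// sqr_sqrtr.
  by rewrite sqr_sqrtr.
rewrite big_split/= prodr_const card_ord -expR_sum ler_pM2l ?exprn_gt0//; last lra.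
rewrite ler_expR sumrN lerN2 -mulr_sumr -mulr_suml mulrA ler_pM2r ?invr_gt0//.
by apply: (le_trans hth); rewrite ler_pM2l.
Qed.

End gaussian_families.

(** * Large deviations *)

Section symmetric_real_sums.
Variable R : realType.
Implicit Types F G : int -> R.

Lemma zs_ge0 F N : (forall k, 0 <= F k) -> 0 <= zs F N.
Proof. by move=> F0; apply: sumr_ge0. Qed.

Lemma zs_le F G N : (forall k, F k <= G k) -> zs F N <= zs G N.
Proof. by move=> FG; apply: ler_sum. Qed.

Lemma zs_homo F N M : (forall k, 0 <= F k) -> (N <= M)%N -> zs F N <= zs F M.
Proof.
move=> F0 /subnKC <-; elim: (M - N)%N => [|m IH]; first by rewrite addn0.
by apply: (le_trans IH); rewrite addnS zsS lerDl addr_ge0.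
Qed.

Lemma zs_realC F N : zs (fun k => (F k)%:C) N = (zs F N)%:C.
Proof. by rewrite /zs realC_sum. Qed.

Lemma zs_cut (V : zmodType) (H : int -> V) N M : (N <= M)%N ->
  zs H M - zs H N = zs (fun k => if (absz k <= N)%N then 0 else H k) M.
Proof.
move=> /subnKC <-; elim: (M - N)%N => [|m IH].
  rewrite addn0 subrr; apply/esym/big1 => j _.
  by rewrite ifT//; have := ltn_ord j; lia.
rewrite addnS !zsS -IH addrAC; congr (_ + _).
by congr (_ + _); rewrite ifF//; lia.
Qed.

Lemma zs_complex_tail (H : int -> R[i]) (A : R) N M : 0 <= A ->
  (forall k, (N < absz k)%N -> normc (H k) <= A / k%:~R ^+ 2) ->
  (0 < N)%N -> (N <= M)%N -> normc (zs H M - zs H N) <= 2 * A / N%:R.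
Proof.
move=> A0 hH N0 NM; pose G k := if (absz k <= N)%N then 0 else H k.
have hG k : k != 0 -> normc (G k) <= A / k%:~R ^+ 2.
  move=> _; rewrite /G; case: leqP => [_|/hH//].
  by rewrite ComplexField.Normc.normc0 divr_ge0// sqr_ge0.
have G0 : zs G N = 0 by rewrite -(zs_cut H (leqnn N)) subrr.
have := zs_geo_tail A0 hG N0 NM; rewrite G0 subr0 -zs_cut// => h.
by apply: (le_trans h); rewrite ler_wpM2l ?mulr_ge0// gerBl invr_ge0.
Qed.

Lemma zs_tail F (A : R) N M : 0 <= A ->
  (forall k, (N < absz k)%N -> `|F k| <= A / k%:~R ^+ 2) ->
  (0 < N)%N -> (N <= M)%N -> zs F M - zs F N <= 2 * A / N%:R.
Proof.
move=> A0 hF N0 NM.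
have H k : (N < absz k)%N -> normc (F k)%:C <= A / k%:~R ^+ 2.
  by move=> Nk; rewrite normc_real hF.
have := zs_complex_tail A0 H N0 NM.
by rewrite !zs_realC -raddfB normc_real; apply: le_trans; exact: ler_norm.
Qed.

Lemma sum_subset_zs F (s : seq int) N : (forall k, 0 <= F k) -> uniq s ->
  (forall k, k \in s -> (absz k <= N)%N) -> \sum_(k <- s) F k <= zs F N.
Proof.
move=> F0 us sN.
pose L := [seq @zidx N j | j <- enum 'I_N.*2.+1].
have uL : uniq L by rewrite map_inj_uniq ?enum_uniq//; exact: zidx_inj.
have -> : zs F N = \sum_(k <- L) F k by rewrite big_map big_enum.
have sL k : k \in s -> k \in L.
  move=> /sN kN; have kb : (absz (k + N%:Z)%R < N.*2.+1)%N by lia.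
  apply/mapP; exists (Ordinal kb); first by rewrite mem_enum.
  by rewrite /zidx /=; lia.
have pe : perm_eq s [seq k <- L | k \in s].
  apply: uniq_perm => //; first exact: filter_uniq.
  by move=> k; rewrite mem_filter; case: (boolP (k \in s)) => //= /sL ->.
rewrite (perm_big _ pe)/= big_filter big_mkcond/=.
by apply: ler_sum => k _; case: ifP.
Qed.

Lemma zs_esum F N : (forall k, 0 <= F k) ->
  ((zs F N)%:E <= \esum_(k in [set: int]) (F k)%:E)%E.
Proof.
move=> F0; pose L := [seq @zidx N j | j <- enum 'I_N.*2.+1].
have uL : uniq L by rewrite map_inj_uniq ?enum_uniq//; exact: zidx_inj.
have -> : zs F N = \sum_(k <- L) F k by rewrite big_map big_enum.
apply: esum_ge; exists [set` L]; first by split => //; exact: finite_seq.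
by rewrite -fsbig_seq// sumEFin.
Qed.

Lemma esum_zs F (B : R) : (forall k, 0 <= F k) -> (forall N, zs F N <= B) ->
  let S := fine (\esum_(k in [set: int]) (F k)%:E) in
  (forall N, zs F N <= S) /\
  (forall kappa, 0 < kappa -> exists N0, forall N, (N0 <= N)%N -> S - kappa <= zs F N).
Proof.
move=> F0 FB S.
have fin A : finite_set A -> exists N, (\sum_(k \in A) (F k)%:E <= (zs F N)%:E)%E.
  move=> fA; exists (\max_(k <- fset_set A) absz k)%N.
  rewrite fsbig_finite// sumEFin lee_fin.
  apply: sum_subset_zs => //; first exact: fset_uniq.
  move=> k kA.
  by rewrite (big_rem k)//= leq_maxl.
have E0 : (0 <= \esum_(k in [set: int]) (F k)%:E)%E.
  by apply: esum_ge0 => k _; rewrite lee_fin.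
have EB : (\esum_(k in [set: int]) (F k)%:E <= B%:E)%E.
  apply: ge_ereal_sup => _ [A [fA _] <-].
  have [N hN] := fin A fA; apply: (le_trans hN); by rewrite lee_fin.
have Efin : \esum_(k in [set: int]) (F k)%:E \is a fin_num.
  by rewrite ge0_fin_numE// (le_lt_trans EB)// ltry.
split=> [N|kappa k0]; first by rewrite -lee_fin fineK//; exact: zs_esum.
have [x [A [fA _] <-] hx] := ub_ereal_sup_adherent k0 Efin.
have [N0 hN] := fin A fA; exists N0 => N NN.
rewrite -lee_fin EFinB /S fineK//; apply: (le_trans (ltW hx)).
by apply: (le_trans hN); rewrite lee_fin zs_homo.
Qed.

End symmetric_real_sums.

Section coefficients.
Variables (R : realType) (a b : R) (c : int -> R).
Hypotheses (a0 : 0 < a) (b0 : 0 < b) (Hc : coefficients a b c).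

Lemma coefficients_gt0 k : 0 < c k.
Proof. by case: Hc => ->; rewrite mulr_gt0 ?expR_gt0. Qed.

Lemma normr_int_ge1 (k : int) : k != 0 -> 1 <= `|k%:~R : R|.
Proof. by move=> k0; rewrite -intr_norm ler1z -gtz0_ge1 normr_gt0. Qed.

Lemma coefficients_le k : c k <= a * expR (- b * `|k%:~R|).
Proof.
case: Hc => ->; rewrite ?lexx// ler_pM2l// ler_expR !mulNr lerN2 ler_pM2l//.
have [->|/normr_int_ge1 k1] := eqVneq k 0; first by rewrite normr0 expr0n.
by rewrite expr2 ler_peMr.
Qed.

Lemma coefficients_decay : exists2 A : R, 0 < A &
  forall k, k != 0 -> c k * `|k%:~R| <= A / k%:~R ^+ 2.
Proof.
exists (27 * a / b ^+ 3); first by rewrite divr_gt0 ?mulr_gt0 ?exprn_gt0.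
move=> k k0; set x : R := `|k%:~R|.
have x0 : 0 < x by rewrite normr_gt0 intr_eq0.
have -> : (k%:~R ^+ 2 : R) = x ^+ 2 by rewrite real_normK ?num_real.
apply: (@le_trans _ _ (a * expR (- b * x) * x)).
  by rewrite ler_pM2r// coefficients_le.
have y0 : 0 < b * x / 3 by rewrite divr_gt0 ?mulr_gt0.
have h : (b * x / 3) ^+ 3 <= expR (b * x).
  have -> : expR (b * x) = expR (b * x / 3) ^+ 3.
    by rewrite -expRM_natl; congr expR; field.
  rewrite lerXn2r ?nnegrE ?expR_ge0 ?(ltW y0)//.
  by apply: le_trans (expR_ge1Dx _); rewrite lerDr.
have y3 : 0 < (b * x / 3) ^+ 3 by rewrite exprn_gt0.
have e : expR (- b * x) <= ((b * x / 3) ^+ 3)^-1.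
  by rewrite mulNr expRN lef_pV2 ?posrE ?expR_gt0.
have -> : 27 * a / b ^+ 3 / x ^+ 2 = a * ((b * x / 3) ^+ 3)^-1 * x.
  by field; rewrite !gt_eqF.
by rewrite ler_pM2r// ler_pM2l.
Qed.

Lemma coefficients_summable : exists2 S : R, 0 < S &
  [/\ S = fine (\esum_(k in [set: int]) (c k ^+ 2)%:E),
      forall N, zs (fun k => c k ^+ 2) N <= S
    & forall kappa, 0 < kappa -> exists N0, forall N, (N0 <= N)%N ->
        S - kappa <= zs (fun k => c k ^+ 2) N].
Proof.
have [A A0 hA] := coefficients_decay.
have F0 k : 0 <= c k ^+ 2 by rewrite sqr_ge0.
have hF k : k != 0 -> `|c k ^+ 2| <= A ^+ 2 / k%:~R ^+ 2.
  move=> k0; have k1 := normr_int_ge1 k0; have ck := ltW (coefficients_gt0 k).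
  have k2 : 1 <= (k%:~R : R) ^+ 2 by rewrite -real_normK ?num_real// exprn_ege1.
  have k20 : 0 < (k%:~R : R) ^+ 2 by lra.
  have h : c k <= A / k%:~R ^+ 2 by apply: le_trans (hA k k0); rewrite ler_peMr.
  rewrite ger0_norm//; apply: (@le_trans _ _ ((A / k%:~R ^+ 2) ^+ 2)).
    by rewrite lerXn2r ?nnegrE ?(le_trans ck h).
  have k40 : 0 < (k%:~R ^+ 2 : R) ^+ 2 by exact: exprn_gt0.
  rewrite expr_div_n ler_pM2l ?(exprn_gt0 _ A0)// lef_pV2 ?posrE//.
  by rewrite [leRHS]expr2 ler_peMr// ltW.
have hF' k : (1 < absz k)%N -> `|c k ^+ 2| <= A ^+ 2 / k%:~R ^+ 2.
  by move=> k1; apply: hF; lia.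
have FB N : zs (fun k => c k ^+ 2) N <= zs (fun k => c k ^+ 2) 1 + 2 * A ^+ 2.
  apply: (@le_trans _ _ (zs (fun k => c k ^+ 2) N.+1)); first exact: zs_homo.
  rewrite -lerBlDl; apply: (le_trans (zs_tail (sqr_ge0 A) hF' (ltn0Sn 0) (ltn0Sn N))).
  by rewrite divr1.
have [h1 h2] := esum_zs F0 FB.
eexists; last by split; [reflexivity|exact: h1|exact: h2].
apply: lt_le_trans (h1 0%N); rewrite zs0 exprn_gt0//; exact: coefficients_gt0.
Qed.

End coefficients.

Section profiles.
Variable R : realType.
Local Notation D := (`[0, 2 * pi]%classic : set R).

Definition resonant_bounds (lam : R) (v : R -> R -> R[i]) (T K rho : R) : Prop :=
  forall eta, 0 < eta -> exists N0, forall N, (N0 <= N)%N ->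
  (forall x, D x ->
    normc (v T x) <= zs (fun k => normc (fc (v 0) k)) N + rho * K + eta) /\
  normc (zs (fun k => cis (lam * normc (fc (v 0) k) ^+ 2 * T - k%:~R ^+ 2 * T)
     * fc (v 0) k) N) <= normc (v T 0) + rho * K + eta.

Variables (c : int -> R) (A s lam T : R) (N : nat) (e : int -> R[i]) (v : R -> R -> R[i]).
Hypotheses (c0 : forall k, 0 <= c k) (A0 : 0 <= A) (s0 : 0 < s) (N0 : (0 < N)%N).
Hypothesis cA : forall k, k != 0 -> c k * `|k%:~R| <= A / k%:~R ^+ 2.
Hypothesis e_far : forall k, (N < absz k)%N -> normc (e k) <= (absz k)%:R / s.
Hypotheses (sol : nls_solution lam v) (ini : initial_datum c e (v 0)).

Lemma far_mode k : (N < absz k)%N -> c k * normc (e k) <= A / s / k%:~R ^+ 2.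
Proof.
move=> Nk; have k0 : k != 0 by lia.
apply: (@le_trans _ _ (c k * ((absz k)%:R / s))); first by rewrite ler_wpM2l// e_far.
rewrite natr_absz intr_norm mulrA [leRHS]mulrAC ler_pM2r ?invr_gt0//; exact: cA.
Qed.

Lemma initial_modes k : fc (v 0) k = (c k)%:C * e k.
Proof.
pose F k := c k * normc (e k) * k%:~R ^+ 2.
have F0 j : 0 <= F j by do ?[exact: sqr_ge0|exact: normc_ge0|exact: c0|apply: mulr_ge0].
have A'0 : 0 <= A / s + zs F N by rewrite addr_ge0 ?zs_ge0// divr_ge0// ltW.
apply: (initial_fc k A'0) => //; last first.
  by case: sol => _ _ [vc _ _ _] _; exact: ccontinuous2_slice.
move=> j j0; rewrite normcM normc_real ger0_norm//.
have j2 : 0 < j%:~R ^+ 2 :> R by rewrite exprn_even_gt0//= intr_eq0.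
case: (leqP (absz j) N) => jN.
  rewrite ler_pdivlMr//; apply: (@le_trans _ _ (zs F N)).
    have := @sum_subset_zs R F [:: j] N F0 isT.
    rewrite big_seq1; apply=> i; rewrite inE => /eqP->//.
  by rewrite lerDr divr_ge0// ltW.
apply: (le_trans (far_mode jN)).
by rewrite ler_pM2r ?invr_gt0// lerDl zs_ge0.
Qed.

Lemma zs_initial M : zs (fun k => normc (fc (v 0) k)) M <=
  zs (fun k => c k * normc (e k)) N + 2 * A / N%:R / s.
Proof.
have F0 k : 0 <= c k * normc (e k) by rewrite mulr_ge0 ?normc_ge0.
rewrite (_ : zs _ M = zs (fun k => c k * normc (e k)) M); last first.
  by apply: eq_bigr => j _; rewrite initial_modes normcM normc_real ger0_norm.
apply: le_trans (zs_homo F0 (leq_maxl M N)) _.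
rewrite -lerBlDl.
have As : 0 <= A / s by rewrite divr_ge0// ltW.
have -> : 2 * A / N%:R / s = 2 * (A / s) / N%:R by ring.
apply: zs_tail => //; last exact: leq_maxr.
by move=> k /far_mode; rewrite ger0_norm.
Qed.

Lemma profile_ub (d z S : R) : 0 < d -> 2 * d < z -> 0 < S ->
  2 * A / N%:R <= d -> zs (fun k => c k ^+ 2) N <= S ->
  \sum_(j < N.*2.+1) s ^+ 2 * normc (e (zidx j)) ^+ 2 < (z - 2 * d) ^+ 2 / S ->
  ((forall M, zs (fun k => normc (fc (v 0) k)) M <= z / s) ->
    resonant_bounds lam v T (z / s) (d / (4 * z))) ->
  forall x, D x -> normc (v T x) <= z / s.
Proof.
move=> d0 dz S0 Nd cS eS res.
pose X := z - 2 * d; have X0 : 0 < X by rewrite subr_gt0.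
have CS : zs (fun k => c k * normc (e k)) N <= X / s.
  rewrite ler_pdivlMr//.
  (* Young's inequality with the weight X / S *)
  apply: (@le_trans _ _ (\sum_(j < N.*2.+1)
     (X / S * c (zidx j) ^+ 2 + S / X * (s ^+ 2 * normc (e (zidx j)) ^+ 2)) / 2)).
    rewrite mulr_suml; apply: ler_sum => j _; rewrite -/(zidx j).
    set q := normc _; have := sqr_ge0 (X / S * c (zidx j) - s * q).
    move=> h; rewrite -subr_ge0.
    have -> : (X / S * c (zidx j) ^+ 2 + S / X * (s ^+ 2 * q ^+ 2)) / 2
       - c (zidx j) * q * s = S / X / 2 * (X / S * c (zidx j) - s * q) ^+ 2.
      by field; rewrite !gt_eqF.
    by do ?[exact: h|apply: mulr_ge0|exact: (ltW S0)|rewrite invr_ge0; exact: (ltW X0)].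
  rewrite -mulr_suml big_split/= -[X in X + _]mulr_sumr -[X in _ + X]mulr_sumr.
  have h1 : X / S * zs (fun k => c k ^+ 2) N <= X.
    rewrite mulrAC ler_pdivrMr// ler_wpM2l// ltW//.
  have h2 : S / X * \sum_(j < N.*2.+1) s ^+ 2 * normc (e (zidx j)) ^+ 2 <= X.
    apply: (@le_trans _ _ (S / X * (X ^+ 2 / S))).
      by rewrite ler_pM2l ?divr_gt0// ltW.
    by rewrite le_eqVlt; apply/orP; left; apply/eqP; field; rewrite !gt_eqF.
  rewrite ler_pdivrMr//; apply: le_trans (lerD h1 h2) _; lra.
have bound M : zs (fun k => normc (fc (v 0) k)) M <= (z - d) / s.
  apply: (le_trans (zs_initial M)); apply: (le_trans (lerD CS (lexx _))).
  rewrite -mulrDl ler_pM2r ?invr_gt0// /X; lra.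
have boundz M : zs (fun k => normc (fc (v 0) k)) M <= z / s.
  by apply: (le_trans (bound M)); rewrite ler_pM2r ?invr_gt0//; lra.
have z0 : 0 < z by lra.
have eta0 : 0 < d / (4 * s) by rewrite divr_gt0// mulr_gt0.
have [M0 hM] := res boundz _ eta0.
move=> x Dx; have [/(_ x Dx) h _] := hM M0 (leqnn _).
apply: (le_trans h); apply: (@le_trans _ _ ((z - d) / s + d / (4 * z) * (z / s) + d / (4 * s))).
  by rewrite lerD2r lerD2r.
have -> : (z - d) / s + d / (4 * z) * (z / s) + d / (4 * s) = (z - d / 2) / s.
  by field; rewrite !gt_eqF.
by rewrite ler_pM2r ?invr_gt0//; lra.
Qed.

Section lower.
Variables (d z r L : R) (y psi : int -> R).
Let Q := zs (fun k => c k + c k ^+ 3 * y k * L * (2 * y k + 1)) N.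
Hypotheses (d0 : 0 < d) (z0 : 0 < z) (Nd : 2 * A / N%:R <= d).
Hypotheses (y0 : forall k, 0 <= y k) (yz : zs (fun k => c k * y k) N = z).
Hypotheses (r0 : 0 <= r) (r1 : r <= 1) (rQ : r * Q <= d).
Hypotheses (lam0 : 0 <= lam) (T0 : 0 <= T) (lamT : lam * T / s ^+ 2 <= L).
Hypothesis psiE : forall k, psi k = k%:~R ^+ 2 * T - lam * T * c k ^+ 2 * y k ^+ 2 / s ^+ 2.
Hypothesis e_near : forall j : 'I_N.*2.+1,
  normc (s%:C * e (zidx j) - (y (zidx j))%:C * cis (psi (zidx j))) <= r.

Lemma near_modulus (j : 'I_N.*2.+1) : `|s * normc (e (zidx j)) - y (zidx j)| <= r.
Proof.
have e1 : normc (s%:C * e (zidx j)) = s * normc (e (zidx j)).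
  by rewrite normcM normc_real gtr0_norm.
have e2 : normc ((y (zidx j))%:C * cis (psi (zidx j))) = y (zidx j).
  by rewrite normcM normc_real normc_cis mulr1 ger0_norm.
rewrite ler_norml; apply/andP; split.
  rewrite lerNl opprB -e1 -e2; apply: le_trans (ler_normc_sub _ _) _.
  by rewrite normc_distrC.
by rewrite -e1 -e2; apply: le_trans (ler_normc_sub _ _) _.
Qed.

Lemma L_ge0 : 0 <= L.
Proof. by apply: le_trans lamT; rewrite divr_ge0 ?sqr_ge0// mulr_ge0. Qed.

Lemma zs_c_le_Q : zs c N <= Q.
Proof.
apply: zs_le => k; rewrite lerDl.
have := L_ge0; have := y0 k; have := c0 k => ck yk l0.
by do ?[exact: ck|exact: yk|exact: l0|exact: exprn_ge0|exact: ler01|exact: ler0n|apply: addr_ge0|apply: mulr_ge0].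
Qed.

Lemma profile_lb_l1 M : zs (fun k => normc (fc (v 0) k)) M <= (z + 2 * d) / s.
Proof.
apply: (le_trans (zs_initial M)).
have h : zs (fun k => c k * normc (e k)) N <= (z + d) / s.
  rewrite ler_pdivlMr//; apply: (@le_trans _ _ (z + r * zs c N)); last first.
    by rewrite lerD2l; apply: le_trans rQ; rewrite ler_wpM2l// zs_c_le_Q.
  rewrite -yz /zs mulr_suml mulr_sumr -big_split; apply: ler_sum => j _.
  apply: (@le_trans _ _ (c (zidx j) * (y (zidx j) + r))); last first.
    by rewrite mulrDr [_ * r]mulrC.
  rewrite -/(zidx j) -mulrA ler_wpM2l//.
  have := near_modulus j; rewrite ler_norml => /andP[_].
  by rewrite [normc _ * s]mulrC; lra.
apply: (le_trans (lerD h (lexx _))).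
by rewrite -mulrDl ler_pM2r ?invr_gt0//; have := Nd; lra.
Qed.

Lemma near_profile : z - d <= s * normc (zs (fun k =>
  cis (lam * normc (fc (v 0) k) ^+ 2 * T - k%:~R ^+ 2 * T) * fc (v 0) k) N).
Proof.
set F := fun k => _.
have main : normc (s%:C * zs F N - z%:C) <= r * Q.
  rewrite -yz -zs_realC /zs mulr_sumr -sumrB /Q /zs mulr_sumr.
  apply: le_trans (ler_normc_sum _ _ _) _; apply: ler_sum => j _; rewrite -/(zidx j).
  have := near_modulus j; have := e_near j; rewrite /F initial_modes psiE.
  set k := zidx j => h1 h2; have ck := c0 k; have yk := y0 k.
  pose th := lam * normc ((c k)%:C * e k) ^+ 2 * T - k%:~R ^+ 2 * T.
  rewrite -/th.
  pose ps := k%:~R ^+ 2 * T - lam * T * c k ^+ 2 * y k ^+ 2 / s ^+ 2; rewrite -/ps in h1.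
  have -> : s%:C * (cis th * ((c k)%:C * e k)) - (c k * y k)%:C =
     (c k)%:C * (cis th * (s%:C * e k - (y k)%:C * cis ps) + (y k)%:C * (cis (th + ps) - 1)).
    rewrite (cisD th ps) realCM; clearbody th ps.
    by move: (cis th) (cis ps) (s%:C) (c k)%:C (y k)%:C (e k) => *; ring.
  rewrite normcM normc_real ger0_norm//.
  have -> : r * (c k + c k ^+ 3 * y k * L * (2 * y k + 1)) =
    c k * (r + y k * (L * c k ^+ 2 * (r * (2 * y k + 1)))) by ring.
  rewrite ler_wpM2l//; apply: le_trans (ler_normcD _ _) _; apply: lerD.
    by rewrite normcM normc_cis mul1r.
  rewrite normcM normc_real ger0_norm// ler_wpM2l//.
  apply: le_trans (normc_cisB1 _) _.
  have -> : th + ps = lam * T / s ^+ 2 * c k ^+ 2 *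
     ((s * normc (e k) - y k) * (s * normc (e k) + y k)).
    rewrite /th /ps normcM normc_real ger0_norm//.
    by field; rewrite gt_eqF.
  have l0 : 0 <= lam * T / s ^+ 2 by rewrite divr_ge0 ?sqr_ge0// mulr_ge0.
  rewrite normrM ger0_norm; last by rewrite mulr_ge0 ?sqr_ge0.
  apply: ler_pM => //; first by rewrite mulr_ge0 ?sqr_ge0.
    by rewrite ler_wpM2r ?sqr_ge0.
  rewrite normrM; apply: ler_pM => //.
  rewrite ger0_norm; last by rewrite addr_ge0// mulr_ge0 ?normc_ge0 ?ltW.
  by move: h2; rewrite ler_norml => /andP[_]; have := r1; lra.
have h : z - normc (s%:C * zs F N) <= d.
  apply: le_trans rQ; apply: le_trans main; rewrite normc_distrC.
  by apply: le_trans (ler_normc_sub _ _); rewrite normc_real gtr0_norm.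
have <- : normc (s%:C * zs F N) = s * normc (zs F N).
  by rewrite normcM normc_real gtr0_norm.
by rewrite lerBlDr -lerBlDl.
Qed.

Lemma profile_lb : resonant_bounds lam v T ((z + 2 * d) / s) (d / (2 * (z + 2 * d))) ->
  (z - 4 * d) / s < normc (v T 0).
Proof.
move=> res.
have K0 : 0 < z + 2 * d by have := z0; have := d0; lra.
have eta0 : 0 < d / (4 * s) by rewrite divr_gt0// mulr_gt0.
have [M0 /(_ (maxn M0 N) (leq_maxl _ _))[_]] := res _ eta0.
set F := fun k => _ => h1.
have As : 0 <= A / s by rewrite divr_ge0// ltW.
have hF k : (N < absz k)%N -> normc (F k) <= A / s / k%:~R ^+ 2.
  move=> /far_mode; rewrite /F normcM normc_cis mul1r initial_modes.
  by rewrite normcM normc_real ger0_norm.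
have h2 := zs_complex_tail As hF N0 (leq_maxr M0 N).
have h3 : normc (zs F N) - normc (zs F (maxn M0 N)) <= d / s.
  apply: le_trans (ler_normc_sub _ _) _; rewrite normc_distrC.
  apply: (le_trans h2).
  have -> : 2 * (A / s) / N%:R = 2 * A / N%:R / s by ring.
  by rewrite ler_pM2r ?invr_gt0.
have h4 : (z - d) / s <= normc (zs F N) by rewrite ler_pdivrMr// mulrC near_profile.
have e1 : d / (2 * (z + 2 * d)) * ((z + 2 * d) / s) = d / s / 2.
  by field; rewrite !gt_eqF.
have e2 : d / (4 * s) = d / s / 4 by field; rewrite gt_eqF.
rewrite e1 e2 in h1.
have ds : 0 < d / s by rewrite divr_gt0.
have -> : (z - 4 * d) / s = (z - d) / s - 3 * (d / s) by ring.
lra.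
Qed.

End lower.
End profiles.

Section small_parameter.
Variable R : realType.
Implicit Types eps : R.

Lemma near0_le (x : R) : 0 < x -> \forall eps \near 0^'+, eps <= x.
Proof.
move=> x0; near=> eps; apply: ltW; near: eps; exact: nbhs_right_lt.
Unshelve. all: by end_near. Qed.

Lemma near0_powR (g x : R) : 0 < g -> 0 < x -> \forall eps \near 0^'+, eps `^ g <= x.
Proof.
move=> g0 x0; near=> eps.
have e0 : 0 < eps by near: eps; exact: nbhs_right_gt.
have -> : x = (x `^ g^-1) `^ g by rewrite -powRrM mulVf ?gt_eqF// powRr1// ltW.
apply: (ge0_ler_powR (ltW g0)); rewrite ?nnegrE ?powR_ge0 ?(ltW e0)//.
near: eps; apply: near0_le; exact: powR_gt0.
Unshelve. all: by end_near. Qed.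

Lemma near0_expR (B kappa : R) : 0 < B -> 0 < kappa ->
  \forall eps \near 0^'+, B <= expR (kappa / eps).
Proof.
move=> B0 k0; near=> eps.
have e0 : 0 < eps by near: eps; exact: nbhs_right_gt.
have h : eps <= kappa / B by near: eps; apply: near0_le; rewrite divr_gt0.
apply: le_trans (expR_ge1Dx _).
apply: (@le_trans _ _ (kappa / eps)); last by rewrite lerDr.
by rewrite ler_pdivlMr// mulrC -ler_pdivlMr.
Unshelve. all: by end_near. Qed.

Lemma log_limit (p : R -> R) (I : R) :
  (forall kappa, 0 < kappa -> \forall eps \near 0^'+,
     expR (- ((I + kappa) / eps)) <= p eps <= expR (- ((I - kappa) / eps))) ->
  (fun eps => eps%:E * lne (p eps)%:E)%E @ 0^'+ --> (- I)%:E.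
Proof.
move=> hp; pose f eps := (eps * ln (p eps))%:E.
have ev : \forall eps \near 0^'+, f eps = (eps%:E * lne (p eps)%:E)%E.
  near=> eps.
  have /andP[h _] : expR (- ((I + 1) / eps)) <= p eps <= expR (- ((I - 1) / eps)).
    by near: eps; exact: hp.
  have p0 : 0 < p eps by apply: lt_le_trans h; exact: expR_gt0.
  by rewrite lne_EFin.
apply: (cvg_trans (near_eq_cvg ev)); apply: cvg_EFin; first exact: nearW.
apply/cvgrPdist_le => kappa k0; near=> eps.
have e0 : 0 < eps by near: eps; exact: nbhs_right_gt.
have /andP[h1 h2] : expR (- ((I + kappa) / eps)) <= p eps <= expR (- ((I - kappa) / eps)).
  by near: eps; exact: hp.
have p0 : 0 < p eps by apply: lt_le_trans h1; exact: expR_gt0.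
have := h1; rewrite -ler_ln ?posrE ?expR_gt0// expRK -mulNr ler_pdivrMr// => h3.
have := h2; rewrite -ler_ln ?posrE ?expR_gt0// expRK -mulNr ler_pdivlMr// => h4.
rewrite /f /=; move: h3 h4; rewrite mulrC; set x := eps * _ => h3 h4.
by rewrite ler_norml; apply/andP; split; lra.
Unshelve. all: by end_near. Qed.

Lemma regime (alpha beta : R) (t : R -> R) : time_scale beta t ->
  alpha - 1 > beta \/ (alpha - 1 = beta /\ beta > 0) ->
  exists2 L : R, 0 < L & forall mu, 0 < mu -> \forall eps \near 0^'+,
    eps `^ alpha * t eps / eps <= L /\
    (eps `^ alpha / eps <= mu \/ eps `^ alpha * t eps / eps <= mu).
Proof.
move=> [C [C1 Ct]] cond; have C0 : 0 < C by lra.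
exists C => // mu mu0.
have powD (x r q : R) : 0 < x -> x `^ (r + q) = x `^ r * x `^ q.
  by move=> x0; rewrite powRD// (gt_eqF x0) implybT.
have e1 eps : 0 < eps -> eps `^ alpha / eps = eps `^ (alpha - 1).
  by move=> e0; rewrite powD// powR_inv1// ltW.
have ub : \forall eps \near 0^'+,
    eps `^ alpha * t eps / eps <= C * eps `^ (alpha - 1 - beta).
  near=> eps.
  have e0 : 0 < eps by near: eps; exact: nbhs_right_gt.
  have [_ h] : C^-1 * eps `^ (- beta) <= t eps /\ t eps <= C * eps `^ (- beta).
    by near: eps; exact: Ct.
  rewrite mulrAC e1// (powD _ _ (- beta))// mulrCA.
  by rewrite ler_wpM2l ?powR_ge0.
case: cond => [ab|[ab b0]].
  have g0 : 0 < alpha - 1 - beta by rewrite subr_gt0.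
  have m0 : 0 < Num.min 1 (mu / C) by rewrite lt_min ltr01 divr_gt0.
  near=> eps.
  have h1 : eps `^ alpha * t eps / eps <= C * eps `^ (alpha - 1 - beta).
    by near: eps; exact: ub.
  have h2 : eps `^ (alpha - 1 - beta) <= Num.min 1 (mu / C).
    by near: eps; exact: near0_powR.
  move: h2; rewrite le_min => /andP[h2 h3].
  split; first by apply: (le_trans h1); rewrite ler_piMr// ltW.
  right; apply: (le_trans h1).
  by rewrite mulrC -ler_pdivlMr.
near=> eps.
have e0 : 0 < eps by near: eps; exact: nbhs_right_gt.
split.
  apply: (@le_trans _ _ (C * eps `^ (alpha - 1 - beta))); first by near: eps; exact: ub.
  by rewrite ab subrr powRr0 mulr1.
left; rewrite e1// ab; near: eps; exact: near0_powR.
Unshelve. all: by end_near. Qed.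

Lemma near0_resonant_bounds (alpha L : R) (t : R -> R) :
  0 < L -> (forall eps, 0 < eps -> 0 < t eps) ->
  (forall mu, 0 < mu -> \forall eps \near 0^'+,
    eps `^ alpha * t eps / eps <= L /\
    (eps `^ alpha / eps <= mu \/ eps `^ alpha * t eps / eps <= mu)) ->
  forall K rho, 0 < K -> 0 < rho -> \forall eps \near 0^'+, forall v,
    nls_solution (eps `^ alpha) v ->
    (forall M, zs (fun k => normc (fc (v 0) k)) M <= K / Num.sqrt eps) ->
    resonant_bounds (eps `^ alpha) v (t eps) (K / Num.sqrt eps) rho.
Proof.
move=> L0 t0 hreg K rho K0 rho0.
have K20 : 0 < K ^+ 2 by rewrite exprn_gt0.
have [mu mu0 main] := @nls_resonant R (K ^+ 2 * L) rho (ltW (mulr_gt0 K20 L0)) rho0.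
have m0 : 0 < mu / K ^+ 2 by rewrite divr_gt0.
near=> eps => v sol hK.
have e0 : 0 < eps by near: eps; exact: nbhs_right_gt.
have [h1 h2] : eps `^ alpha * t eps / eps <= L /\
    (eps `^ alpha / eps <= mu / K ^+ 2 \/ eps `^ alpha * t eps / eps <= mu / K ^+ 2).
  by near: eps; exact: hreg.
have s0 : 0 < Num.sqrt eps by rewrite sqrtr_gt0.
apply: main => //; [exact: powR_gt0|exact: divr_gt0|exact: ltW (t0 _ e0)|].
rewrite expr_div_n sqr_sqrtr ?(ltW e0)//.
have -> : eps `^ alpha * (K ^+ 2 / eps) * t eps = K ^+ 2 * (eps `^ alpha * t eps / eps) by ring.
have -> : eps `^ alpha * (K ^+ 2 / eps) = K ^+ 2 * (eps `^ alpha / eps) by ring.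
case: h2 => h2; [left|right]; last by rewrite mulrC -ler_pdivlMr.
by split; [rewrite ler_pM2l|rewrite mulrC -ler_pdivlMr].
Unshelve. all: by end_near. Qed.

End small_parameter.

Section large_deviations.
Context (R : realType) (d : measure_display) (Omega : measurableType d).
Variables (P : probability Omega R) (a b : R) (c : int -> R) (eta : int -> Omega -> R[i]).
Variables (alpha z0 : R) (t : R -> R) (u : R -> Omega -> R -> R -> R[i]).
Hypotheses (a0 : 0 < a) (b0 : 0 < b) (Hc : coefficients a b c).
Hypotheses (Heta : standard_complex_gaussians P eta) (z00 : 0 < z0).
Let Q eps w := nls_solution (eps `^ alpha) (u eps w) /\
  initial_datum c (fun k => eta k w) (u eps w 0).
Hypothesis HQ : forall eps : R, 0 < eps -> {ae P, forall w, Q eps w}.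
Hypothesis t0 : forall eps : R, 0 < eps -> 0 < t eps.
Variable L : R.
Hypothesis L0 : 0 < L.
Hypothesis hreg : forall mu, 0 < mu -> \forall eps \near 0^'+,
  eps `^ alpha * t eps / eps <= L /\
  (eps `^ alpha / eps <= mu \/ eps `^ alpha * t eps / eps <= mu).
Variable S : R.
Hypotheses (S0 : 0 < S) (cS : forall N, zs (fun k => c k ^+ 2) N <= S).
Hypothesis Sc : forall kappa, 0 < kappa -> exists N0, forall N, (N0 <= N)%N ->
  S - kappa <= zs (fun k => c k ^+ 2) N.

Let event eps := [set w |
  ((z0 * eps `^ (- 2^-1))%:E < sup_torus (u eps w (t eps)))%E].

Let thresholdE eps : 0 < eps -> z0 * eps `^ (- 2^-1) = z0 / Num.sqrt eps.
Proof. by move=> e0; rewrite powRN powR12_sqrt// ltW. Qed.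

Let c_ge0 k : 0 <= c k.
Proof. exact: ltW (coefficients_gt0 a0 Hc k). Qed.

Let far N eps := [set w | exists k : int, (N < absz k)%N /\
  (absz k)%:R / Num.sqrt eps < normc (eta k w)].

Let not_far N eps w : ~ far N eps w -> forall k, (N < absz k)%N ->
  normc (eta k w) <= (absz k)%:R / Num.sqrt eps.
Proof.
move=> nf k Nk; rewrite leNgt; apply/negP => h; apply: nf.
by exists k.
Qed.

Let large_index (x : R) : exists2 N, (0 < N)%N & x <= N%:R.
Proof.
exists (Num.truncn x).+1 => //.
by rewrite ltW// truncnS_gt.
Qed.

Lemma event_ub (kappa : R) : 0 < kappa ->
  \forall eps \near 0^'+, pr P (event eps) <= expR (- ((z0 ^+ 2 / S - kappa) / eps)).
Proof.
move=> k0; have [A A0 cA] := coefficients_decay a0 b0 Hc.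
pose D := Num.min (z0 / 4) (kappa * S / (12 * z0)).
have D0 : 0 < D by rewrite lt_min !divr_gt0// ?mulr_gt0.
have Dz : D <= z0 / 4 by rewrite ge_min lexx.
have Dk : D * (12 * z0) <= kappa * S.
  by rewrite -ler_pdivlMr ?mulr_gt0// ge_min lexx orbT.
pose r := (z0 - 2 * D) ^+ 2 / S.
have X0 : 0 < z0 - 2 * D by lra.
have r0 : 0 < r by rewrite divr_gt0// exprn_gt0.
have r1 : r <= z0 ^+ 2 / S.
  by rewrite ler_pM2r ?invr_gt0// lerXn2r ?nnegrE; lra.
have r2 : z0 ^+ 2 / S - kappa / 3 <= r.
  rewrite lerBlDr ler_pdivrMr// mulrDl divfK ?gt_eqF//.
  have := sqr_ge0 D; move: Dk; rewrite !expr2; nra.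
pose k' := Num.min (kappa / 3) (r / 2).
have k'0 : 0 < k' by rewrite lt_min (divr_gt0 k0)//= (divr_gt0 r0).
have k'k : k' <= kappa / 3 by rewrite ge_min lexx.
have k'r : k' < r.
  by apply: (@le_lt_trans _ _ (r / 2)); [rewrite ge_min lexx orbT|lra].
have [N N0 hN] := large_index (2 * A / D + 2 * (z0 ^+ 2 / S)).
have AD0 : 0 <= 2 * A / D by rewrite divr_ge0 ?mulr_ge0// ltW.
have I0 : 0 <= z0 ^+ 2 / S by rewrite divr_ge0 ?sqr_ge0// ltW.
have n0 : 0 < N%:R :> R by rewrite ltr0n.
have AN : 2 * A / N%:R <= D.
  rewrite ler_pdivrMr// [leRHS]mulrC -ler_pdivrMr//; lra.
have IN : 2 * (z0 ^+ 2 / S) <= N%:R by lra.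
have [C1 C10 far_ub] := large_modes_ub Heta.
have [C2 C20 en_ub] := energy_ub Heta N k'0 k'r.
have rho0 : 0 < D / (4 * z0) by rewrite divr_gt0// mulr_gt0.
near=> eps.
have e0 : 0 < eps by near: eps; exact: nbhs_right_gt.
have e1 : eps <= 1 by near: eps; exact: near0_le.
have hres : forall v, nls_solution (eps `^ alpha) v ->
    (forall M, zs (fun k => normc (fc (v 0) k)) M <= z0 / Num.sqrt eps) ->
    resonant_bounds (eps `^ alpha) v (t eps) (z0 / Num.sqrt eps) (D / (4 * z0)).
  by near: eps; exact: (near0_resonant_bounds L0 t0 hreg).
have hC : C1 + C2 <= expR (kappa / 3 / eps).
  by near: eps; apply: near0_expR; [exact: addr_gt0|exact: divr_gt0].
have s0 : 0 < Num.sqrt eps by rewrite sqrtr_gt0.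
pose energy := [set w | r <= \sum_(j < N.*2.+1) eps * normc (eta (zidx j) w) ^+ 2].
have sub : event eps `<=` [set w | ~ Q eps w] `|` (far N eps `|` energy).
  move=> w; rewrite /event /= thresholdE// => hw.
  case: (pselect (Q eps w)) => [[sol ini]|]; last by left.
  right; case: (pselect (far N eps w)) => [|/not_far hf]; [by left|right].
  rewrite /energy /= leNgt; apply/negP => hen.
  move: hw; apply/negP; rewrite -leNgt.
  apply: ge_ereal_sup => _ [x Dx <-]; rewrite lee_fin.
  have s2 : Num.sqrt eps ^+ 2 = eps by rewrite sqr_sqrtr// ltW.
  apply: (@profile_ub R c A (Num.sqrt eps) (eps `^ alpha) (t eps) N
    (fun k => eta k w) (u eps w) c_ge0 (ltW A0) s0 N0 cA hf sol ini D z0 S) => //.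
  - lra.
  - by rewrite s2.
  - exact: hres.
apply: (le_trans (pr_le P sub)); apply: (le_trans (prU _ _ _)).
rewrite (pr_ae (HQ e0)) add0r; apply: (le_trans (prU _ _ _)).
apply: (le_trans (lerD (far_ub N eps e0 e1) (en_ub eps e0))).
pose W := expR (- ((r - k') / eps)).
have f1 : expR (- (N%:R / (2 * eps))) <= W.
  rewrite ler_expR lerN2 invfM mulrA ler_pM2r ?invr_gt0//; lra.
apply: (@le_trans _ _ ((C1 + C2) * W)).
  by rewrite [leRHS]mulrDl lerD2r ler_pM2l.
apply: (@le_trans _ _ (expR (kappa / 3 / eps) * W)); first by rewrite ler_pM2r ?expR_gt0.
rewrite -expRD ler_expR -mulNr -mulNr -mulrDl ler_pM2r ?invr_gt0//; lra.
Unshelve. all: by end_near. Qed.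

Lemma event_lb (kappa : R) : 0 < kappa ->
  \forall eps \near 0^'+, expR (- ((z0 ^+ 2 / S + kappa) / eps)) <= pr P (event eps).
Proof.
move=> k0; have z0p := z00; have Sp := S0.
have [A A0 cA] := coefficients_decay a0 b0 Hc.
pose D := Num.min 1 (kappa * S / (4 * (8 * z0 + 16))).
have z16 : 0 < 8 * z0 + 16 by lra.
have D0 : 0 < D by rewrite lt_min ltr01 !divr_gt0// mulr_gt0.
have D1 : D <= 1 by rewrite ge_min lexx.
have Dk : D * (4 * (8 * z0 + 16)) <= kappa * S.
  by rewrite -ler_pdivlMr ?mulr_gt0// ge_min lexx orbT.
pose z := z0 + 4 * D; have zp : 0 < z by rewrite /z; lra.
pose k1 := Num.min (S / 4) (kappa * S ^+ 2 / (8 * z ^+ 2)).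
have z2 : 0 < z ^+ 2 by rewrite exprn_gt0.
have S2 : 0 < S ^+ 2 by rewrite exprn_gt0.
have k10 : 0 < k1 by rewrite lt_min !divr_gt0// mulr_gt0.
have k1S : k1 <= S / 4 by rewrite ge_min lexx.
have k1z : k1 * (8 * z ^+ 2) <= kappa * S ^+ 2.
  by rewrite -ler_pdivlMr ?mulr_gt0// ge_min lexx orbT.
have [N1 hN1] := Sc k10.
have I0 : 0 <= z0 ^+ 2 / S by rewrite divr_ge0 ?sqr_ge0// ltW.
have AD0 : 0 <= 2 * A / D by rewrite divr_ge0 ?mulr_ge0// ltW.
have [N2 N20 hN2] := large_index (2 * A / D + 2 * (z0 ^+ 2 / S + kappa)).
pose N := maxn N1 N2.
have N0 : (0 < N)%N by rewrite /N leq_max N20 orbT.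
have n0 : 0 < N%:R :> R by rewrite ltr0n.
have hN : 2 * A / D + 2 * (z0 ^+ 2 / S + kappa) <= N%:R.
  by apply: (le_trans hN2); rewrite ler_nat leq_maxr.
have AN : 2 * A / N%:R <= D.
  rewrite ler_pdivrMr// [leRHS]mulrC -ler_pdivrMr//; lra.
have IN : 2 * (z0 ^+ 2 / S + kappa) <= N%:R by lra.
pose SN := zs (fun k => c k ^+ 2) N.
have SN1 : S - k1 <= SN by apply: hN1; exact: leq_maxl.
have SN0 : 0 < SN by lra.
have J : z ^+ 2 / SN <= z0 ^+ 2 / S + kappa / 2.
  have j1 : z ^+ 2 <= z0 ^+ 2 + kappa * S / 4.
    rewrite /z; have : D * D <= D by rewrite ler_piMl// ltW.
    by move: Dk; rewrite !expr2; nra.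
  rewrite ler_pdivrMr//.
  have -> : (z0 ^+ 2 / S + kappa / 2) * SN = (z0 ^+ 2 + kappa * S / 2) * SN / S.
    by field; rewrite gt_eqF.
  rewrite ler_pdivlMr//.
  have j2 : kappa * S ^+ 2 * z ^+ 2 <= kappa * S ^+ 2 * (z0 ^+ 2 + kappa * S / 4).
    by rewrite ler_pM2l// mulr_gt0.
  have j3 : (z0 ^+ 2 + kappa * S / 2) * (S - k1) <= (z0 ^+ 2 + kappa * S / 2) * SN.
    by rewrite ler_wpM2l// addr_ge0 ?sqr_ge0// ltW// divr_gt0// mulr_gt0.
  apply: le_trans j3.
  have j4 : kappa * S * k1 <= kappa * S * (S / 4) by rewrite ler_pM2l// mulr_gt0.
  have j5 : z ^+ 2 * S <= (z0 ^+ 2 + kappa * S / 4) * S by rewrite ler_pM2r.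
  have j6 : z0 ^+ 2 * k1 * 8 <= kappa * S ^+ 2.
    have zz : z0 ^+ 2 <= z ^+ 2 by rewrite lerXn2r ?nnegrE ?(ltW zp) ?(ltW z0p)// /z; lra.
    by apply: le_trans k1z; have := ler_wpM2l (ltW k10) zz; lra.
  apply: (le_trans j5); rewrite expr2 in j6; lra.
pose y k := z * c k / SN.
have y0 k : 0 <= y k by rewrite divr_ge0 ?mulr_ge0// ltW.
have yz : zs (fun k => c k * y k) N = z.
  transitivity (z / SN * SN); last by rewrite divfK// gt_eqF.
  rewrite -[X in _ = _ * X]/(zs (fun k => c k ^+ 2) N) /zs mulr_sumr; apply: eq_bigr => j _.
  by rewrite /y; ring.
have yy : zs (fun k => y k ^+ 2) N = z ^+ 2 / SN.
  transitivity (z ^+ 2 / SN ^+ 2 * SN); last by field; rewrite gt_eqF.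
  rewrite -[X in _ = _ * X]/(zs (fun k => c k ^+ 2) N) /zs mulr_sumr; apply: eq_bigr => j _.
  by rewrite /y; field; rewrite gt_eqF.
pose q := zs (fun k => c k + c k ^+ 3 * y k * L * (2 * y k + 1)) N.
have q0 : 0 <= q.
  apply: zs_ge0 => k; have := ltW L0; have := y0 k; have := c_ge0 k => ck yk l0.
  by do ?[exact: ck|exact: yk|exact: l0|exact: exprn_ge0|exact: ler01|exact: ler0n|apply: addr_ge0|apply: mulr_ge0].
pose r := Num.min 1 (D / (q + 1)).
have q1 : 0 < q + 1 by lra.
have r0 : 0 < r by rewrite lt_min ltr01 divr_gt0.
have r1 : r <= 1 by rewrite ge_min lexx.
have rq : r * q <= D.
  apply: (@le_trans _ _ (r * (q + 1))); first by rewrite ler_pM2l// lerDl.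
  by rewrite -ler_pdivlMr// ge_min lexx orbT.
pose n := N.*2.+1; have np : 0 < n%:R :> R by rewrite ltr0n.
pose kn := kappa / (4 * n%:R).
have kn0 : 0 < kn by rewrite divr_gt0// mulr_gt0.
pose ball (j : 'I_n) eps p p' := [set w |
  (reC (eta (@zidx N j) w) - y (zidx j) * p / Num.sqrt eps) ^+ 2 +
  (imC (eta (@zidx N j) w) - y (zidx j) * p' / Num.sqrt eps) ^+ 2 <= r ^+ 2 / eps].
have balls : \forall eps \near 0^'+, forall (j : 'I_n) p p', p ^+ 2 + p' ^+ 2 = 1 ->
    expR (- ((y (@zidx N j) ^+ 2 + kn) / eps)) <= pr P (ball j eps p p').
  apply: filter_forall => j.
  have [e1 e10 he] := ball_lb Heta (y0 (@zidx N j)) r0 kn0.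
  near=> eps.
  have h1 : 0 < eps by near: eps; exact: nbhs_right_gt.
  have h2 : eps < e1 by near: eps; exact: nbhs_right_lt.
  by move=> p p' pp; exact: he.
have [C1 C10 far_ub] := large_modes_ub Heta.
pose K := z + 2 * D; have K0 : 0 < K by rewrite /K; lra.
have rho0 : 0 < D / (2 * K) by rewrite divr_gt0// mulr_gt0.
near=> eps.
have e0 : 0 < eps by near: eps; exact: nbhs_right_gt.
have e1 : eps <= 1 by near: eps; exact: near0_le.
have hres : forall v, nls_solution (eps `^ alpha) v ->
    (forall M, zs (fun k => normc (fc (v 0) k)) M <= K / Num.sqrt eps) ->
    resonant_bounds (eps `^ alpha) v (t eps) (K / Num.sqrt eps) (D / (2 * K)).
  by near: eps; exact: (near0_resonant_bounds L0 t0 hreg).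
have hC : C1 + 1 <= expR (kappa / 4 / eps).
  by near: eps; apply: near0_expR; [exact: addr_gt0|exact: divr_gt0].
have [hL _] : eps `^ alpha * t eps / eps <= L /\
    (eps `^ alpha / eps <= 1 \/ eps `^ alpha * t eps / eps <= 1).
  by near: eps; exact: hreg.
have hballs : forall (j : 'I_n) p p', p ^+ 2 + p' ^+ 2 = 1 ->
    expR (- ((y (@zidx N j) ^+ 2 + kn) / eps)) <= pr P (ball j eps p p').
  by near: eps; exact: balls.
pose s := Num.sqrt eps; have s0 : 0 < s by rewrite sqrtr_gt0.
have s2 : s ^+ 2 = eps by rewrite sqr_sqrtr// ltW.
pose lam := eps `^ alpha; pose T := t eps.
have lam0 : 0 <= lam by exact: powR_ge0.
have T0 : 0 <= T by exact: ltW (t0 e0).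
pose psi k := k%:~R ^+ 2 * T - lam * T * c k ^+ 2 * y k ^+ 2 / s ^+ 2.
pose box := [set w | forall j : 'I_n, [set p : R * R |
  (p.1 - y (@zidx N j) * cos (psi (zidx j)) / s) ^+ 2 +
  (p.2 - y (@zidx N j) * sin (psi (zidx j)) / s) ^+ 2 <= r ^+ 2 / eps]
  (pairC (eta (@zidx N j) w))].
have sub : box `<=` event eps `|` ([set w | ~ Q eps w] `|` far N eps).
  move=> w hw; case: (pselect (Q eps w)) => [[sol ini]|]; last by right; left.
  case: (pselect (far N eps w)) => [|/not_far hf]; [by right; right|left].
  rewrite /event /= thresholdE//.
  have near_e (j : 'I_N.*2.+1) :
      normc (s%:C * eta (zidx j) w - (y (zidx j))%:C * cis (psi (zidx j))) <= r.
    have := hw j; rewrite /=; set x := eta _ w; set yj := y _; set p := psi _ => h.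
    rewrite -(ler_pXn2r (n := 2))// ?nnegrE ?normc_ge0 ?(ltW r0)// sqr_normcE.
    rewrite reCD imCD reCN imCN !reCM !imCM.
    have -> : s * reC x - 0 * imC x - (yj * cos p - 0 * sin p) =
      s * (reC x - yj * cos p / s) by field; rewrite gt_eqF.
    have -> : s * imC x + 0 * reC x - (yj * sin p + 0 * cos p) =
      s * (imC x - yj * sin p / s) by field; rewrite gt_eqF.
    by rewrite !exprMn -mulrDr s2 mulrC -ler_pdivlMr.
  have hL' : lam * T / s ^+ 2 <= L by rewrite s2.
  have lb := @profile_lb R c A s lam T N (fun k => eta k w) (u eps w) c_ge0 (ltW A0)
    s0 N0 cA hf sol ini D z r L y psi D0 zp AN y0 yz r1 rq lam0 T0 hL'
    (fun k => erefl) near_e.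
  have lb1 := @profile_lb_l1 R c A s lam T N (fun k => eta k w) (u eps w) c_ge0 (ltW A0)
    s0 N0 cA hf sol ini D z r L y psi AN y0 yz (ltW r0) rq lam0 T0 hL' near_e.
  have := lb (hres _ sol lb1).
  have -> : z - 4 * D = z0 by rewrite /z; ring.
  move=> h; apply: (@lt_le_trans _ _ (normc (u eps w T 0))%:E); first by rewrite lte_fin.
  apply: ereal_sup_ubound; exists 0 => //=.
  by rewrite in_itv/= lexx mulr_ge0// pi_ge0.
have box_lb : expR (- ((z0 ^+ 2 / S + 3 * kappa / 4) / eps)) <= pr P box.
  rewrite /box (@pr_independent _ _ _ P eta Heta 'I_n (@zidx N) (fun j => [set p : R * R |
    (p.1 - y (@zidx N j) * cos (psi (zidx j)) / s) ^+ 2 +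
    (p.2 - y (@zidx N j) * sin (psi (zidx j)) / s) ^+ 2 <= r ^+ 2 / eps])); last 2 first.
  - by move=> i j /zidx_inj.
  - by move=> j; exact: measurable_sqdist.
  apply: (@le_trans _ _ (\prod_(j < n) expR (- ((y (@zidx N j) ^+ 2 + kn) / eps)))).
    rewrite -expR_sum ler_expR sumrN lerN2 -mulr_suml ler_pM2r ?invr_gt0//.
    rewrite big_split/= sumr_const card_ord.
    have -> : kn *+ n = kappa / 4 by rewrite -mulr_natr /kn; field; rewrite gt_eqF.
    rewrite [X in X + _](_ : _ = z ^+ 2 / SN); last exact: yy.
    lra.
  apply: ler_prod => j _; rewrite expR_ge0 /=; apply: hballs.
  by rewrite cos2Dsin2.
have := le_trans box_lb (le_trans (pr_le P sub) (le_trans (prU _ _ _) (lerD (lexx _) (prU _ _ _)))).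
rewrite (pr_ae (HQ e0)) add0r => hbox.
have fub := far_ub N eps e0 e1.
pose W := expR (- ((z0 ^+ 2 / S + kappa) / eps)).
have W0 : 0 < W by exact: expR_gt0.
have f1 : C1 * expR (- (N%:R / (2 * eps))) <= C1 * W.
  rewrite ler_pM2l// ler_expR lerN2 invfM mulrA ler_pM2r ?invr_gt0//; lra.
have f2 : (C1 + 1) * W <= expR (- ((z0 ^+ 2 / S + 3 * kappa / 4) / eps)).
  apply: (@le_trans _ _ (expR (kappa / 4 / eps) * W)); first by rewrite ler_pM2r.
  rewrite -expRD ler_expR -mulNr -mulNr -mulrDl ler_pM2r ?invr_gt0//; lra.
have h : pr P (far N eps) <= C1 * W by apply: le_trans f1.
rewrite -/W; lra.
Unshelve. all: by end_near. Qed.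

End large_deviations.

Theorem theorem1p6 (R : realType) (d : measure_display)
    (Omega : measurableType d) (P : probability Omega R)
    (a b : R) (c : int -> R) (eta : int -> Omega -> R[i])
    (alpha beta z0 : R) (t : R -> R) (u : R -> Omega -> R -> R -> R[i]) :
  0 < a -> 0 < b -> coefficients a b c ->
  standard_complex_gaussians P eta ->
  0 < alpha -> 0 < z0 ->
  (forall eps : R, 0 < eps -> {ae P, forall w,
     nls_solution (eps `^ alpha) (u eps w) /\
     initial_datum c (fun k => eta k w) (u eps w 0)}) ->
  (forall eps : R, 0 < eps -> 0 < t eps) ->
  time_scale beta t ->
  alpha - 1 > beta \/ (alpha - 1 = beta /\ beta > 0) ->
  (fun eps : R => (eps%:E * lne (Prob P
     [set w | ((z0 * eps `^ (- 2^-1))%:E < sup_torus (u eps w (t eps)))%E]))%E)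
    @ 0^'+ -->
  (- (z0 ^+ 2 / fine (\esum_(k in [set: int]) (c k ^+ 2)%:E)))%:E.
Proof.
move=> a0 b0 Hc Heta _ z00 HQ t0 Ht cond.
have [L L0 hreg] := regime Ht cond.
have [S S0 [<- cS Sc]] := coefficients_summable a0 b0 Hc.
under eq_fun do rewrite -prE.
apply: log_limit => kappa k0; near=> eps; apply/andP; split.
  by near: eps; exact: (event_lb a0 b0 Hc Heta z00 HQ t0 L0 hreg S0 Sc).
by near: eps; exact: (event_ub a0 b0 Hc Heta z00 HQ t0 L0 hreg S0 cS).
Unshelve. all: by end_near. Qed.
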